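(* Let $G$ be a countable discrete abelian group, $g\mapsto U(g)$ a unitary representation of $G$ on a separable Hilbert space $\mathcal{H}$, and let $\Phi=\{\varphi_1,\dots,\varphi_N\}\subset\mathcal{H}$ be such that $\{U(g)\varphi_n\}_{g\in G;\,n=1,\dots,N}$ is a Riesz sequence in $\mathcal{H}$. Let $$\mathcal{V}_\Phi=\Big\{\sum_{n=1}^N\sum_{g\in G}x_n(g)\,U(g)\varphi_n\ :\ x_n\in\ell^2(G),\ n=1,\dots,N\Big\}.$$ Let $A=[a_{m,n}]$ be an $M\times N$ matrix with entries in $\ell^2(G)$ and, for each $f=\sum_{n=1}^N\sum_{g\in G}x_n(g)U(g)\varphi_n\in\mathcal{V}_\Phi$ with coefficient vector $\mathbf{x}=(x_1,\dots,x_N)^\top\in\ell^2_N(G)$, define its samples by $$\boldsymbol{\mathcal{L}}f(g)=\big(\mathcal{L}_1f(g),\dots,\mathcal{L}_Mf(g)\big)^\top:=(A\ast\mathbf{x})(g),\quad g\in G.$$ Assume that the transfer matrix $\widehat{A}=[\widehat{a}_{m,n}]$ has all its entries in $L^\infty(\widehat{G})$. Then the following statements are equivalent: (a) The constant $\delta_A:=\operatorname{ess\,inf}_{\xi\in\widehat{G}}\det[\widehat{A}(\xi)^*\widehat{A}(\xi)]$ satisfies $\delta_A>0$. (b) There exist constants $0<\alpha\le\beta$ such that $\alpha\|f\|^2\le\sum_{m=1}^M\sum_{g\in G}|\mathcal{L}_mf(g)|^2\le\beta\|f\|^2$ for all $f\in\mathcal{V}_\Phi$. (c) There exists an $N\times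 M$ matrix $\widehat{B}$ with entries in $L^\infty(\widehat{G})$ such that $\widehat{B}(\xi)\,\widehat{A}(\xi)=I_N$ for a.e. $\xi\in\widehat{G}$. (d) There exists an $N\times M$ matrix $B$ with entries in $\ell^2(G)$ and with $\widehat{B}$ having entries in $L^\infty(\widehat{G})$ such that, for each $f=\sum_{n=1}^N\sum_{g\in G}x_n(g)U(g)\varphi_n\in\mathcal{V}_\Phi$, one has $\mathbf{x}=B\ast\boldsymbol{\mathcal{L}}f$. In other words, there exists a bounded convolution operator $\mathcal{B}:\ell^2_M(G)\to\ell^2_N(G)$ such that $\mathcal{B}\mathcal{A}=\mathcal{I}_{\ell^2_N(G)}$, where $\mathcal{A}(\mathbf{x})=A\ast\mathbf{x}$. (e) There exist $M$ elements $S_m\in\mathcal{V}_\Phi$, $m=1,\dots,M$, such that the sequence $\{U(g)S_m\}_{g\in G;\,m=1,\dots,M}$ is a frame for $\mathcal{V}_\Phi$ and for each $f\in\mathcal{V}_\Phi$ the reconstruction formula $$f=\sum_{m=1}^M\sum_{g\in G}\mathcal{L}_mf(g)\,U(g)S_m\quad\text{in }\mathcal{H}$$ holds. (f) There exists a frame $\{S_{g,m}\}_{g\in G;\,m=1,\dots,M}$ for $\mathcal{V}_\Phi$ such that for each $f\in\mathcal{V}_\Phi$ the expansion $$f=\sum_{m=1}^M\sum_{g\in G}\mathcal{L}_mf(g)\,S_{g,m}\quad\text{in }\mathcal{H}$$ holds. In this case, any reconstruction elements $S_1,\dots,S_M\in\mathcal{V}_\Phi$ as in (e) are necessarily obtained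 from the columns $\mathbf{b}_1,\dots,\mathbf{b}_M$ of a matrix $B=[b_{n,m}]$ whose transfer matrix $\widehat{B}$ satisfies (c), i.e., $S_m=\mathcal{T}_{U,\Phi}\mathbf{b}_m=\sum_{n=1}^N\sum_{g\in G}b_{n,m}(g)\,U(g)\varphi_n$, $m=1,\dots,M$.
   Context: $G$ is written additively; $\widehat{G}$ is its (compact) dual group with Haar measure normalized to total mass $1$. For $x\in\ell^1(G)$ the Fourier transform is $\widehat{x}(\xi)=\sum_{g\in G}x(g)\overline{\langle g,\xi\rangle}$, where $\langle g,\xi\rangle=\xi(g)$; it extends to a unitary isomorphism $\ell^2(G)\to L^2(\widehat{G})$. A unitary representation is a homomorphism from $G$ into the group of unitary operators of $\mathcal{H}$. A Riesz sequence is a sequence which is a Riesz basis of its closed linear span; in particular the coefficients $\mathbf{x}$ of $f\in\mathcal{V}_\Phi$ are uniquely determined by $f$. $\ell^2_N(G)=\ell^2(G)\times\dots\times\ell^2(G)$ ($N$ times), a product Hilbert space. For a matrix $A=[a_{m,n}]$ of size $M\times N$ with entries in $\ell^2(G)$ and $\mathbf{x}\in\ell^2_N(G)$, the convolution is $(A\ast\mathbf{x})(g)=\sum_{g'\in G}A(g-g')\mathbf{x}(g')$, whose $m$-th entry is $\sum_{n=1}^N(a_{m,n}\ast x_n)(g)$. The transfer matrix is $\widehat{A}(\xi)=[\widehat{a}_{m,n}(\xi)]$, and $\widehat{A}(\xi)^*$ denotes the conjugate transpose. A bounded convolution operator (system) $\ell^2_M(G)\to\ell^2_N(G)$ is a bounded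 operator of the form $\mathbf{y}\mapsto B\ast\mathbf{y}$ with $B$ an $N\times M$ matrix with entries in $\ell^2(G)$ such that $\widehat{B}$ has entries in $L^\infty(\widehat{G})$ (this last condition is equivalent to boundedness). $\mathcal{T}_{U,\Phi}:\ell^2_N(G)\to\mathcal{V}_\Phi$ is the isomorphism mapping the standard orthonormal basis $\{\boldsymbol{\delta}_{g,n}\}$ of $\ell^2_N(G)$ onto the Riesz basis $\{U(g)\varphi_n\}$ of $\mathcal{V}_\Phi$, i.e. $\mathcal{T}_{U,\Phi}\mathbf{x}=\sum_{n}\sum_g x_n(g)U(g)\varphi_n$. *)

(* Defs.v *)
From HB Require Import structures.
From mathcomp Require Import all_boot all_order all_algebra.
From mathcomp Require Import sesquilinear finmap complex.
From mathcomp Require Import all_classical all_reals all_analysis.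
From mathcomp Require Import ess_sup_inf.
From mathcomp.analysis Require Import showcase.summability.

Set Implicit Arguments.
Unset Strict Implicit.
Unset Printing Implicit Defensive.

Import Order.TTheory GRing.Theory Num.Theory.
Import numFieldNormedType.Exports.

Local Open Scope classical_set_scope.
Local Open Scope ring_scope.

(* The complex scalars are R[i] for R : realType. Norms of normed spaces over
   R[i] (including R[i] itself) take values in R[i]; [rnorm] is the same norm as
   an element of R. *)
Definition rnorm (R : realType) (V : normedZmodType R[i]) (v : V) : R :=
  complex.Re `|v|.

(* Unconditional summation: convergence of the net of finite partial sums.
   [summability.sum] is the value of such a sum. *)
Definition has_sum (I : choiceType) (K : numFieldType) (V : normedModType K)
    (x : I -> V) (s : V) : Prop :=
  summability.partial_sum x @ summability.totally --> s.

Section SequenceSpaces.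
Variable R : realType.

Definition l2norm2 (I : choiceType) (x : I -> R[i]) : \bar R :=
  \esum_(i in [set: I]) (rnorm (x i) ^+ 2)%:E.

Definition l2 (I : choiceType) : set (I -> R[i]) :=
  [set x | (l2norm2 x < +oo)%E].

Definition l2delta (I : choiceType) (i : I) : I -> R[i] := fun j => (j == i)%:R.

(* Elements of the product space l2_N(G) are column-vector valued functions. *)
Definition vl2norm2 (G : choiceType) (N : nat) (x : G -> 'cV[R[i]]_N) : \bar R :=
  (\sum_(n < N) l2norm2 (fun g => x g n ord0))%E.

Definition vl2 (G : choiceType) (N : nat) : set (G -> 'cV[R[i]]_N) :=
  [set x | forall n, l2 (fun g => x g n ord0)].

Definition mxl2 (G : choiceType) (M N : nat) : set (G -> 'M[R[i]]_(M, N)) :=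
  [set A | forall m n, l2 (fun g => A g m n)].

Definition convolution (G : zmodType) (a x : G -> R[i]) (g : G) : R[i] :=
  summability.sum (fun g' : G => (a (g - g') * x g' : R[i]^o)).

Definition mxconvolution (G : zmodType) (M N : nat)
    (A : G -> 'M[R[i]]_(M, N)) (x : G -> 'cV[R[i]]_N) (g : G) : 'cV[R[i]]_M :=
  \col_m \sum_(n < N) convolution (fun h => A h m n) (fun h => x h n ord0) g.

End SequenceSpaces.

Section HilbertSpace.
Variables (R : realType) (H : completeNormedModType R[i]).
Variable ip : {dot H for Num.conj}.

Definition unitary_operator (u : H -> H) : Prop :=
  [/\ linear u, bijective u & forall v w, ip (u v) (u w) = ip v w].

Definition unitary_representation (G : zmodType) (U : G -> H -> H) : Prop :=
  (forall g, unitary_operator (U g)) /\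
  (forall g h, U (g + h) = U g \o U h).

Definition closed_span (I : choiceType) (e : I -> H) : set H :=
  closure [set v | exists (J : {fset I}) (c : I -> R[i]),
                     v = summability.partial_sum (fun i => c i *: e i) J].

(* A Riesz basis of V is the image of the standard orthonormal basis of l2(I)
   under a topological isomorphism of l2(I) onto V. *)
Definition riesz_basis (I : choiceType) (V : set H) (e : I -> H) : Prop :=
  exists T : (I -> R[i]) -> H,
    [/\ forall (a : R[i]) x y, l2 x -> l2 y ->
          T (fun i => a * x i + y i) = a *: T x + T y,
        T @` @l2 R I = V,
        exists c d : R, 0 < c /\ forall x, l2 x ->
          (c%:E * l2norm2 x <= (rnorm (T x) ^+ 2)%:E /\
           (rnorm (T x) ^+ 2)%:E <= d%:E * l2norm2 x)%E
      & forall i, T (l2delta R i) = e i].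

Definition riesz_sequence (I : choiceType) (e : I -> H) : Prop :=
  riesz_basis (closed_span e) e.

Definition frame (I : choiceType) (V : set H) (S : I -> H) : Prop :=
  (forall i, V (S i)) /\
  exists alpha beta : R, [/\ 0 < alpha, alpha <= beta &
    forall f, V f ->
      ((alpha * rnorm f ^+ 2)%:E <=
         \esum_(i in [set: I]) (rnorm (ip f (S i)) ^+ 2)%:E /\
       \esum_(i in [set: I]) (rnorm (ip f (S i)) ^+ 2)%:E <=
         (beta * rnorm f ^+ 2)%:E)%E].

End HilbertSpace.

Section ShiftInvariantSpace.
Variables (R : realType) (H : completeNormedModType R[i]).
Variables (G : zmodType) (U : G -> H -> H) (N : nat) (phi : 'I_N -> H).

Definition orbit_family (p : G * 'I_N) : H := U p.1 (phi p.2).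

(* f = T_{U,Phi} x. *)
Definition synthesis (x : G -> 'cV[R[i]]_N) (f : H) : Prop :=
  has_sum (fun p : G * 'I_N => x p.1 p.2 ord0 *: orbit_family p) f.

Definition VPhi : set H := [set f | exists2 x, vl2 x & synthesis x f].

Definition reconstructs (M : nat) (A : G -> 'M[R[i]]_(M, N))
    (S : G * 'I_M -> H) : Prop :=
  forall x f, vl2 x -> synthesis x f ->
    has_sum (fun p : G * 'I_M => mxconvolution A x p.1 p.2 ord0 *: S p) f.

End ShiftInvariantSpace.

Section DualGroup.
Variables (R : realType) (G : zmodType).

Definition character : set {ptws G -> R[i]^o} :=
  [set xi | (forall g, `|xi g| = 1) /\ (forall g h, xi (g + h) = xi g * xi h)].

Definition dual : Type := set_type character.

HB.instance Definition _ := Topological.on dual.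

Definition pairing (g : G) (xi : dual) : R[i] := \val xi g.

Lemma dual_one_subproof : (fun=> 1) \in character.
Proof. by apply/mem_set; split => [g|g h]; rewrite ?normr1 ?mulr1. Qed.

Definition dual_one : dual := SigSub dual_one_subproof.

HB.instance Definition _ := isPointed.Build dual dual_one.

Lemma dual_mul_subproof (xi eta : dual) :
  (fun g => pairing g xi * pairing g eta) \in character.
Proof.
have [x1 xM] := set_mem (valP xi); have [e1 eM] := set_mem (valP eta).
apply/mem_set; split => [g|g h]; first by rewrite normrM x1 e1 mulr1.
by rewrite /pairing xM eM mulrACA.
Qed.

Definition dual_mul (xi eta : dual) : dual :=
  SigSub (dual_mul_subproof xi eta).

Definition borel_dual := g_sigma_algebraType (@open dual).

(* [mu] is a probability measure: with total mass 1, translation invariance determines the Haar measure. *)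
Definition haar_measure (mu : probability borel_dual R) : Prop :=
  forall (xi : dual) (B : set borel_dual), measurable B ->
    mu [set eta : borel_dual | B (dual_mul xi eta)] = mu B.

Variable mu : probability borel_dual R.

Definition cmeasurable (F : borel_dual -> R[i]) : Prop :=
  measurable_fun setT (fun xi => complex.Re (F xi)) /\
  measurable_fun setT (fun xi => complex.Im (F xi)).

Definition Linfty : set (borel_dual -> R[i]) :=
  [set F | cmeasurable F /\ (ess_sup mu (fun xi => (rnorm (F xi))%:E) < +oo)%E].

Definition mxLinfty (M N : nat) : set (borel_dual -> 'M[R[i]]_(M, N)) :=
  [set F | forall m n, Linfty (fun xi => F xi m n)].

(* The Fourier transform is extended from finitely supported x, where it is the
   finite sum below, to l2 by L2-continuity: F represents the transform of x
   iff the transforms of the finite truncations of x tend to F in L2. *)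
Definition is_fourier (x : G -> R[i]) (F : borel_dual -> R[i]) : Prop :=
  cmeasurable F /\
  (fun J : {fset G} =>
     \int[mu]_xi (rnorm (F xi -
        summability.partial_sum (fun g => x g * (pairing g xi)^*) J) ^+ 2)%:E)%E
    @ summability.totally --> 0%E.

Definition transfer_matrix (M N : nat) (A : G -> 'M[R[i]]_(M, N))
    (Ahat : borel_dual -> 'M[R[i]]_(M, N)) : Prop :=
  forall m n, is_fourier (fun g => A g m n) (fun xi => Ahat xi m n).

Definition bounded_convolution_operator (M N : nat)
    (T : (G -> 'cV[R[i]]_M) -> (G -> 'cV[R[i]]_N)) : Prop :=
  [/\ forall y, vl2 y -> vl2 (T y),
      exists c : R, forall y, vl2 y -> (vl2norm2 (T y) <= c%:E * vl2norm2 y)%E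
    & exists B Bhat, [/\ mxl2 B, transfer_matrix B Bhat, mxLinfty Bhat
        & forall y, vl2 y -> T y = mxconvolution B y]].

End DualGroup.

Definition conjtrmx (R : realType) (M N : nat) (A : 'M[R[i]]_(M, N)) :
  'M[R[i]]_(N, M) := map_mx Num.conj A^T.

(* Main.v *)
(* Everything takes place in W, the L^2-closure of the trigonometric polynomials on
   the dual group. Characters separate points, so by invariance of the Haar measure
   they are orthonormal, and W is exactly the set of transforms of l^2(G). The
   essentially bounded elements of W form a *-algebra closed under uniform limits,
   hence (Neumann series) under inversion of functions bounded below by a positive
   constant. As the entries of Ahat lie in this algebra, so do those of the left
   inverse det(K)^-1 adj(K) Ahat^*, K = Ahat^* Ahat, as soon as det K is bounded
   below; thus the density of trigonometric polynomials in the whole of L^2 is never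
   needed. Convolution by A becomes multiplication by Ahat, a lower bound
   |A * x| >= c |x| on l^2 becomes the pointwise bound |Ahat(xi) v| >= c |v| by
   testing on x^ = p v with p in the algebra concentrated where the bound fails, and
   this bound is equivalent to a bound on det K by the spectral theorem.

   The Riesz basis transports l^2 to V_Phi. The Bessel inequality of a frame is
   equivalent to the boundedness of its synthesis operator: this gives the lower
   bound in (b) from (f), and shows that the matrix B of the coefficients of
   reconstruction elements acts boundedly by convolution. Its transform F then
   satisfies |F^n|_2 <= C^n for all n, hence is essentially bounded. *)
Require Import Defs.
From HB Require Import structures.
From mathcomp Require Import all_boot all_order all_algebra.
From mathcomp Require Import sesquilinear finmap complex.
From mathcomp Require Import all_classical all_reals all_analysis.
From mathcomp Require Import ess_sup_inf.
From mathcomp Require Import spectral measurable_realfun ring lra.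

Set Implicit Arguments.
Unset Strict Implicit.
Unset Printing Implicit Defensive.

Import Order.TTheory GRing.Theory Num.Theory.
Import numFieldNormedType.Exports.

Local Open Scope classical_set_scope.
Local Open Scope ring_scope.

(** * Characters separate points *)


(** Three obstacles shape the argument. Indicator functions of Borel sets are not known to lie in W,
    so test functions concentrated on a set are powers of an affine function of the quantity at
    hand, and null sets are recognized by geometric growth: if [mu A * r ^+ n] stays bounded for
    some [r > 1], then [A] is null. For the same reason a left inverse as in (c), which is only
    essentially bounded, is not visibly the transform of any sequence; it merely yields a pointwise
    lower bound for [Ahat], and the convolution inverse needed in (d) is built anew from the Gram
    determinant, inside the algebra. Finally, almost everywhere statements can be intersected only
    over countable families, so the pointwise bound is proved for each fixed vector, hence for all
    rational vectors at once, and then extended by approximation at the price of a factor 4. That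
    every [l2] sequence has a transform is the Riesz-Fischer theorem, proved with an almost
    everywhere limit of a rapidly converging sequence of partial sums. *)

Section CharacterExtension.
Variables (R : realType) (G : zmodType).
Local Notation C := R[i].
Implicit Types (X : set (G * C)).

(* Graphs of characters of subgroups of [G] (the empty graph is allowed). *)
Definition character_graph X : Prop :=
  [/\ forall p q, X p -> X q -> X (p.1 - q.1, p.2 / q.2),
      forall p, X p -> `|p.2| = 1
    & forall z, X (0, z) -> z = 1].

Lemma norm1_neq0 (z : C) : `|z| = 1 -> z != 0.
Proof. by move=> z1; rewrite -normr_eq0 z1 oner_eq0. Qed.

Lemma norm1_expz (z : C) (n : int) : `|z| = 1 -> `|z ^ n| = 1.
Proof.
move=> z1; case: n => n; first by rewrite -exprnP normrX z1 expr1n.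
by rewrite NegzE -exprnN normfV normrX z1 expr1n invr1.
Qed.

Lemma character_graph_functional X g z w :
  character_graph X -> X (g, z) -> X (g, w) -> z = w.
Proof.
move=> [Xd X1 X0] Xz Xw; have /= := Xd _ _ Xz Xw; rewrite subrr => /X0 /eqP.
by rewrite -(can_eq (mulfK (norm1_neq0 (X1 _ Xw)))) /= mul1r divfK ?(norm1_neq0 (X1 _ Xw)) // => /eqP.
Qed.

Lemma character_graph_exp X g z n : character_graph X -> X (g, z) ->
  X (g *~ n, z ^ n).
Proof.
move=> gX Xz; have [Xd X1 X0] := gX; have z0 := norm1_neq0 (X1 _ Xz).
have X01 : X (0, 1) by have /= := Xd _ _ Xz Xz; rewrite subrr divff.
have XN p : X p -> X (- p.1, p.2^-1).
  by move=> Xp; have /= := Xd _ _ X01 Xp; rewrite sub0r div1r.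
have Xn m : X (g *+ m, z ^+ m).
  elim: m => [|m IH]; first by rewrite mulr0n expr0.
  have /= := Xd _ _ IH (XN _ Xz).
  by rewrite opprK invrK -mulrSr -exprSr.
case: n => m; first by rewrite -pmulrn -exprnP.
by rewrite NegzE mulrNz -pmulrn -exprnN; exact: (XN _ (Xn m.+1)).
Qed.

(** For a graph [X] that is a subgroup, this is the subgroup generated by [X] and [(h, z)]. *)
Definition extend_graph X (h : G) (z : C) : set (G * C) :=
  [set p | exists n : int, exists2 q, X q & p = (q.1 + h *~ n, q.2 * z ^ n)].

Lemma character_graph_extend X h z : character_graph X -> `|z| = 1 ->
  (forall (n : int) w, X (h *~ n, w) -> w = z ^ n) ->
  character_graph (extend_graph X h z).
Proof.
move=> gX z1 Xz; have [Xd X1 X0] := gX; have z0 := norm1_neq0 z1.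
split.
- move=> _ _ [n [p Xp ->]] [m [q Xq ->]] /=; exists (n - m).
  exists (p.1 - q.1, p.2 / q.2); first exact: Xd.
  rewrite /= mulrzBr; congr (_, _); first by rewrite opprD addrACA.
  by rewrite expfzDr // invfM -invr_expz mulrACA.
- move=> _ [n [p Xp ->]] /=; rewrite normrM (X1 _ Xp) mul1r.
  exact: norm1_expz.
- move=> w [n [p Xp [pn ->]]].
  have X01 : X (0, 1) by have /= := Xd _ _ Xp Xp; rewrite subrr divff ?norm1_neq0 ?X1.
  have /= := Xd _ _ X01 Xp; rewrite sub0r div1r.
  have -> : - p.1 = h *~ n by apply/eqP; rewrite eq_sym -subr_eq0 opprK addrC -pn.
  by move/Xz => <-; rewrite divff ?norm1_neq0 ?X1.
Qed.

Lemma extend_graph_sub X h z : X `<=` extend_graph X h z.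
Proof. by move=> p Xp; exists 0; exists p; rewrite // mulr0z expr0z addr0 mulr1; case: p Xp. Qed.

Lemma extend_graph_mem X h z : X (0, 1) -> extend_graph X h z (h, z).
Proof. by move=> X01; exists 1; exists (0, 1); rewrite //= mulr1z expr1z add0r mul1r. Qed.

Lemma norm1_root (k : nat) (v z : C) : (0 < k)%N -> `|v| = 1 -> z ^+ k = v -> `|z| = 1.
Proof.
by move=> k0 v1 zk; apply/eqP; rewrite -(@pexpr_eq1 _ _ k) // -normrX zk v1.
Qed.

(** The integers [n] with [h *~ n] in the domain form an ideal. Either it is zero, or it is
    generated by its least positive element [k], and then the compatibility of [z] with the graph
    reduces to the single equation [z ^+ k = v]. *)
Lemma multiples_in_domain X h : character_graph X ->
  (forall (n : int) w, X (h *~ n, w) -> n = 0) \/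
  exists k v, [/\ (0 < k)%N, X (h *+ k, v) &
    forall z, z ^+ k = v -> forall (n : int) w, X (h *~ n, w) -> w = z ^ n].
Proof.
move=> gX; have [Xd X1 X0] := gX.
pose P k := `[< (0 < k)%N /\ exists w, X (h *+ k, w) >].
have [exP|nP] := pselect (exists k, P k); last first.
  left => n w Xn; apply: contrapT => /eqP n0; apply: nP; exists `|n|%N.
  apply/asboolP; rewrite absz_gt0; split => //.
  case: n Xn n0 => m Xm m0; first by exists w; rewrite absz_nat pmulrn.
  exists w^-1; change (X (h *+ m.+1, w^-1)).
  have := character_graph_exp (-1) gX Xm.
  by rewrite -mulrzA NegzE mulrN1 opprK -pmulrn exprN1.
right; case: (ex_minnP exP) => k /asboolP [k0 [v Xk]] kmin; exists k, v; split => //.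
move=> z zk n w Xn.
have v1 : `|v| = 1 := X1 _ Xk.
have z1 : `|z| = 1 := norm1_root k0 v1 zk.
have kz0 : k%:Z != 0 by rewrite eqz_nat -lt0n.
have Xq := character_graph_exp (n %/ k)%Z gX Xk.
have /= Xr := Xd _ _ Xn Xq.
have en := divz_eq n k.
have hr : h *~ n - h *+ k *~ (n %/ k)%Z = h *~ (n %% k)%Z.
  by rewrite pmulrn -mulrzA -mulrzBr {1}en mulrC addrC addKr.
have r0 : (n %% k)%Z = 0.
  have := modz_ge0 n kz0; have := ltz_pmod n (_ : 0 < k%:Z).
  rewrite ltz_nat => /(_ k0); rewrite hr in Xr.
  case: (n %% k)%Z Xr => // r Xr; rewrite ltz_nat => rk _.
  case: (posnP r) => [-> //|r0]; suff: (k <= r)%N by rewrite leqNgt rk.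
  by apply: kmin; apply/asboolP; split => //; exists (w / v ^ (n %/ k)%Z); rewrite pmulrn.
move: Xr; rewrite hr r0 mulr0z => /X0 /eqP.
rewrite -(can_eq (mulfK (norm1_neq0 (norm1_expz (n %/ k)%Z v1)))) /= mul1r.
rewrite divfK ?norm1_neq0 ?norm1_expz // => /eqP ->.
by rewrite -zk [in RHS]en r0 addr0 exprnP exprz_exp mulrC.
Qed.

(** The circle is divisible: if some positive multiple of [h] is in the domain, a [k]-th root of the
    value [v] there is a legitimate value at [h]; otherwise any value is, for instance 1. *)
Lemma character_graph_extension X h : character_graph X -> X (0, 1) ->
  exists z, character_graph (extend_graph X h z).
Proof.
move=> gX X01; have [Xn|[k [v [k0 Xk Xz]]]] := multiples_in_domain h gX.
  exists 1; apply: character_graph_extend; rewrite ?normr1 // => n w Xw.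
  have n0 := Xn _ _ Xw; move: Xw; rewrite n0 mulr0z expr0z.
  by case: gX => _ _; apply.
have zk := rootCK k0 v; exists (k.-root v)%C.
apply: character_graph_extend => //; last exact: Xz.
by apply: norm1_root k0 _ zk; case: gX => _ X1 _; exact: (X1 _ Xk).
Qed.

(** A root of [1 + z + ... + z ^+ (k - 1)], which is not constant since [k > 1]; the value of this
    polynomial at 1 is [k], so the root is not 1. *)
Lemma nontrivial_root_of_unity (k : nat) : (1 < k)%N ->
  exists2 z : C, z ^+ k = 1 & z != 1.
Proof.
move=> k1; pose p : {poly C} := \poly_(i < k) 1.
have sp : size p = k by rewrite size_poly_eq // oner_neq0.
have /closed_rootP [z /rootP pz] : size p != 1%N by rewrite sp neq_ltn k1 orbT.
have ez : \sum_(i < k) z ^+ i = 0.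
  by rewrite -[RHS]pz horner_poly; apply: eq_bigr => i _; rewrite mul1r.
exists z; first by apply/eqP; rewrite -subr_eq0 subrX1 ez mulr0.
apply/eqP => z1; move/eqP: ez; rewrite z1 (eq_bigr (fun=> 1)).
  by rewrite sumr_const card_ord pnatr_eq0 -leqn0 leqNgt (ltn_trans _ k1).
by move=> i _; rewrite expr1n.
Qed.

Lemma trivial_character_graph : character_graph [set (0, 1)].
Proof.
split=> [p q -> -> //=|p -> /=|z [] //]; last exact: normr1.
by rewrite subrr divr1.
Qed.

Lemma nontrivial_character_graph g : g != 0 ->
  exists2 z, z != 1 & character_graph (extend_graph [set (0, 1)] g z).
Proof.
move=> g0; have gX := trivial_character_graph.
have [Xn|[k [v [k0 [gk v1]] Xz]]] := multiples_in_domain g gX.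
  (* Here [g] has infinite order, so its value is unconstrained; below it has finite order
     [k > 1]. *)
  exists (-1); first by rewrite -subr_eq0 -opprD oppr_eq0 -mulr2n pnatr_eq0.
  apply: character_graph_extend => //; first by rewrite normrN1.
  by move=> n w Xw; have n0 := Xn _ _ Xw; case: Xw => _ ->; rewrite n0.
have k1 : (1 < k)%N.
  by case: k k0 gk {Xz} => [//|[|//]] _; rewrite mulr1n => /eqP; rewrite (negbTE g0).
have [z zk z1] := nontrivial_root_of_unity k1; exists z => //.
apply: character_graph_extend => //; first by apply: norm1_root k0 _ zk; rewrite normr1.
by apply: Xz; rewrite zk v1.
Qed.

Lemma character_separates g : g != 0 -> exists xi : dual R G, pairing g xi != 1.
Proof.
move=> g0; have [z z1 g_X] := nontrivial_character_graph g0.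
set X := extend_graph _ _ _ in g_X.
(* Zorn's lemma also sees the empty chain, whose union is empty; hence [Y] is required to contain
   [X] only when it is nonempty. *)
pose P Y := character_graph Y /\ (Y !=set0 -> X `<=` Y).
have [|Y [[gY XY] Ymax]] := @Zorn_bigcup _ P.
  move=> F FP tF; split; last first.
    move=> [p [Y FY Yp]] q Xq; exists Y => //; apply: (FP _ FY).2 => //.
    by exists p.
  split.
  - move=> p q [Y FY Yp] [Z FZ Zq].
    have [YZ|ZY] := tF _ _ FY FZ.
      by exists Z => //; have [[Zd _ _] _] := FP _ FZ; apply: Zd => //; exact: YZ.
    by exists Y => //; have [[Yd _ _] _] := FP _ FY; apply: Yd => //; exact: ZY.
  - by move=> p [Y FY Yp]; have [[_ Y1 _] _] := FP _ FY; exact: Y1.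
  - by move=> w [Y FY Yp]; have [[_ _ Y0] _] := FP _ FY; exact: Y0.
have X01 : X (0, 1) by apply: extend_graph_sub.
have Y0 : Y !=set0.
  apply: contrapT => /set0P/negP; rewrite negbK => /eqP Y0; apply: (Ymax X).
    by rewrite Y0; split=> [//|/(_ _ X01)].
  split=> [|_]; [exact: g_X|exact: subset_refl].
have {}XY := XY Y0; have Y01 : Y (0, 1) by exact: XY.
(* An element outside the domain could be adjoined, against the maximality of [Y]. *)
have Ytot h : exists w, Y (h, w).
  have [w gYw] := character_graph_extension h gY Y01.
  have Yh := extend_graph_mem h w Y01.
  exists w; apply: contrapT => nY; apply: (Ymax (extend_graph Y h w)).
    by split; [exact: extend_graph_sub|move=> /(_ _ Yh)].
  split => // _; apply: subset_trans XY (@extend_graph_sub _ _ _).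
have [Yd Y1 Yz] := gY.
pose f h : C := projT1 (cid (Ytot h)).
have Yf h : Y (h, f h) := projT2 (cid (Ytot h)).
have fc : @character R G f.
  split => [h|h k]; first exact: (Y1 _ (Yf h)).
  apply: (character_graph_functional gY (Yf _)).
  have := Yd _ _ Y01 (Yf k); rewrite sub0r div1r => /(Yd _ _ (Yf h)) /=.
  by rewrite opprK invrK.
exists (SigSub (mem_set fc)); rewrite /pairing /=.
have Xg : X (g, z) by exact: extend_graph_mem.
by rewrite (character_graph_functional gY (Yf g) (XY _ Xg)).
Qed.

End CharacterExtension.

(** * Norms as real numbers *)

Section RealNorm.
Variable R : realType.
Local Notation C := R[i].

Section NormedZmod.
Variable V : normedZmodType C.
Implicit Types v w : V.

Lemma rnormE v : (rnorm v)%:C%C = `|v|.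
Proof. by apply: RRe_real; exact: normr_real. Qed.

Lemma rnorm_ge0 v : 0 <= rnorm v.
Proof. by rewrite -ler0c rnormE. Qed.

Lemma rnorm0 : rnorm (0 : V) = 0.
Proof. by rewrite /rnorm normr0. Qed.

Lemma rnorm_eq0 v : (rnorm v == 0) = (v == 0).
Proof. by rewrite -(inj_eq (@complexI R)) rnormE normr_eq0. Qed.

Lemma rnormN v : rnorm (- v) = rnorm v.
Proof. by rewrite /rnorm normrN. Qed.

Lemma rnormD v w : rnorm (v + w) <= rnorm v + rnorm w.
Proof. by rewrite -lecR rmorphD /= !rnormE ler_normD. Qed.

Lemma rnorm_sum (I : Type) (r : seq I) (P : pred I) (F : I -> V) :
  rnorm (\sum_(i <- r | P i) F i) <= \sum_(i <- r | P i) rnorm (F i).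
Proof.
elim/big_rec2: _ => [|i a b _ ab]; first by rewrite rnorm0.
by rewrite (le_trans (rnormD _ _)) // lerD2l.
Qed.

Lemma rnorm_sqrD v w : rnorm (v + w) ^+ 2 <= 2 * rnorm v ^+ 2 + 2 * rnorm w ^+ 2.
Proof.
have vw : rnorm (v + w) ^+ 2 <= (rnorm v + rnorm w) ^+ 2.
  by rewrite ler_pXn2r ?nnegrE ?addr_ge0 ?rnorm_ge0 // rnormD.
apply: (le_trans vw); rewrite -subr_ge0.
rewrite [leRHS](_ : _ = (rnorm v - rnorm w) ^+ 2) ?sqr_ge0 //; ring.
Qed.

End NormedZmod.

Implicit Types z w : C.

Lemma rnormM z w : rnorm (z * w) = rnorm z * rnorm w.
Proof. by apply: complexI; rewrite rmorphM /= !rnormE normrM. Qed.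

Lemma rnormX z n : rnorm (z ^+ n) = rnorm z ^+ n.
Proof. by apply: complexI; rewrite rmorphXn /= !rnormE normrX. Qed.

Lemma rnorm1 : rnorm (1 : C) = 1.
Proof. by rewrite /rnorm normr1. Qed.

Lemma rnorm_real (r : R) : rnorm (r%:C%C) = `|r|.
Proof. by rewrite /rnorm normc_def /= expr0n /= addr0 sqrtr_sqr. Qed.

Lemma rnorm_sqr z : rnorm z ^+ 2 = complex.Re z ^+ 2 + complex.Im z ^+ 2.
Proof. by apply: complexI; rewrite rmorphXn /= rnormE -add_Re2_Im2. Qed.

Lemma conjC_conjc z : z^* = (conjc z)%C.
Proof. by []. Qed.

Lemma rnorm_conj z : rnorm (z^*) = rnorm z.
Proof. by rewrite /rnorm norm_conjC. Qed.

Lemma mul_conj_rnorm z : z * z^* = (rnorm z ^+ 2)%:C%C.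
Proof. by rewrite -normCK rmorphXn /= rnormE. Qed.

Lemma Re_le_rnorm z : `|complex.Re z| <= rnorm z.
Proof.
rewrite -(@ler_pXn2r _ 2) ?nnegrE ?rnorm_ge0 // real_normK ?num_real // rnorm_sqr.
by rewrite lerDl sqr_ge0.
Qed.

Lemma Im_le_rnorm z : `|complex.Im z| <= rnorm z.
Proof.
rewrite -(@ler_pXn2r _ 2) ?nnegrE ?rnorm_ge0 // real_normK ?num_real // rnorm_sqr.
by rewrite lerDr sqr_ge0.
Qed.

Lemma cReD z w : complex.Re (z + w) = complex.Re z + complex.Re w.
Proof. by case: z => ? ?; case: w. Qed.
Lemma cImD z w : complex.Im (z + w) = complex.Im z + complex.Im w.
Proof. by case: z => ? ?; case: w. Qed.
Lemma cReN z : complex.Re (- z) = - complex.Re z. Proof. by case: z. Qed.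
Lemma cImN z : complex.Im (- z) = - complex.Im z. Proof. by case: z. Qed.
Lemma cReM z w : complex.Re (z * w) = complex.Re z * complex.Re w - complex.Im z * complex.Im w.
Proof. by case: z => ? ?; case: w. Qed.
Lemma cImM z w : complex.Im (z * w) = complex.Re z * complex.Im w + complex.Im z * complex.Re w.
Proof. by case: z => ? ?; case: w. Qed.

Lemma cRe_sum (I : Type) (r : seq I) (P : pred I) (F : I -> C) :
  complex.Re (\sum_(i <- r | P i) F i) = \sum_(i <- r | P i) complex.Re (F i).
Proof. by elim/big_rec2: _ => // i a b _ <-; rewrite cReD. Qed.

End RealNorm.

#[local] Existing Instance summability.totally_filter.

(** * Unconditional sums *)

Section HasSum.
Variables (R : realType) (I : choiceType).
Local Notation C := R[i].

Lemma partial_sumE (V : zmodType) (x : I -> V) (J : {fset I}) :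
  summability.partial_sum x J = \sum_(i <- J) x i.
Proof. by rewrite /summability.partial_sum big_seq_fsetE. Qed.

Lemma near_totally (P : {fset I} -> Prop) :
  (\forall J \near summability.totally, P J) <->
  exists J0, forall J, (J0 `<=` J)%fset -> P J.
Proof. by split=> [[J0 _ J0P]|[J0 J0P]]; exists J0. Qed.

Lemma has_sumP (V : normedModType C) (x : I -> V) (s : V) :
  has_sum x s <-> forall e : R, 0 < e ->
    exists J0, forall J, (J0 `<=` J)%fset -> rnorm (s - \sum_(i <- J) x i) < e.
Proof.
rewrite /has_sum cvgrPdist_lt; split=> [xs e e0|xs e e0].
  have /near_totally [J0 J0P] : \forall J \near summability.totally,
      `|s - summability.partial_sum x J| < e%:C%C.
    by apply: xs; rewrite ltcR.
  by exists J0 => J /J0P; rewrite -rnormE partial_sumE ltcR.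
have er : e \is Num.real := gtr0_real e0.
have [|J0 J0P] := xs (complex.Re e); first by rewrite -ltcR RRe_real.
by apply/near_totally; exists J0 => J /J0P; rewrite -ltcR RRe_real // rnormE partial_sumE.
Qed.

Lemma has_sum_unique (V : normedModType C) (x : I -> V) (s t : V) :
  has_sum x s -> has_sum x t -> s = t.
Proof. by move=> xs xt; exact: (cvg_unique _ xs xt). Qed.

Lemma has_sum_sum (V : normedModType C) (x : I -> V) (s : V) :
  has_sum x s -> summability.sum x = s.
Proof. by move=> xs; apply: cvg_lim xs => //; exact: norm_hausdorff. Qed.

Lemma integral_cvg0P (f : {fset I} -> \bar R) : (forall J, (0 <= f J)%E) ->
  (f @ summability.totally --> 0%E) <-> forall e : R, 0 < e ->
    exists J0, forall J, (J0 `<=` J)%fset -> (f J < e%:E)%E.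
Proof.
move=> f0; split => [/fine_cvgP [ffin /cvgrPdist_lt fc] e e0|fe].
  have [J0 J0P] : exists J0, forall J, (J0 `<=` J)%fset ->
      f J \is a fin_num /\ `|0 - fine (f J)| < e.
    apply/near_totally; apply: filterI => //; exact: (fc e e0).
  exists J0 => J /J0P [Jf]; rewrite sub0r normrN ger0_norm ?fine_ge0 // => Je.
  by rewrite -(fineK Jf) lte_fin.
apply/fine_cvgP; split.
  have [J0 J0P] := fe 1 ltr01; apply/near_totally; exists J0 => J /J0P Je.
  by rewrite ge0_fin_numE // (lt_trans Je) ?ltry.
apply/cvgrPdist_lt => e e0; have [J0 J0P] := fe e e0.
apply/near_totally; exists J0 => J /J0P Je.
have Jf : f J \is a fin_num by rewrite ge0_fin_numE // (lt_trans Je) ?ltry.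
by rewrite sub0r normrN /= ger0_norm ?fine_ge0 // -lte_fin fineK.
Qed.

Lemma sum_le_esum (a : I -> \bar R) (J : {fset I}) : (forall i, (0 <= a i)%E) ->
  (\sum_(i <- J) a i <= \esum_(i in [set: I]) a i)%E.
Proof.
move=> a0; apply: esum_ge; exists [set` J].
  by split => //; exact: finite_fset.
by rewrite fsbig_finite /=; [rewrite set_fsetK|exact: finite_fset].
Qed.

Lemma esum_le (a : I -> \bar R) c :
  (forall J : {fset I}, (\sum_(i <- J) a i <= c)%E) ->
  (\esum_(i in [set: I]) a i <= c)%E.
Proof.
move=> ac; apply: ub_ereal_sup => _ [F [fF _] <-].
by rewrite fsbig_finite //=.
Qed.

End HasSum.

(** * Square-summable families and their truncations *)

Section SquareSummable.
Variables (R : realType) (I : choiceType).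
Local Notation C := R[i].
Implicit Types (x y : I -> C) (J K : {fset I}).

Definition sqsum x J : R := \sum_(i <- J) rnorm (x i) ^+ 2.

Definition l2n x : R := fine (l2norm2 x).

Definition cutoff J x : I -> C := fun i => if i \in J then x i else 0.

Lemma sqsum_ge0 x J : 0 <= sqsum x J.
Proof. by apply: sumr_ge0 => i _; rewrite sqr_ge0. Qed.

Lemma sqsum_esum x J : (\sum_(i <- J) (rnorm (x i) ^+ 2)%:E = (sqsum x J)%:E)%E.
Proof. by rewrite sumEFin. Qed.

Lemma sqsum_le_l2norm2 x J : ((sqsum x J)%:E <= l2norm2 x)%E.
Proof. by rewrite -sqsum_esum; apply: sum_le_esum => i; rewrite lee_fin sqr_ge0. Qed.

Lemma l2norm2_ge0 x : (0 <= l2norm2 x)%E.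
Proof. by apply: esum_ge0 => i _; rewrite lee_fin sqr_ge0. Qed.

Lemma l2norm2_leP x (c : R) : (l2norm2 x <= c%:E)%E <-> forall J, sqsum x J <= c.
Proof.
split=> [xc J|xc]; first by rewrite -lee_fin (le_trans (sqsum_le_l2norm2 x J)).
by apply: esum_le => J; rewrite sqsum_esum lee_fin.
Qed.

Lemma l2P x : l2 x <-> exists c : R, forall J, sqsum x J <= c.
Proof.
split=> [x2|[c xc]].
  exists (l2n x); apply/l2norm2_leP.
  by rewrite /l2n fineK // ge0_fin_numE ?l2norm2_ge0.
by rewrite /l2 /= (le_lt_trans ((l2norm2_leP _ _).2 xc)) ?ltry.
Qed.

Lemma l2nE x : l2 x -> l2norm2 x = (l2n x)%:E.
Proof. by move=> x2; rewrite /l2n fineK // ge0_fin_numE ?l2norm2_ge0. Qed.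

Lemma sqsum_le x J : l2 x -> sqsum x J <= l2n x.
Proof. by move=> x2; rewrite -lee_fin -l2nE // sqsum_le_l2norm2. Qed.

Lemma l2n_ge0 x : 0 <= l2n x.
Proof. by rewrite fine_ge0 // l2norm2_ge0. Qed.

Lemma sum_fset_mkcond (W : zmodType) (F : I -> W) J K : (K `<=` J)%fset ->
  \sum_(i <- J) (if i \in K then F i else 0) = \sum_(i <- K) F i.
Proof.
move=> KJ; rewrite -(big_fset_incl _ KJ); last by move=> i _ /negbTE ->.
by rewrite big_seq [RHS]big_seq; apply: eq_bigr => i ->.
Qed.

Lemma sqsum_mono x J K : (K `<=` J)%fset -> sqsum x K <= sqsum x J.
Proof.
move=> KJ; rewrite /sqsum -(sum_fset_mkcond _ KJ); apply: ler_sum => i _.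
by case: ifP => // _; rewrite sqr_ge0.
Qed.

(** [x - cutoff K x] vanishes on [K], so the overlap of [J] and [K] is counted once. *)
Lemma sqsumU x J K : sqsum x (J `|` K)%fset = sqsum x K + sqsum (fun i => x i - cutoff K x i) J.
Proof.
rewrite /sqsum -(sum_fset_mkcond (fun i => rnorm (x i) ^+ 2) (fsubsetUr J K)).
rewrite -[X in _ + X](sum_fset_mkcond _ (fsubsetUl J K)) -big_split /=.
apply: eq_big_seq => i; rewrite inE /cutoff.
by case: (i \in K); case: (i \in J) => //= _; rewrite ?subrr ?subr0 ?rnorm0 ?expr0n ?addr0 ?add0r.
Qed.

Lemma l2norm2_cutoffC x J : l2 x ->
  (l2norm2 (fun i => (x i - cutoff J x i)%R) <= (l2n x - sqsum x J)%:E)%E.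
Proof.
move=> x2; apply/l2norm2_leP => K.
by rewrite lerBrDl -sqsumU sqsum_le.
Qed.

Lemma l2norm2_cutoff x J : l2norm2 (cutoff J x) = (sqsum x J)%:E.
Proof.
apply/eqP; rewrite eq_le; apply/andP; split.
  apply/l2norm2_leP => K; rewrite (le_trans (sqsum_mono (cutoff J x) (fsubsetUl K J))) //.
  rewrite /sqsum -(sum_fset_mkcond (fun i => rnorm (x i) ^+ 2) (fsubsetUr K J)); apply: ler_sum => i _.
  by rewrite /cutoff; case: ifP => // _; rewrite rnorm0 expr0n.
rewrite (le_trans _ (sqsum_le_l2norm2 _ J)) // lee_fin /sqsum big_seq [leRHS]big_seq.
by apply: ler_sum => i iJ; rewrite /cutoff iJ.
Qed.

Lemma cutoff_l2 x J : l2 (cutoff J x).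
Proof. by rewrite /l2 /= l2norm2_cutoff ltry. Qed.

Lemma l2D x y : l2 x -> l2 y -> l2 (fun i => x i + y i).
Proof.
move=> /l2P [c xc] /l2P [d yd]; apply/l2P; exists (2 * c + 2 * d) => J.
rewrite (@le_trans _ _ (2 * sqsum x J + 2 * sqsum y J)) //.
  by rewrite /sqsum !mulr_sumr -big_split /=; apply: ler_sum => i _; exact: rnorm_sqrD.
by rewrite lerD // ler_wpM2l.
Qed.

Lemma l2Z (a : C) x : l2 x -> l2 (fun i => a * x i).
Proof.
move=> /l2P [c xc]; apply/l2P; exists (rnorm a ^+ 2 * c) => J.
rewrite (@le_trans _ _ (rnorm a ^+ 2 * sqsum x J)) ?ler_wpM2l ?sqr_ge0 //.
by rewrite /sqsum mulr_sumr; apply: ler_sum => i _; rewrite rnormM exprMn.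
Qed.

Lemma l2_cst0 : l2 (fun _ : I => 0 : C).
Proof. by apply/l2P; exists 0 => J; rewrite /sqsum big1 // => i _; rewrite rnorm0 expr0n. Qed.

Lemma l2_delta i : @l2 R I (l2delta R i).
Proof.
suff -> : l2delta R i = cutoff [fset i]%fset (fun=> 1) by exact: cutoff_l2.
by apply/funext => j; rewrite /cutoff /l2delta inE; case: eqP.
Qed.

Lemma l2n_approx x (e : R) : l2 x -> 0 < e ->
  exists J0, forall J, (J0 `<=` J)%fset -> l2n x - sqsum x J < e.
Proof.
move=> x2 e0.
have [J0 xJ0] : exists J, l2n x - e < sqsum x J.
  apply: contrapT => nJ; suff: (l2norm2 x <= (l2n x - e)%:E)%E.
    by rewrite l2nE // lee_fin lerBrDr gerDl leNgt e0.
  apply/l2norm2_leP => J; rewrite leNgt; apply/negP => xJ; apply: nJ.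
  by exists J.
exists J0 => J JJ; rewrite ltrBlDr -ltrBlDl (lt_le_trans xJ0) //.
exact: sqsum_mono.
Qed.

Lemma sqsum_tail x (e : R) : l2 x -> 0 < e ->
  exists J0, forall J, (J0 `<=` J)%fset ->
    (l2norm2 (fun i => (x i - cutoff J x i)%R) <= e%:E)%E.
Proof.
move=> x2 e0; have [J0 J0P] := l2n_approx x2 e0; exists J0 => J JJ.
by rewrite (le_trans (l2norm2_cutoffC J x2)) // lee_fin ltW // J0P.
Qed.

End SquareSummable.

Section VectorSequences.
Variables (R : realType) (G : zmodType) (N : nat).
Local Notation C := R[i].
Implicit Types x y : G -> 'cV[C]_N.

(** Convolution acts on vector-valued functions on [G], whereas the Riesz basis is a family indexed
    by pairs; the flattening passes from one to the other. *)
Definition flatten_vec x : G * 'I_N -> C := fun p => x p.1 p.2 ord0.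
Definition unflatten_vec (c : G * 'I_N -> C) : G -> 'cV[C]_N :=
  fun g => \col_n c (g, n).

Lemma flatten_vecK : cancel flatten_vec unflatten_vec.
Proof. by move=> x; apply/funext => g; apply/colP => n; rewrite mxE. Qed.

Lemma unflatten_vecK : cancel unflatten_vec flatten_vec.
Proof. by move=> c; apply/funext => -[g n]; rewrite /flatten_vec mxE. Qed.

Lemma vl2norm2E x : vl2norm2 x = l2norm2 (flatten_vec x).
Proof.
rewrite /vl2norm2 /l2norm2 -esum_sum; last by move=> *; rewrite lee_fin sqr_ge0.
have -> : [set: G * 'I_N] = [set: G] `*`` (fun=> [set: 'I_N]) by apply/seteqP; split.
rewrite -(@esum_esum _ _ _ _ _ (fun g n => (rnorm (x g n ord0) ^+ 2)%:E)); last first.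
  by move=> *; rewrite lee_fin sqr_ge0.
apply: eq_esum => g _; rewrite esum_fset; last by move=> *; rewrite lee_fin sqr_ge0.
  rewrite fsbig_finite //= -big_enum /=; apply: perm_big.
  apply: uniq_perm; rewrite ?enum_uniq ?fset_uniq // => n.
  by rewrite mem_enum in_fset_set ?mem_setT //; exact: finite_finset.
exact: finite_finset.
Qed.

Lemma vl2P x : vl2 x <-> l2 (flatten_vec x).
Proof.
rewrite /l2 /= -vl2norm2E /vl2norm2; split=> [x2|].
  by apply: lte_sum_pinfty => n _; exact: x2.
move=> xfin n; apply: le_lt_trans xfin; rewrite (bigD1 n) //= leeDl //.
by apply: sume_ge0 => m _; exact: l2norm2_ge0.
Qed.

End VectorSequences.

(** * Bessel inequalities and frames *)


Section InnerProduct.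
Variables (R : realType) (H : completeNormedModType R[i]).
Variable ip : {dot H for Num.conj}.
Hypothesis ip_norm : forall v, ip v v = `|v| ^+ 2.
Local Notation C := R[i].
Implicit Types u v w f h : H.

Lemma ipC u v : ip u v = (ip v u)^*.
Proof. by rewrite hermC expr0 mul1r. Qed.

Lemma ipvv v : ip v v = (rnorm v ^+ 2)%:C%C.
Proof. by rewrite ip_norm rmorphXn /= rnormE. Qed.

Lemma ipBl u v w : ip (u - v) w = ip u w - ip v w.
Proof. by rewrite linearBl. Qed.

Lemma ipBr u v w : ip u (v - w) = ip u v - ip u w.
Proof. by rewrite linearBr. Qed.

Lemma ipZl (a : C) u v : ip (a *: u) v = a * ip u v.
Proof. by rewrite linearZl_LR. Qed.

Lemma ipZr (a : C) u v : ip u (a *: v) = a^* * ip u v.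
Proof. by rewrite linearZr_LR. Qed.

Lemma Re_ipC u v : complex.Re (ip u v) = complex.Re (ip v u).
Proof. by rewrite ipC; case: (ip v u). Qed.

Lemma Re_realM (t : R) (z : C) : complex.Re (t%:C%C * z) = t * complex.Re z.
Proof. by rewrite cReM /= mul0r subr0. Qed.

(** This is [0 <= |t u - v|^2] divided by [t]. The free weight [t] lets each later bound absorb one
    of the two squares. *)
Lemma Re_ip_amgm u v (t : R) : 0 < t ->
  2 * complex.Re (ip u v) <= t * rnorm u ^+ 2 + t^-1 * rnorm v ^+ 2.
Proof.
move=> t0; set w := t%:C%C *: u - v.
have : 0 <= complex.Re (ip w w) by rewrite ipvv /= sqr_ge0.
have tr : (t%:C%C)^* = t%:C%C :> C by rewrite conjC_conjc conjc_real.
rewrite /w ipBl !ipBr !ipZl !ipZr tr !ipvv !(cReD, cReN).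
rewrite !Re_realM (Re_ipC v u) /= => pos.
have e : t * rnorm u ^+ 2 + t^-1 * rnorm v ^+ 2 - 2 * complex.Re (ip u v) =
  t^-1 * (t * (t * rnorm u ^+ 2) - t * complex.Re (ip u v) - (t * complex.Re (ip u v) - rnorm v ^+ 2)).
  by field; rewrite gt_eqF.
by rewrite -subr_ge0 e mulr_ge0 // invr_ge0 ltW.
Qed.

Lemma Re_ip_le u v : complex.Re (ip u v) <= rnorm u * rnorm v.
Proof.
have [->|u0] := eqVneq u 0; first by rewrite linear0l rnorm0 mul0r.
have [->|v0] := eqVneq v 0; first by rewrite linear0r rnorm0 mulr0.
have ru : 0 < rnorm u by rewrite lt_neqAle rnorm_ge0 eq_sym rnorm_eq0 u0.
have rv : 0 < rnorm v by rewrite lt_neqAle rnorm_ge0 eq_sym rnorm_eq0 v0.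
(* The optimal weight [|v| / |u|] makes the two squares equal. *)
have := Re_ip_amgm u v (divr_gt0 rv ru).
have -> : rnorm v / rnorm u * rnorm u ^+ 2 + (rnorm v / rnorm u)^-1 * rnorm v ^+ 2 =
   2 * (rnorm u * rnorm v) by field; rewrite !gt_eqF.
by rewrite ler_pM2l.
Qed.

Lemma Re_mul_amgm (z w : C) (t : R) : 0 < t ->
  2 * complex.Re (z * w^*) <= t * rnorm z ^+ 2 + t^-1 * rnorm w ^+ 2.
Proof.
move=> t0; rewrite !rnorm_sqr; case: z => a b; case: w => c d /=.
rewrite -subr_ge0.
have -> : t * (a ^+ 2 + b ^+ 2) + t^-1 * (c ^+ 2 + d ^+ 2) - 2 * (a * c - b * - d) =
   t^-1 * ((t * a - c) ^+ 2 + (t * b - d) ^+ 2) by field; rewrite gt_eqF.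
by rewrite mulr_ge0 ?invr_ge0 ?addr_ge0 ?sqr_ge0 // ltW.
Qed.

Section Families.
Variables (I : choiceType) (S : I -> H).

Lemma ip_synthesis (c : I -> C) (J : {fset I}) h :
  ip (\sum_(i <- J) c i *: S i) h = \sum_(i <- J) c i * (ip h (S i))^*.
Proof. by rewrite linear_sumlz; apply: eq_bigr => i _; rewrite -ipC -ipZl. Qed.

Lemma Re_ip_synthesis_le (c : I -> C) (J : {fset I}) h (t : R) : 0 < t ->
  2 * complex.Re (ip (\sum_(i <- J) c i *: S i) h) <=
  t * sqsum c J + t^-1 * sqsum (fun i => ip h (S i)) J.
Proof.
move=> t0; rewrite ip_synthesis cRe_sum /sqsum !mulr_sumr -big_split /=.
by apply: ler_sum => i _; exact: Re_mul_amgm.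
Qed.

(** The sum [h] is paired with itself, with weight [b]: the Bessel inequality at [h] turns the
    analysis term into [|h|^2], and [2 |h|^2 <= b |c|^2 + |h|^2]. *)
Lemma synthesis_bound (c : I -> C) (J : {fset I}) (b : R) : 0 < b ->
  (let h := \sum_(i <- J) c i *: S i in
   sqsum (fun i => ip h (S i)) J <= b * rnorm h ^+ 2) ->
  rnorm (\sum_(i <- J) c i *: S i) ^+ 2 <= b * sqsum c J.
Proof.
move=> b0 /=; set h := \sum_(i <- J) _ => hb.
have := Re_ip_synthesis_le c J h b0; rewrite -/h ipvv /=.
have : b^-1 * sqsum (fun i => ip h (S i)) J <= rnorm h ^+ 2.
  by rewrite mulrC ler_pdivrMr // mulrC.
lra.
Qed.

(** Synthesizing the coefficients of [f] itself gives a vector whose inner product with [f] is the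
    sum of squares [s]; with weight [b], [2 s <= b |f|^2 + s]. *)
Lemma analysis_bound (b : R) : 0 < b ->
  (forall (c : I -> C) (J : {fset I}), rnorm (\sum_(i <- J) c i *: S i) ^+ 2 <= b * sqsum c J) ->
  forall f (J : {fset I}), sqsum (fun i => ip f (S i)) J <= b * rnorm f ^+ 2.
Proof.
move=> b0 Sb f J; set c := fun i => ip f (S i); set s := sqsum c J.
have es : ip (\sum_(i <- J) c i *: S i) f = s%:C%C.
  rewrite ip_synthesis rmorph_sum /=; apply: eq_bigr => i _.
  by rewrite -mul_conj_rnorm.
have := Re_ip_amgm f (\sum_(i <- J) c i *: S i) b0; rewrite Re_ipC es /=.
have : b^-1 * rnorm (\sum_(i <- J) c i *: S i) ^+ 2 <= s.
  by rewrite mulrC ler_pdivrMr // mulrC Sb.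
lra.
Qed.

(** Pairing [f] with a partial sum of its expansion, with weight [b^-1], gives
    [2 |f|^2 <= |f|^2 + b Q] up to [e]. *)
Lemma lower_frame_bound (y : I -> C) f (b Q : R) : 0 < b ->
  has_sum (fun i => y i *: S i) f ->
  (forall J, sqsum y J <= b * rnorm f ^+ 2) ->
  (forall J, sqsum (fun i => ip f (S i)) J <= Q) ->
  rnorm f ^+ 2 <= b * Q.
Proof.
move=> b0 /has_sumP yf yb SQ; apply/ler_addgt0Pr => e e0.
(* Chosen so that the inner product of the remainder with [f] is at most [e / 2]; the 1 covers
   [f = 0]. *)
have d0 : 0 < e / (2 * (rnorm f + 1)).
  by rewrite divr_gt0 // mulr_gt0 // ltr_wpDl // rnorm_ge0.
have [J /(_ J (fsubset_refl _))] := yf _ d0.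
set s := \sum_(i <- J) _ => fs.
have bi0 : 0 < b^-1 by rewrite invr_gt0.
have := Re_ip_synthesis_le y J f bi0; rewrite invrK -/s.
have -> : s = f - (f - s) by rewrite opprB addrCA subrr addr0.
rewrite ipBl cReD cReN ipvv /=.
have h1 : complex.Re (ip (f - s) f) <= e / 2.
  rewrite (le_trans (Re_ip_le _ _)) // (@le_trans _ _ (e / (2 * (rnorm f + 1)) * (rnorm f + 1))) //.
    by rewrite ler_pM ?rnorm_ge0 // ?(ltW fs) // lerDl.
  rewrite [leLHS](_ : _ = e / 2) //.
  by field; rewrite gt_eqF // ltr_wpDl // rnorm_ge0.
have h2 : b^-1 * sqsum y J <= rnorm f ^+ 2 by rewrite mulrC ler_pdivrMr // mulrC.
have h3 : b * sqsum (fun i => ip f (S i)) J <= b * Q by rewrite ler_pM2l.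
lra.
Qed.

End Families.
End InnerProduct.

Section HasSumOps.
Variables (R : realType) (V : normedModType R[i]).
Local Notation C := R[i].

Lemma has_sum_reindex (I J : choiceType) (h : I -> J) (k : J -> I) (x : J -> V) s :
  cancel h k -> cancel k h -> has_sum x s -> has_sum (x \o h) s.
Proof.
move=> hK kK /has_sumP xs; apply/has_sumP => e /xs [J0 J0P].
exists [fset k j | j in J0]%fset => K JK.
have := J0P [fset h i | i in K]%fset.
rewrite big_imfset /=; last by move=> i j _ _; exact: can_inj.
apply; apply/fsubsetP => j jJ; apply/imfsetP; exists (k j); last by rewrite kK.
by rewrite (fsubsetP JK) //; apply/imfsetP; exists j.
Qed.

Lemma has_sumB (I : choiceType) (x y : I -> V) s t :
  has_sum x s -> has_sum y t -> has_sum (fun i => x i - y i) (s - t).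
Proof.
move=> /has_sumP xs /has_sumP yt; apply/has_sumP => e e0.
have e2 : 0 < e / 2 by rewrite divr_gt0.
have [J1 J1P] := xs _ e2; have [J2 J2P] := yt _ e2.
exists (J1 `|` J2)%fset => J; rewrite fsubUset => /andP[/J1P h1 /J2P h2].
rewrite sumrB [X in rnorm X](_ : _ = (s - \sum_(i <- J) x i) - (t - \sum_(i <- J) y i)).
  by rewrite (le_lt_trans (rnormD _ _)) // rnormN (splitr e) ltrD.
by rewrite !opprD !opprK addrACA.
Qed.

Lemma has_sum_finsupp (I : choiceType) (x : I -> V) (K : {fset I}) :
  (forall i, i \notin K -> x i = 0) -> has_sum x (\sum_(i <- K) x i).
Proof.
move=> xK; apply/has_sumP => e e0; exists K => J KJ.
by rewrite (big_fset_incl _ KJ) ?subrr ?rnorm0 // => i _; exact: xK.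
Qed.

End HasSumOps.

(** * The synthesis operator of a Riesz sequence *)

Section RieszSynthesis.
Variables (R : realType) (H : completeNormedModType R[i]) (I : choiceType) (e : I -> H).
Local Notation C := R[i].
Implicit Types x y : I -> C.

Definition synthesis_operator (T : (I -> C) -> H) (c d : R) : Prop :=
  [/\ 0 < c, 0 < d,
      forall (a : C) x y, l2 x -> l2 y -> T (fun i => a * x i + y i) = a *: T x + T y,
      forall x, l2 x -> c * l2n x <= rnorm (T x) ^+ 2 <= d * l2n x
    & forall i, T (l2delta R i) = e i].

Lemma riesz_synthesis_operator : riesz_sequence e ->
  exists T c d, synthesis_operator T c d.
Proof.
(* The definition of a Riesz basis puts no sign on the upper constant; the maximum makes it
   positive. *)
move=> [T [Tlin _ [c [d [c0 Tb]]] Te]]; exists T, c, (Num.max d 1); split => //.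
  by rewrite lt_max ltr01 orbT.
move=> x x2; have [] := Tb x x2; rewrite l2nE // -!EFinM !lee_fin => -> h /=.
by rewrite (le_trans h) // ler_wpM2r ?l2n_ge0 // le_max lexx.
Qed.

Variables (T : (I -> C) -> H) (c d : R).
Hypothesis synT : synthesis_operator T c d.

Lemma synop0 : T (fun=> 0) = 0.
Proof.
have [_ _ Tlin _ _] := synT; have l0 := @l2_cst0 R I.
have := Tlin 1 _ _ l0 l0.
rewrite (_ : (fun i : I => 1 * 0 + 0) = (fun=> 0 : C)); last first.
  by apply/funext => i; rewrite mulr0 addr0.
rewrite scale1r => /eqP; rewrite -subr_eq0 opprD addrA subrr sub0r oppr_eq0.
by move/eqP.
Qed.

Lemma synopB x y : l2 x -> l2 y -> T (fun i => x i - y i) = T x - T y.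
Proof.
have [_ _ Tlin _ _] := synT => x2 y2.
have -> : (fun i => x i - y i) = (fun i => -1 * y i + x i).
  by apply/funext => i; rewrite mulN1r addrC.
by rewrite (Tlin _ _ _ y2 x2) scaleN1r addrC.
Qed.

Lemma synop_sum (K : Type) (r : seq K) (a : K -> C) (x : K -> I -> C) :
  (forall k, l2 (x k)) ->
  l2 (fun i => \sum_(k <- r) a k * x k i) /\
  T (fun i => \sum_(k <- r) a k * x k i) = \sum_(k <- r) a k *: T (x k).
Proof.
have [_ _ Tlin _ _] := synT; move=> x2; elim: r => [|k r [r2 IH]].
  have -> : (fun i => \sum_(k <- [::]) a k * x k i) = (fun=> 0).
    by apply/funext => i; rewrite big_nil.
  by rewrite big_nil; split; [exact: l2_cst0|exact: synop0].
have -> : (fun i => \sum_(k <- k :: r) a k * x k i) =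
          (fun i => a k * x k i + \sum_(k <- r) a k * x k i).
  by apply/funext => i; rewrite big_cons.
split; first exact: l2D (l2Z _ (x2 k)) r2.
by rewrite (Tlin (a k) _ _ (x2 k) r2) big_cons IH.
Qed.

Lemma cutoff_delta J x : cutoff J x = (fun i => \sum_(j <- J) x j * l2delta R j i).
Proof.
apply/funext => i; rewrite /cutoff /l2delta; case: ifPn => iJ.
  rewrite (big_fsetD1 i) //= eqxx mulr1 big1_fset ?addr0 // => j.
  by rewrite !inE => /andP[ji _ _]; rewrite eq_sym (negbTE ji) mulr0.
rewrite big1_fset // => j jJ _; rewrite (_ : i == j = false) ?mulr0 //.
by apply: contraNF iJ => /eqP ->.
Qed.

Lemma synop_cutoff J x : T (cutoff J x) = \sum_(i <- J) x i *: e i.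
Proof.
have [_ _ _ _ Te] := synT; rewrite cutoff_delta.
by rewrite (synop_sum J x (@l2_delta R I)).2; apply: eq_bigr => i _; rewrite Te.
Qed.

(** The abstract isomorphism is the series: finite truncations of [x] converge to [x] in [l2], and
    [T] is bounded. *)
Lemma synop_has_sum x : l2 x -> has_sum (fun i => x i *: e i) (T x).
Proof.
have [_ d0 _ Tb _] := synT; move=> x2; apply/has_sumP => r r0.
(* The squared norm of the remainder is then at most [r ^+ 2 / 2], strictly below [r ^+ 2]. *)
have r1 : 0 < r ^+ 2 / (2 * d) by rewrite divr_gt0 ?mulr_gt0 ?exprn_gt0.
have [J0 J0P] := sqsum_tail x2 r1; exists J0 => J /J0P xJ.
rewrite -synop_cutoff -synopB //; last exact: cutoff_l2.
have z2 : l2 (fun i => x i - cutoff J x i).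
  by apply: (le_lt_trans xJ); rewrite ltry.
have /andP[_ h] := Tb _ z2.
rewrite -(@ltr_pXn2r _ 2) ?nnegrE ?rnorm_ge0 ?(ltW r0) // (le_lt_trans h) //.
rewrite (@le_lt_trans _ _ (d * (r ^+ 2 / (2 * d)))) //.
  by rewrite ler_pM2l // -lee_fin -l2nE.
rewrite [ltLHS](_ : _ = r ^+ 2 / 2); last by field; rewrite gt_eqF.
by rewrite ltr_pdivrMr // ltr_pMr ?exprn_gt0 // ltrDl.
Qed.

Lemma synop_inj x y : l2 x -> l2 y -> T x = T y -> x = y.
Proof.
have [c0 _ _ Tb _] := synT; move=> x2 y2 Txy.
have z2 : l2 (fun i => x i - y i).
  have -> : (fun i => x i - y i) = (fun i => x i + -1 * y i).
    by apply/funext => i; rewrite mulN1r.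
  exact: l2D x2 (l2Z _ y2).
have /andP[h _] := Tb _ z2; move: h; rewrite synopB // Txy subrr rnorm0 expr0n /=.
rewrite pmulr_rle0 // => zn; apply/funext => i.
have := sqsum_le [fset i]%fset z2; rewrite /sqsum big_seq_fset1 => /le_trans/(_ zn) h.
by apply/eqP; rewrite -subr_eq0 -rnorm_eq0 -sqrf_eq0 eq_le h sqr_ge0.
Qed.

End RieszSynthesis.

(** What the Hilbert space side has to know about the convolution; the Fourier side provides it for
    bounded transfer matrices. Compatibility with differences is part of it because [convolution] is
    a [summability.sum], which is additive only on convergent series. *)
Definition bounded_convolution (R : realType) (G : zmodType) (M N : nat)
    (B : G -> 'M[R[i]]_(N, M)) (b : R) : Prop :=
  [/\ 0 < b,
      forall y, vl2 y -> vl2 (mxconvolution B y) /\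
        (vl2norm2 (mxconvolution B y) <= b%:E * vl2norm2 y)%E
    & forall x y, vl2 x -> vl2 y ->
        mxconvolution B (fun g => x g - y g) =
        (fun g => mxconvolution B x g - mxconvolution B y g)].

(** * Shift-invariant spaces: reconstruction as convolution *)

Section ShiftInvariant.
Variables (R : realType) (H : completeNormedModType R[i]).
Local Notation C := R[i].
Variable ip : {dot H for Num.conj}.
Hypothesis ip_norm : forall v, ip v v = `|v| ^+ 2.

Section Frames.
Variables (I : choiceType) (V : set H) (S : I -> H).

Lemma frame_synthesis_bound : frame ip V S ->
  (forall (c : I -> C) (J : {fset I}), V (\sum_(i <- J) c i *: S i)) ->
  exists2 b : R, 0 < b &
    forall (c : I -> C) (J : {fset I}), rnorm (\sum_(i <- J) c i *: S i) ^+ 2 <= b * sqsum c J.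
Proof.
move=> [VS [a [b [a0 ab fS]]]] Vlin; have b0 := lt_le_trans a0 ab; exists b => // c J.
apply: (synthesis_bound ip_norm b0) => /=; have [_ h] := fS _ (Vlin c J).
by rewrite -lee_fin (le_trans _ h) // sqsum_le_l2norm2.
Qed.

(* The upper bound is dual to the synthesis bound; the lower one follows by pairing
   the expansion of f with f itself. *)
Lemma frame_of_reconstruction (a b : R) : 0 < a -> 0 < b -> (forall i, V (S i)) ->
  (forall (c : I -> C) (J : {fset I}), rnorm (\sum_(i <- J) c i *: S i) ^+ 2 <= b * sqsum c J) ->
  (forall f, V f -> exists2 y : I -> C, has_sum (fun i => y i *: S i) f &
     forall J, sqsum y J <= a * rnorm f ^+ 2) ->
  frame ip V S.
Proof.
move=> a0 b0 VS Sb Srec; split => //.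
have ub f J : sqsum (fun i => ip f (S i)) J <= b * rnorm f ^+ 2.
  exact: (analysis_bound ip_norm b0 Sb).
have f2 f : l2 (fun i => ip f (S i)) by apply/l2P; exists (b * rnorm f ^+ 2).
exists a^-1, (Num.max b a^-1); split; first by rewrite invr_gt0.
  by rewrite le_max lexx orbT.
move=> f Vf; have [y yf yb] := Srec f Vf.
split.
  rewrite [leRHS](l2nE (f2 f)) lee_fin mulrC ler_pdivrMr // mulrC.
  by apply: (lower_frame_bound ip_norm a0 yf yb) => J; exact: sqsum_le.
apply/(l2norm2_leP (fun i => ip f (S i))) => J; rewrite (le_trans (ub f J)) //.
by rewrite ler_wpM2r ?sqr_ge0 // le_max lexx.
Qed.

End Frames.

Variables (G : zmodType) (U : G -> H -> H) (N : nat) (phi : 'I_N -> H).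
Hypothesis U_rep : unitary_representation ip U.
Variables (T : (G * 'I_N -> C) -> H) (c d : R).
Hypothesis synT : synthesis_operator (orbit_family U phi) T c d.

Lemma synthesisP x f : vl2 x -> synthesis U phi x f <-> f = T (flatten_vec x).
Proof.
move=> /vl2P x2; have Tx := synop_has_sum synT x2.
by split=> [xf|->//]; exact: has_sum_unique xf Tx.
Qed.

Lemma VPhiP f : VPhi U phi f <-> exists2 z, l2 z & f = T z.
Proof.
split=> [[x x2 xf]|[z z2 ->]].
  by exists (flatten_vec x); [exact/vl2P|exact/synthesisP].
have x2 : vl2 (unflatten_vec z) by apply/vl2P; rewrite unflatten_vecK.
by exists (unflatten_vec z) => //; apply/synthesisP; rewrite // unflatten_vecK.
Qed.

Lemma VPhi_sum (I : choiceType) (S : I -> H) (a : I -> C) (J : {fset I}) :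
  (forall i, VPhi U phi (S i)) -> VPhi U phi (\sum_(i <- J) a i *: S i).
Proof.
move=> VS; have /choice [z zS] : forall i, exists z, l2 z /\ S i = T z.
  by move=> i; have /VPhiP [z] := VS i; exists z.
apply/VPhiP; have [s2 Ts] := synop_sum synT J a (fun i => (zS i).1).
by eexists; first exact: s2; rewrite Ts; apply: eq_bigr => i _; rewrite (zS i).2.
Qed.

Definition translate (g : G) (z : G * 'I_N -> C) : G * 'I_N -> C :=
  fun p => z (p.1 - g, p.2).

Lemma translate_l2 g z : l2 z -> l2 (translate g z).
Proof.
move=> /l2P [b zb]; apply/l2P; exists b => J.
rewrite (le_trans _ (zb [fset (p.1 - g, p.2) | p in J]%fset)) //.
by rewrite /sqsum big_imfset //= => -[g1 n1] [g2 n2] _ _ [/addIr -> ->].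
Qed.

Lemma unitary_linear g : linear (U g).
Proof. by have [Ug _] := U_rep; have [] := Ug g. Qed.

Lemma unitaryD g u v : U g (u + v) = U g u + U g v.
Proof. by have := unitary_linear g 1 u v; rewrite !scale1r. Qed.

Lemma unitary0 g : U g 0 = 0.
Proof.
have /eqP := unitaryD g 0 0.
by rewrite addr0 -subr_eq0 opprD addrA subrr sub0r oppr_eq0 => /eqP.
Qed.

Lemma unitaryZ g (a : C) v : U g (a *: v) = a *: U g v.
Proof. by have := unitary_linear g a v 0; rewrite !addr0 unitary0 addr0. Qed.

Lemma unitary_rnorm g v : rnorm (U g v) = rnorm v.
Proof.
have [Ug _] := U_rep; have [_ _ /(_ v v)] := Ug g.
rewrite !(ipvv ip_norm) => /(@complexI R)/eqP.
by rewrite eqrXn2 ?rnorm_ge0 // => /eqP.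
Qed.

Lemma unitary_has_sum (I : choiceType) g (x : I -> H) s :
  has_sum x s -> has_sum (fun i => U g (x i)) (U g s).
Proof.
move=> /has_sumP xs; apply/has_sumP => e /xs [J0 J0P]; exists J0 => J /J0P.
rewrite -(unitary_rnorm g); congr (_ < _); congr rnorm.
have -> : s - \sum_(i <- J) x i = -1 *: (\sum_(i <- J) x i) + s by rewrite scaleN1r addrC.
rewrite unitary_linear scaleN1r addrC; congr (_ - _).
by elim/big_rec2: _ => [|i u v _ <-]; rewrite ?unitary0 ?unitaryD.
Qed.

(** [U g] permutes the orbit family, sending index [(a, n)] to [(a + g, n)]; the series of [T z] is
    reindexed accordingly. *)
Lemma unitary_synop g z : l2 z -> U g (T z) = T (translate g z).
Proof.
move=> z2; have [_ Uhom] := U_rep.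
have := synop_has_sum synT (translate_l2 g z2).
set h := fun p : G * 'I_N => (p.1 + g, p.2); set k := fun p : G * 'I_N => (p.1 - g, p.2).
have hk : cancel h k by case=> a n; rewrite /h /k /= addrK.
have kh : cancel k h by case=> a n; rewrite /h /k /= subrK.
move=> /(has_sum_reindex hk kh) /has_sum_unique Tz; apply/esym/Tz.
have := unitary_has_sum (g := g) (synop_has_sum synT z2).
congr has_sum; apply/funext => -[a n]; rewrite /translate /h /= addrK /orbit_family /=.
by rewrite unitaryZ addrC Uhom.
Qed.

Section Columns.
Variables (M : nat) (B : G -> 'M[C]_(N, M)).
Implicit Types y : G * 'I_M -> C.

Definition column (m : 'I_M) : G * 'I_N -> C := fun p => B p.1 p.2 m.

Hypothesis B_l2 : mxl2 B.

Lemma column_l2 m : l2 (column m).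
Proof.
suff : vl2 (fun g => col m (B g)).
  by move/vl2P; congr l2; apply/funext => -[g n]; rewrite /flatten_vec mxE.
by move=> n; have := B_l2 n m; congr l2; apply/funext => g; rewrite mxE.
Qed.

Lemma convolution_finsupp (a x : G -> C) (K : {fset G}) g :
  (forall h, h \notin K -> x h = 0) ->
  convolution a x g = \sum_(h <- K) a (g - h) * x h.
Proof.
move=> xK; apply: (@has_sum_sum _ _ C^o).
by apply: (@has_sum_finsupp _ C^o) => h hK; rewrite xK // mulr0.
Qed.

Lemma mxconvolution_cutoff J y p :
  flatten_vec (mxconvolution B (unflatten_vec (cutoff J y))) p =
  \sum_(q <- J) y q * translate q.1 (column q.2) p.
Proof.
case: p => g n; rewrite /flatten_vec /mxconvolution mxE /translate /column /=.
(* Sorting [J] by its second component matches the sum over [m] in the matrix convolution; the set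
   of first components supports the entry [m] of the truncated sequence. *)
transitivity (\sum_(q <- J) \sum_(m < M | q.2 == m) y q * B (g - q.1) n q.2); last first.
  by apply: eq_bigr => q _; rewrite (big_pred1 q.2) // => m; rewrite eq_sym.
rewrite (exchange_big_dep predT) //=; apply: eq_bigr => m _.
rewrite (@convolution_finsupp _ _ [fset q.1 | q in J & q.2 == m]%fset); last first.
  move=> h hK; rewrite mxE /cutoff ifN //; apply: contra hK => hJ.
  by apply/imfsetP; exists (h, m) => //; rewrite !inE hJ /=.
rewrite big_imfset /=; last first.
  by move=> [g1 m1] [g2 m2] /andP[_ /eqP /= ->] /andP[_ /eqP /= ->] /= ->.
rewrite big_filter big_seq_cond [RHS]big_seq_cond.
apply: eq_bigr => -[h m1] /= /andP[hJ /eqP m1m].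
by rewrite mxE /cutoff -m1m hJ mulrC.
Qed.

(** The dictionary between reconstruction elements and matrices: for [S m = T (column m)], synthesis
    with the orbit of [S] is convolution by [B] followed by [T], because [U g] acts on coefficients
    as a translation. *)
Lemma columns_synthesis J y :
  l2 (flatten_vec (mxconvolution B (unflatten_vec (cutoff J y)))) /\
  \sum_(q <- J) y q *: orbit_family U (fun m => T (column m)) q =
  T (flatten_vec (mxconvolution B (unflatten_vec (cutoff J y)))).
Proof.
have [s2 Ts] := synop_sum synT J y (fun q => translate_l2 q.1 (column_l2 q.2)).
have -> : flatten_vec (mxconvolution B (unflatten_vec (cutoff J y))) =
    fun p => \sum_(q <- J) y q * translate q.1 (column q.2) p.
  by apply/funext => p; exact: mxconvolution_cutoff.
split => //; rewrite Ts; apply: eq_bigr => q _.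
by rewrite /orbit_family unitary_synop //; exact: column_l2.
Qed.

Lemma columns_synthesis_bound (b : R) : bounded_convolution B b ->
  forall y (J : {fset G * 'I_M}),
  rnorm (\sum_(q <- J) y q *: orbit_family U (fun m => T (column m)) q) ^+ 2 <=
  d * b * sqsum y J.
Proof.
move=> [b0 Bb _] y J; have [s2 ->] := columns_synthesis J y.
have [_ d0 _ Tb _] := synT; have /andP[_ h] := Tb _ s2; rewrite (le_trans h) //.
rewrite -mulrA ler_pM2l // -lee_fin -l2nE // -vl2norm2E.
have y2 : vl2 (unflatten_vec (cutoff J y)).
  by apply/vl2P; rewrite unflatten_vecK; exact: cutoff_l2.
rewrite (le_trans (Bb _ y2).2) // vl2norm2E unflatten_vecK l2norm2_cutoff.
by rewrite EFinM.
Qed.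

(** The remainder of a partial sum is [T] of [B] convolved with a tail of [y], and its squared norm
    is at most [d * b] times that of the tail. *)
Lemma columns_has_sum (b : R) y : bounded_convolution B b -> l2 y ->
  has_sum (fun q => y q *: orbit_family U (fun m => T (column m)) q)
    (T (flatten_vec (mxconvolution B (unflatten_vec y)))).
Proof.
move=> [b0 Bb BB] y2; have [_ d0 _ Tb _] := synT; apply/has_sumP => e e0.
have db0 : 0 < d * b by rewrite mulr_gt0.
have r1 : 0 < e ^+ 2 / (2 * (d * b)) by rewrite divr_gt0 ?mulr_gt0 ?exprn_gt0.
have [J0 J0P] := sqsum_tail y2 r1; exists J0 => J /J0P yJ.
have [s2 ->] := columns_synthesis J y.
have vy2 : vl2 (unflatten_vec y) by apply/vl2P; rewrite unflatten_vecK.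
have vc2 : vl2 (unflatten_vec (cutoff J y)).
  by apply/vl2P; rewrite unflatten_vecK; exact: cutoff_l2.
have By2 := (vl2P _).1 (Bb _ vy2).1.
rewrite -(synopB synT) //.
have eD : (fun p => flatten_vec (mxconvolution B (unflatten_vec y)) p -
    flatten_vec (mxconvolution B (unflatten_vec (cutoff J y))) p) =
    flatten_vec (mxconvolution B (unflatten_vec (fun q => y q - cutoff J y q))).
  have -> : unflatten_vec (fun q => y q - cutoff J y q) =
      fun g => unflatten_vec y g - unflatten_vec (cutoff J y) g.
    by apply/funext => g; apply/colP => n; rewrite !mxE.
  by rewrite BB //; apply/funext => p; rewrite /flatten_vec !mxE.
rewrite eD; set w := fun q => y q - _ in eD yJ *.
have w2 : l2 w by apply: (le_lt_trans yJ); rewrite ltry.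
have vw2 : vl2 (unflatten_vec w) by apply/vl2P; rewrite unflatten_vecK.
have [Bw2 Bwb] := Bb _ vw2.
have /andP[_ h] := Tb _ ((vl2P _).1 Bw2).
rewrite -(@ltr_pXn2r _ 2) ?nnegrE ?rnorm_ge0 ?(ltW e0) // (le_lt_trans h) //.
rewrite (@le_lt_trans _ _ (d * (b * (e ^+ 2 / (2 * (d * b)))))) //.
  rewrite ler_pM2l // -lee_fin -l2nE; last exact/vl2P.
  rewrite -vl2norm2E (le_trans Bwb) // vl2norm2E unflatten_vecK EFinM.
  by rewrite lee_pmul2l ?lte_fin.
rewrite [ltLHS](_ : _ = e ^+ 2 / 2); last by field; rewrite !gt_eqF.
by rewrite ltr_pdivrMr // ltr_pMr ?exprn_gt0 // ltrDl.
Qed.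

Lemma columns_VPhi m : VPhi U phi (T (column m)).
Proof. by apply/VPhiP; exists (column m) => //; exact: column_l2. Qed.

Lemma orbit_VPhi (S : 'I_M -> H) q : (forall m, VPhi U phi (S m)) ->
  VPhi U phi (orbit_family U S q).
Proof.
move=> /(_ q.2)/VPhiP [z z2 Sz]; apply/VPhiP; rewrite /orbit_family Sz.
by rewrite unitary_synop //; exists (translate q.1 z) => //; exact: translate_l2.
Qed.

Section LeftInverse.
Variables (A : G -> 'M[C]_(M, N)) (a : R).
Hypothesis Aa : bounded_convolution A a.

Lemma left_inverse_reconstructs (b : R) : bounded_convolution B b ->
  (forall x, vl2 x -> mxconvolution B (mxconvolution A x) = x) ->
  reconstructs U phi A (orbit_family U (fun m => T (column m))).
Proof.
move=> Bb BA x f x2 xf; have [_ Ab _] := Aa; have [Ax2 _] := Ab x x2.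
have := columns_has_sum Bb ((vl2P _).1 Ax2); rewrite flatten_vecK BA //.
by rewrite -((synthesisP f x2).1 xf).
Qed.

Lemma samples_bound x f : vl2 x -> synthesis U phi x f ->
  (vl2norm2 (mxconvolution A x) <= (a / c * rnorm f ^+ 2)%:E)%E.
Proof.
move=> x2 /(synthesisP _ x2) ->; have [a0 Ab _] := Aa; have [_ h] := Ab x x2.
apply: (le_trans h); have fx2 := (vl2P x).1 x2.
have [c0 _ _ /(_ _ fx2)/andP[Tb _] _] := synT.
rewrite vl2norm2E l2nE // -EFinM lee_fin -mulrA ler_pM2l //.
by rewrite mulrC ler_pdivlMr // mulrC.
Qed.

Lemma left_inverse_frame (b : R) : bounded_convolution B b ->
  (forall x, vl2 x -> mxconvolution B (mxconvolution A x) = x) ->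
  frame ip (VPhi U phi) (orbit_family U (fun m => T (column m))).
Proof.
move=> Bb BA; have [c0 d0 _ _ _] := synT; have [b0 _ _] := Bb; have [a0 _ _] := Aa.
apply: (@frame_of_reconstruction _ _ _ (a / c) (d * b)).
- by rewrite divr_gt0.
- by rewrite mulr_gt0.
- by move=> q; apply: orbit_VPhi; exact: columns_VPhi.
- exact: columns_synthesis_bound.
move=> f [x x2 xf]; exists (flatten_vec (mxconvolution A x)).
  exact: left_inverse_reconstructs Bb BA _ _ x2 xf.
by apply/l2norm2_leP; rewrite -vl2norm2E; exact: samples_bound.
Qed.

(** The reconstruction series sums both to [T x] and to [T] of the double convolution, and [T] is
    injective. *)
Lemma reconstructs_left_inverse (b : R) : bounded_convolution B b ->
  reconstructs U phi A (orbit_family U (fun m => T (column m))) ->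
  forall x, vl2 x -> mxconvolution B (mxconvolution A x) = x.
Proof.
move=> Bb rec x x2; have [_ Ab _] := Aa; have [Ax2 _] := Ab x x2.
have /rec/(_ ((synthesisP _ x2).2 erefl)) := x2.
have := columns_has_sum Bb ((vl2P _).1 Ax2); rewrite flatten_vecK.
move=> /has_sum_unique h /h {}h.
have [_ Bb' _] := Bb.
have := synop_inj synT ((vl2P _).1 (Bb' _ Ax2).1) ((vl2P _).1 x2) h.
exact: (can_inj (@flatten_vecK _ _ _)).
Qed.

End LeftInverse.

(** The lower Riesz bound brings an estimate in [H] back to coefficients. Finitely supported [y] are
    all that can be treated here, since nothing is known yet about convolving [B] with a general
    [l2] sequence. *)
Lemma synthesis_bound_convolution (b : R) :
  (forall y (J : {fset G * 'I_M}),
    rnorm (\sum_(q <- J) y q *: orbit_family U (fun m => T (column m)) q) ^+ 2 <=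
    b * sqsum y J) ->
  forall y J, (l2norm2 (flatten_vec (mxconvolution B (unflatten_vec (cutoff J y)))) <=
    (b / c * sqsum y J)%:E)%E.
Proof.
move=> Sb y J; have := Sb y J; have [s2 ->] := columns_synthesis J y => h.
have [c0 _ _ /(_ _ s2)/andP[Tb _] _] := synT.
rewrite l2nE // lee_fin mulrAC ler_pdivlMr // mulrC.
exact: le_trans Tb h.
Qed.

End Columns.

(** [f] is a limit of partial sums of its expansion, each of squared norm at most [b] times that of
    the samples. *)
Lemma synthesis_lower_bound (M : nat) (A : G -> 'M[C]_(M, N)) (S : G * 'I_M -> H) (b : R) :
  reconstructs U phi A S ->
  0 < b -> (forall y (J : {fset G * 'I_M}), rnorm (\sum_(q <- J) y q *: S q) ^+ 2 <= b * sqsum y J) ->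
  forall x f, vl2 x -> synthesis U phi x f -> vl2 (mxconvolution A x) ->
  ((b^-1 * rnorm f ^+ 2)%:E <= vl2norm2 (mxconvolution A x))%E.
Proof.
move=> rec b0 Sb x f x2 xf /vl2P Ax2; have /has_sumP fs := rec x f x2 xf.
rewrite vl2norm2E l2nE // lee_fin mulrC ler_pdivrMr // mulrC.
set y := flatten_vec _ in Ax2 *; have n0 : 0 <= b * l2n y by rewrite mulr_ge0 ?l2n_ge0 ?ltW.
rewrite -(sqr_sqrtr n0) ler_pXn2r ?nnegrE ?rnorm_ge0 ?sqrtr_ge0 //.
apply/ler_addgt0Pr => e /fs [J /(_ J (fsubset_refl _)) fJ].
set s := \sum_(i <- J) _ in fJ; rewrite -(subrK s f) (le_trans (rnormD _ _)) // addrC.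
rewrite lerD ?(ltW fJ) // -(@ler_pXn2r _ 2) ?nnegrE ?rnorm_ge0 ?sqrtr_ge0 //.
by rewrite sqr_sqrtr // (le_trans (Sb _ _)) // ler_pM2l // sqsum_le.
Qed.

End ShiftInvariant.

(** * Integration on the dual group *)


Section DualMeasurability.
Variables (R : realType) (G : zmodType).
Local Notation C := R[i].
Local Notation X := (borel_dual R G).
Implicit Types (F K : X -> C).

Lemma pairing_continuous (g : G) : continuous (fun xi : dual R G => (pairing g xi : C^o)).
Proof.
move=> xi.
apply: (@continuous_comp _ _ _ (fun xi : dual R G => (\val xi : {ptws G -> C^o}))
  (@proj G (fun=> C^o) g)); first exact: initial_continuous.
exact: proj_continuous.
Qed.

Lemma lipschitz_continuous (f : C^o -> R) :
  (forall z w, `|f z - f w| <= rnorm (z - w)) -> continuous f.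
Proof.
move=> fl z; apply/(@cvgrPdist_lt R R C^o (nbhs z) (nbhs_filter z)) => e e0.
have : \forall w \near z, `|z - w| < e%:C%C.
  by apply/nbhs_ballP; exists e%:C%C; rewrite /= ?ltcR // => w; rewrite -ball_normE.
by apply: filterS => w; rewrite -rnormE ltcR; exact: le_lt_trans.
Qed.

Lemma continuous_dual_measurable (f : dual R G -> R) : continuous f ->
  measurable_fun [set: X] (f : X -> R).
Proof.
move=> cf; apply: (measurability _ (@RGenOpens.measurableE R)).
move=> _ [_ [x [y ->]] <-]; rewrite setTI; apply: sub_sigma_algebra.
by move/continuousP: cf; apply; exact: interval_open.
Qed.

Lemma pairing_cmeasurable (g : G) : cmeasurable (pairing g : X -> C).
Proof.
split; apply: continuous_dual_measurable => xi.
  apply: (@continuous_comp _ _ _ (fun xi : dual R G => (pairing g xi : C^o)) (@complex.Re R)).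
    exact: pairing_continuous.
  by apply: lipschitz_continuous => z w; rewrite -cReN -cReD Re_le_rnorm.
apply: (@continuous_comp _ _ _ (fun xi : dual R G => (pairing g xi : C^o)) (@complex.Im R)).
  exact: pairing_continuous.
by apply: lipschitz_continuous => z w; rewrite -cImN -cImD Im_le_rnorm.
Qed.

Lemma cmeasurable_cst (z : C) : cmeasurable (cst z : X -> C).
Proof. by split; exact: measurable_cst. Qed.

Lemma cmeasurableD F K : cmeasurable F -> cmeasurable K ->
  cmeasurable (fun xi => F xi + K xi).
Proof.
move=> [F1 F2] [K1 K2]; split.
  rewrite (_ : (fun xi => _) = (fun xi => complex.Re (F xi)) \+ (fun xi => complex.Re (K xi))).
    exact: measurable_funD.
  by apply/funext => xi; rewrite /= cReD.
rewrite (_ : (fun xi => _) = (fun xi => complex.Im (F xi)) \+ (fun xi => complex.Im (K xi))).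
  exact: measurable_funD.
by apply/funext => xi; rewrite /= cImD.
Qed.

Lemma cmeasurableM F K : cmeasurable F -> cmeasurable K ->
  cmeasurable (fun xi => F xi * K xi).
Proof.
move=> [F1 F2] [K1 K2]; split.
  rewrite (_ : (fun xi => _) =
    ((fun xi => complex.Re (F xi)) \* (fun xi => complex.Re (K xi))) \-
    ((fun xi => complex.Im (F xi)) \* (fun xi => complex.Im (K xi)))).
    by apply: measurable_funB; exact: measurable_funM.
  by apply/funext => xi; rewrite /= cReM.
rewrite (_ : (fun xi => _) =
  ((fun xi => complex.Re (F xi)) \* (fun xi => complex.Im (K xi))) \+
  ((fun xi => complex.Im (F xi)) \* (fun xi => complex.Re (K xi)))).
  by apply: measurable_funD; exact: measurable_funM.
by apply/funext => xi; rewrite /= cImM.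
Qed.

Lemma cmeasurableZ (z : C) F : cmeasurable F -> cmeasurable (fun xi => z * F xi).
Proof. by move=> mF; apply: (cmeasurableM (cmeasurable_cst z) mF). Qed.

Lemma cmeasurableB F K : cmeasurable F -> cmeasurable K ->
  cmeasurable (fun xi => F xi - K xi).
Proof.
move=> mF mK; rewrite (_ : (fun xi => _) = (fun xi => F xi + -1 * K xi)).
  by apply: cmeasurableD => //; exact: cmeasurableZ.
by apply/funext => xi; rewrite mulN1r.
Qed.

Lemma cmeasurable_conj F : cmeasurable F -> cmeasurable (fun xi => (F xi)^*).
Proof.
move=> [F1 F2]; split.
  rewrite (_ : (fun xi => _) = fun xi => complex.Re (F xi)) //.
  by apply/funext => xi; case: (F xi).
rewrite (_ : (fun xi => _) = \- (fun xi => complex.Im (F xi))).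
  exact: measurable_funN.
by apply/funext => xi /=; case: (F xi).
Qed.

Lemma cmeasurable_sqr F : cmeasurable F ->
  measurable_fun [set: X] (fun xi => (rnorm (F xi) ^+ 2)%:E).
Proof.
move=> [F1 F2]; apply/measurable_EFinP.
rewrite (_ : (fun xi => _) = (fun xi => complex.Re (F xi) ^+ 2) \+ (fun xi => complex.Im (F xi) ^+ 2)).
  by apply: measurable_funD; exact: measurable_funX.
by apply/funext => xi; rewrite /= rnorm_sqr.
Qed.

Lemma cmeasurable_rnorm F : cmeasurable F ->
  measurable_fun [set: X] (fun xi => rnorm (F xi)).
Proof.
move=> mF; rewrite (_ : (fun xi => _) = (fun xi => Num.sqrt (rnorm (F xi) ^+ 2))).
  apply: measurableT_comp; first by apply: continuous_measurable_fun; exact: sqrt_continuous.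
  by apply/measurable_EFinP; exact: cmeasurable_sqr.
by apply/funext => xi; rewrite sqrtr_sqr ger0_norm // rnorm_ge0.
Qed.

Lemma pairing_norm (g : G) (xi : X) : `|pairing g xi| = 1.
Proof. by have [x1 _] := set_mem (valP xi); exact: x1. Qed.

Lemma pairing_rnorm (g : G) (xi : X) : rnorm (pairing g xi) = 1.
Proof. by rewrite /rnorm pairing_norm. Qed.

Lemma pairingD (g h : G) (xi : X) : pairing (g + h) xi = pairing g xi * pairing h xi.
Proof. by have [_ xD] := set_mem (valP xi); exact: xD. Qed.

Lemma pairing_mul_conj (g : G) (xi : X) : pairing g xi * (pairing g xi)^* = 1.
Proof. by rewrite -normCK pairing_norm expr1n. Qed.

Lemma pairing0 (xi : X) : pairing 0 xi = 1.
Proof.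
have := pairingD 0 0 xi; rewrite addr0 => /(congr1 ( *%R^~ (pairing 0 xi)^*)).
by rewrite -mulrA !pairing_mul_conj mulr1.
Qed.

Lemma pairing_conj (g : G) (xi : X) : (pairing g xi)^* = pairing (- g) xi.
Proof.
have := pairingD (- g) g xi; rewrite addNr pairing0.
move=> /(congr1 ( *%R^~ (pairing g xi)^*)).
by rewrite -mulrA pairing_mul_conj mulr1 mul1r.
Qed.

Lemma pairing_dual_mul (g : G) (xi eta : X) :
  pairing g (dual_mul xi eta) = pairing g xi * pairing g eta.
Proof. by []. Qed.

End DualMeasurability.

Section DualIntegration.
Variables (R : realType) (G : zmodType) (mu : probability (borel_dual R G) R).
Local Notation C := R[i].
Local Notation X := (borel_dual R G).
Implicit Types (F K : X -> C).

Definition sqint F : \bar R := (\int[mu]_xi (rnorm (F xi) ^+ 2)%:E)%E.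

Definition L2 F : Prop := cmeasurable F /\ (sqint F < +oo)%E.

Definition cintegrable F : Prop :=
  cmeasurable F /\ (\int[mu]_xi (rnorm (F xi))%:E < +oo)%E.

Definition cint F : C :=
  Complex (Rintegral mu setT (fun xi => complex.Re (F xi)))
          (Rintegral mu setT (fun xi => complex.Im (F xi))).

Lemma sqint_ge0 F : (0 <= sqint F)%E.
Proof. by apply: integral_ge0 => xi _; rewrite lee_fin sqr_ge0. Qed.

Lemma L2_fin F : L2 F -> sqint F \is a fin_num.
Proof. by move=> [_ ?]; rewrite ge0_fin_numE ?sqint_ge0. Qed.

Lemma le_sqint F K : cmeasurable F -> cmeasurable K ->
  (forall xi, rnorm (F xi) <= rnorm (K xi)) -> (sqint F <= sqint K)%E.
Proof.
move=> mF mK FK; apply: ge0_le_integral => //.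
- by move=> xi _; rewrite lee_fin sqr_ge0.
- exact: cmeasurable_sqr.
- exact: cmeasurable_sqr.
- by move=> xi _; rewrite lee_fin ler_pXn2r ?nnegrE ?rnorm_ge0.
Qed.

Lemma ae_le_sqint F K : cmeasurable F -> cmeasurable K ->
  (\forall xi \ae mu, rnorm (F xi) <= rnorm (K xi)) -> (sqint F <= sqint K)%E.
Proof.
move=> mF mK FK; apply: ae_ge0_le_integral => //.
- by move=> xi _; rewrite lee_fin sqr_ge0.
- exact: cmeasurable_sqr.
- by move=> xi _; rewrite lee_fin sqr_ge0.
- exact: cmeasurable_sqr.
- by move: FK; apply: filterS => xi FK _; rewrite lee_fin ler_pXn2r ?nnegrE ?rnorm_ge0.
Qed.

Lemma sqintZ (z : C) F : cmeasurable F ->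
  sqint (fun xi => z * F xi) = ((rnorm z ^+ 2)%:E * sqint F)%E.
Proof.
move=> mF; rewrite /sqint -ge0_integralZl_EFin //; last 3 first.
- by move=> xi _; rewrite lee_fin sqr_ge0.
- exact: cmeasurable_sqr.
- by rewrite sqr_ge0.
by apply: eq_integral => xi _; rewrite rnormM exprMn.
Qed.

Lemma sqintD F K : cmeasurable F -> cmeasurable K ->
  (sqint (fun xi => (F xi + K xi)%R) <= 2%:E * sqint F + 2%:E * sqint K)%E.
Proof.
move=> mF mK; have mF2 := cmeasurable_sqr mF; have mK2 := cmeasurable_sqr mK.
rewrite /sqint -!ge0_integralZl_EFin //; try by move=> xi _; rewrite lee_fin sqr_ge0.
rewrite -ge0_integralD //; first last.
- by apply: measurable_funeM.
- by move=> xi _; rewrite -EFinM lee_fin mulr_ge0 // sqr_ge0.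
- by apply: measurable_funeM.
- by move=> xi _; rewrite -EFinM lee_fin mulr_ge0 // sqr_ge0.
apply: ge0_le_integral => //.
- by move=> xi _; rewrite lee_fin sqr_ge0.
- by apply: cmeasurable_sqr; exact: cmeasurableD.
- by apply: emeasurable_funD; exact: measurable_funeM.
- by move=> xi _; rewrite -!EFinM -EFinD lee_fin rnorm_sqrD.
Qed.

Lemma sqintN F : sqint (fun xi => - F xi) = sqint F.
Proof. by apply: eq_integral => xi _; rewrite rnormN. Qed.

Lemma sqintB F K : cmeasurable F -> cmeasurable K ->
  (sqint (fun xi => (F xi - K xi)%R) <= 2%:E * sqint F + 2%:E * sqint K)%E.
Proof.
move=> mF mK; rewrite -(sqintN K); apply: (sqintD mF).
rewrite (_ : (fun xi => _) = fun xi => -1 * K xi); first exact: cmeasurableZ.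
by apply/funext => xi; rewrite mulN1r.
Qed.

Lemma sqint_cst (z : C) : sqint (cst z) = (rnorm z ^+ 2)%:E.
Proof. by rewrite /sqint (eq_integral (cst (rnorm z ^+ 2)%:E)) // integral_cst //= probability_setT mule1. Qed.

Lemma L2_cst (z : C) : L2 (cst z).
Proof. by split; [exact: cmeasurable_cst|rewrite sqint_cst ltry]. Qed.

Lemma L2D F K : L2 F -> L2 K -> L2 (fun xi => F xi + K xi).
Proof.
move=> [mF iF] [mK iK]; split; first exact: cmeasurableD.
by apply: (le_lt_trans (sqintD mF mK)); rewrite lte_add_pinfty // lte_mul_pinfty // sqint_ge0.
Qed.

Lemma L2Z (z : C) F : L2 F -> L2 (fun xi => z * F xi).
Proof.
move=> [mF iF]; split; first exact: cmeasurableZ.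
by rewrite sqintZ // lte_mul_pinfty // lee_fin sqr_ge0.
Qed.

Lemma L2B F K : L2 F -> L2 K -> L2 (fun xi => F xi - K xi).
Proof.
move=> F2 K2; rewrite (_ : (fun xi => _) = (fun xi => F xi + -1 * K xi)).
  by apply: L2D => //; exact: L2Z.
by apply/funext => xi; rewrite mulN1r.
Qed.

Lemma L2_conj F : L2 F -> L2 (fun xi => (F xi)^*).
Proof.
move=> [mF iF]; split; first exact: cmeasurable_conj.
by rewrite (_ : sqint _ = sqint F) //; apply: eq_integral => xi _; rewrite rnorm_conj.
Qed.

Lemma bounded_mul_sqint F K (c : R) : 0 <= c -> cmeasurable F -> cmeasurable K ->
  (\forall xi \ae mu, rnorm (F xi) <= c) ->
  (sqint (fun xi => (F xi * K xi)%R) <= (c ^+ 2)%:E * sqint K)%E.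
Proof.
move=> c0 mF mK Fc; have <- : rnorm c%:C%C = c by rewrite rnorm_real ger0_norm.
rewrite -sqintZ //; apply: ae_le_sqint.
- exact: cmeasurableM.
- exact: cmeasurableZ.
- by move: Fc; apply: filterS => xi Fc; rewrite !rnormM ler_wpM2r ?rnorm_ge0 // rnorm_real ger0_norm.
Qed.

Lemma L2_bounded_mul F K (c : R) : cmeasurable F -> (\forall xi \ae mu, rnorm (F xi) <= c) ->
  L2 K -> L2 (fun xi => F xi * K xi).
Proof.
move=> mF Fc [mK iK]; split; first exact: cmeasurableM.
have Fc' : \forall xi \ae mu, rnorm (F xi) <= Num.max c 0.
  by move: Fc; apply: filterS => xi Fc; rewrite le_max Fc.
have c0 : 0 <= Num.max c 0 by rewrite le_max lexx orbT.
apply: (le_lt_trans (bounded_mul_sqint c0 mF mK Fc')).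
by rewrite lte_mul_pinfty // lee_fin sqr_ge0.
Qed.

Lemma L2_sum (I : Type) (r : seq I) (F : I -> X -> C) :
  (forall i, L2 (F i)) -> L2 (fun xi => \sum_(i <- r) F i xi).
Proof.
move=> F2; elim: r => [|i r IH].
  rewrite (_ : (fun xi => _) = cst 0); first exact: L2_cst.
  by apply/funext => xi; rewrite big_nil.
rewrite (_ : (fun xi => _) = (fun xi => F i xi + \sum_(i <- r) F i xi)).
  exact: L2D.
by apply/funext => xi; rewrite big_cons.
Qed.

Lemma cintegrable_Re F : cintegrable F -> mu.-integrable setT (fun xi => (complex.Re (F xi))%:E).
Proof.
move=> [mF iF]; apply/integrableP; split; first by apply/measurable_EFinP; exact: mF.1.
apply: (le_lt_trans _ iF); apply: ge0_le_integral => //.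
- by apply: measurableT_comp => //; apply/measurable_EFinP; exact: mF.1.
- by apply/measurable_EFinP; exact: cmeasurable_rnorm.
- by move=> xi _ /=; rewrite lee_fin Re_le_rnorm.
Qed.

Lemma cintegrable_Im F : cintegrable F -> mu.-integrable setT (fun xi => (complex.Im (F xi))%:E).
Proof.
move=> [mF iF]; apply/integrableP; split; first by apply/measurable_EFinP; exact: mF.2.
apply: (le_lt_trans _ iF); apply: ge0_le_integral => //.
- by apply: measurableT_comp => //; apply/measurable_EFinP; exact: mF.2.
- by apply/measurable_EFinP; exact: cmeasurable_rnorm.
- by move=> xi _ /=; rewrite lee_fin Im_le_rnorm.
Qed.

Lemma integral_rnormM F K (t : R) : 0 < t -> cmeasurable F -> cmeasurable K ->
  (\int[mu]_xi (rnorm (F xi * K xi))%:E <=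
   (t / 2)%:E * sqint F + (t^-1 / 2)%:E * sqint K)%E.
Proof.
move=> t0 mF mK; have mF2 := cmeasurable_sqr mF; have mK2 := cmeasurable_sqr mK.
have t1 : 0 <= t / 2 by rewrite divr_ge0 // ltW.
have t2 : 0 <= t^-1 / 2 by rewrite divr_ge0 // invr_ge0 ltW.
rewrite /sqint -!ge0_integralZl_EFin //; try by move=> xi _; rewrite lee_fin sqr_ge0.
rewrite -ge0_integralD //; first last.
- by apply: measurable_funeM.
- by move=> xi _; rewrite -EFinM lee_fin mulr_ge0 // sqr_ge0.
- by apply: measurable_funeM.
- by move=> xi _; rewrite -EFinM lee_fin mulr_ge0 // sqr_ge0.
apply: ge0_le_integral => //.
- by move=> xi _; rewrite lee_fin rnorm_ge0.
- by apply/measurable_EFinP; apply: cmeasurable_rnorm; exact: cmeasurableM.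
- by apply: emeasurable_funD; exact: measurable_funeM.
- move=> xi _; rewrite -!EFinM -EFinD lee_fin rnormM -subr_ge0.
  set a := rnorm _; set b := rnorm _.
  rewrite [leRHS](_ : _ = t^-1 / 2 * (t * a - b) ^+ 2); last by field; rewrite gt_eqF.
  by rewrite mulr_ge0 // sqr_ge0.
Qed.

Lemma cintegrableM F K : L2 F -> L2 K -> cintegrable (fun xi => F xi * K xi).
Proof.
move=> [mF iF] [mK iK]; split; first exact: cmeasurableM.
apply: (le_lt_trans (integral_rnormM ltr01 mF mK)).
by rewrite lte_add_pinfty // lte_mul_pinfty // sqint_ge0.
Qed.

Lemma L2_cintegrable F : L2 F -> cintegrable F.
Proof.
move=> F2; rewrite (_ : F = fun xi => F xi * cst 1 xi); last first.
  by apply/funext => xi; rewrite mulr1.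
by apply: cintegrableM => //; exact: L2_cst.
Qed.

Lemma cintD F K : cintegrable F -> cintegrable K ->
  cint (fun xi => F xi + K xi) = cint F + cint K.
Proof.
move=> iF iK; apply/eqP; rewrite eq_complex /= -!RintegralD //; last 4 first.
- exact: cintegrable_Im.
- exact: cintegrable_Im.
- exact: cintegrable_Re.
- exact: cintegrable_Re.
by apply/andP; split; apply/eqP; apply: eq_Rintegral => xi _; rewrite ?cReD ?cImD.
Qed.

Lemma cintZ (z : C) F : cintegrable F -> cint (fun xi => z * F xi) = z * cint F.
Proof.
move=> iF; have iR := cintegrable_Re iF; have iI := cintegrable_Im iF.
case: z => a b; apply/eqP; rewrite eq_complex /=.
have ZR r (f : X -> R) : mu.-integrable setT (EFin \o f) -> mu.-integrable setT (EFin \o (fun xi => r * f xi)).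
  by move=> /(integrableZl measurableT r).
rewrite -!RintegralZl // -RintegralB //; try exact: ZR.
rewrite -RintegralD //; try exact: ZR.
apply/andP; split; apply/eqP; apply: eq_Rintegral => xi _; first by case: (F xi).
by case: (F xi) => c d /=; rewrite addrC.
Qed.

Lemma eq_cint F K : (forall xi, F xi = K xi) -> cint F = cint K.
Proof. by move=> FK; congr cint; apply/funext. Qed.

Lemma cint_cst (z : C) : cint (cst z) = z.
Proof.
have Rc (r : R) : Rintegral mu setT (cst r) = r.
  by rewrite /Rintegral (eq_integral (cst r%:E)) // integral_cst //= probability_setT mule1.
by case: z => a b; rewrite /cint /= !Rc.
Qed.

Lemma cint_conj F : cintegrable F -> cint (fun xi => (F xi)^*) = (cint F)^*.
Proof.
move=> iF; rewrite conjC_conjc; apply/eqP; rewrite eq_complex /=.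
apply/andP; split; apply/eqP; first by apply: eq_Rintegral => xi _; case: (F xi).
rewrite -mulN1r -RintegralZl //; last exact: cintegrable_Im.
by apply: eq_Rintegral => xi _; rewrite mulN1r; case: (F xi).
Qed.

Hypothesis mu_haar : haar_measure mu.

(* Translation invariance is used through image measures on the line, so that no
   measurability of the translation itself is needed. *)
Lemma haar_Rintegral (eta : X) (f : X -> R) (b : R) :
  measurable_fun setT f -> measurable_fun setT (fun xi : X => f (dual_mul eta xi)) ->
  (forall xi, `|f xi| <= b) ->
  Rintegral mu setT (fun xi : X => f (dual_mul eta xi)) = Rintegral mu setT f.
Proof.
move=> mf mg fb; set g := fun xi : X => f (dual_mul eta xi).
have bint (h : X -> R) : measurable_fun setT h -> (forall xi, `|h xi| <= b) ->
    mu.-integrable setT (EFin \o h).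
  move=> mh hb; apply: measurable_bounded_integrable => //.
    by rewrite [X in (X < _)%E](probability_setT mu) ltry.
  exists b; split; rewrite ?num_real // => x bx xi _ /=.
  exact: le_trans (hb xi) (ltW bx).
have pushE (h : X -> R) : measurable_fun setT h -> (forall xi, `|h xi| <= b) ->
    Rintegral mu setT h = fine (\int[pushforward mu h]_y y%:E).
  move=> mh hb; rewrite integral_pushforward //; last exact: bint.
rewrite !pushE // => [|xi]; last exact: fb.
congr fine; apply: eq_measure_integral => B mB _.
rewrite /pushforward; apply: mu_haar.
by rewrite -[X in measurable X]setTI; exact: mf.
Qed.

Lemma pairing_L2 (g : G) : L2 (pairing g : X -> C).
Proof.
split; first exact: pairing_cmeasurable.
rewrite (_ : sqint _ = sqint (cst 1)); first by case: (L2_cst 1).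
by apply: eq_integral => xi _; rewrite /= pairing_rnorm rnorm1.
Qed.

(** Translation by a character [eta] with [pairing g eta != 1] preserves the integral and multiplies
    it by [pairing g eta], so it vanishes for [g != 0]. *)
Lemma cint_pairing (g : G) : cint (pairing g : X -> C) = (g == 0)%:R.
Proof.
have [->|g0] := eqVneq g 0.
  by rewrite (eq_cint (K := cst 1)) ?cint_cst // => xi; exact: pairing0.
have [eta eta1] := @character_separates R G g g0.
have cinv : cint (fun xi : X => pairing g (dual_mul eta xi)) = cint (pairing g : X -> C).
  have [m1 m2] := @pairing_cmeasurable R G g.
  have [n1 n2] := cmeasurableZ (pairing g eta) (@pairing_cmeasurable R G g).
  rewrite /cint; congr Complex; apply: (@haar_Rintegral _ _ 1) => //.
    by move=> xi; rewrite (le_trans (Re_le_rnorm _)) // pairing_rnorm.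
  by move=> xi; rewrite (le_trans (Im_le_rnorm _)) // pairing_rnorm.
move: cinv; under eq_cint do rewrite pairing_dual_mul.
rewrite cintZ; last exact/L2_cintegrable/pairing_L2.
move/eqP; rewrite -subr_eq0 -{2}[cint _]mul1r -mulrBl mulf_eq0 subr_eq0 (negbTE eta1) /=.
by move/eqP.
Qed.

End DualIntegration.

(** * Fourier series of square-summable sequences *)


Section FourierL2.
Variables (R : realType) (G : zmodType) (mu : probability (borel_dual R G) R).
Hypothesis mu_haar : haar_measure mu.
Local Notation C := R[i].
Local Notation X := (borel_dual R G).
Local Notation L2 := (@L2 R G mu).
Local Notation sqint := (@sqint R G mu).
Local Notation cint := (@cint R G mu).
Implicit Types (F K : X -> C) (x y : G -> C) (J : {fset G}).

(** The squared L^2 norm; it is meaningful on [L2] only, since [fine] sends infinity to 0. *)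
Definition N2 F : R := fine (sqint F).

Definition trig x J : X -> C := fun xi => \sum_(g <- J) x g * (pairing g xi)^*.

Definition fourier_coef F (g : G) : C := cint (fun xi => F xi * pairing g xi).

Definition pip F K : C := cint (fun xi => F xi * (K xi)^*).

Lemma N2E F : L2 F -> sqint F = (N2 F)%:E.
Proof. by move=> F2; rewrite /N2 fineK //; exact: L2_fin. Qed.

Lemma N2_ge0 F : 0 <= N2 F.
Proof. by rewrite fine_ge0 // sqint_ge0. Qed.

Lemma N2D F K : L2 F -> L2 K -> N2 (fun xi => F xi + K xi) <= 2 * N2 F + 2 * N2 K.
Proof.
move=> F2 K2; rewrite -lee_fin -N2E; last exact: L2D.
by rewrite EFinD !EFinM -!N2E // sqintD //; [case: F2|case: K2].
Qed.

Lemma N2B_le F K : L2 F -> L2 K -> N2 (fun xi => F xi - K xi) <= 2 * N2 F + 2 * N2 K.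
Proof.
move=> F2 K2; rewrite -lee_fin -N2E; last exact: L2B.
by rewrite EFinD !EFinM -!N2E // sqintB //; [case: F2|case: K2].
Qed.

Lemma L2_pairing_conj (g : G) : L2 (fun xi => (pairing g xi)^*).
Proof. by apply: L2_conj; exact: pairing_L2. Qed.

Lemma trig_L2 x J : L2 (trig x J).
Proof. by apply: L2_sum => g; apply: L2Z; exact: L2_pairing_conj. Qed.

Lemma cintegrableD F K : cintegrable mu F -> cintegrable mu K ->
  cintegrable mu (fun xi => F xi + K xi).
Proof.
move=> [mF iF] [mK iK]; split; first exact: cmeasurableD.
apply: (@le_lt_trans _ _ (\int[mu]_xi (rnorm (F xi))%:E + \int[mu]_xi (rnorm (K xi))%:E)%E).
  rewrite -ge0_integralD //; first last.
  - by apply/measurable_EFinP; exact: cmeasurable_rnorm.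
  - by move=> xi _; rewrite lee_fin rnorm_ge0.
  - by apply/measurable_EFinP; exact: cmeasurable_rnorm.
  - by move=> xi _; rewrite lee_fin rnorm_ge0.
  apply: ge0_le_integral => //.
  - by move=> xi _; rewrite lee_fin rnorm_ge0.
  - by apply/measurable_EFinP; apply: cmeasurable_rnorm; exact: cmeasurableD.
  - by apply: emeasurable_funD; apply/measurable_EFinP; exact: cmeasurable_rnorm.
  - by move=> xi _; rewrite -EFinD lee_fin rnormD.
by rewrite lte_add_pinfty.
Qed.

Lemma cintegrableZ (z : C) F : cintegrable mu F -> cintegrable mu (fun xi => z * F xi).
Proof.
move=> [mF iF]; split; first exact: cmeasurableZ.
under eq_integral do rewrite rnormM EFinM.
rewrite ge0_integralZl_EFin ?rnorm_ge0 //.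
- by rewrite lte_mul_pinfty // lee_fin rnorm_ge0.
- by move=> xi _; rewrite lee_fin rnorm_ge0.
- by apply/measurable_EFinP; exact: cmeasurable_rnorm.
Qed.

Lemma cint_sum (I : Type) (r : seq I) (F : I -> X -> C) :
  (forall i, cintegrable mu (F i)) ->
  cintegrable mu (fun xi => \sum_(i <- r) F i xi) /\
  cint (fun xi => \sum_(i <- r) F i xi) = \sum_(i <- r) cint (F i).
Proof.
move=> iF; elim: r => [|i r [ir IH]].
  rewrite big_nil (_ : (fun xi => _) = cst 0); last by apply/funext => xi; rewrite big_nil.
  by rewrite cint_cst; split => //; apply: L2_cintegrable; exact: L2_cst.
rewrite big_cons -IH -(cintD (iF i) ir).
have -> : (fun xi => \sum_(j <- i :: r) F j xi) = (fun xi => F i xi + \sum_(i <- r) F i xi).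
  by apply/funext => xi; rewrite big_cons.
by split => //; exact: cintegrableD.
Qed.

Lemma pip_cintegrable F K : L2 F -> L2 K -> cintegrable mu (fun xi => F xi * (K xi)^*).
Proof. by move=> F2 K2; apply: cintegrableM => //; exact: L2_conj. Qed.

Lemma pip_self F : L2 F -> pip F F = (N2 F)%:C%C.
Proof.
move=> F2; apply/eqP; rewrite eq_complex /= /N2 /Rintegral.
apply/andP; split; apply/eqP.
  by congr fine; apply: eq_integral => xi _; rewrite mul_conj_rnorm.
rewrite (eq_integral (cst 0%E)) ?integral_cst ?mul0e //.
by move=> xi _; rewrite mul_conj_rnorm.
Qed.

Lemma pip_conj F K : L2 F -> L2 K -> pip K F = (pip F K)^*.
Proof.
move=> F2 K2; rewrite /pip -cint_conj; last exact: pip_cintegrable.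
by apply: eq_cint => xi; rewrite rmorphM /= conjCK mulrC.
Qed.

Lemma N2B F K : L2 F -> L2 K ->
  N2 (fun xi => F xi - K xi) = N2 F - 2 * complex.Re (pip F K) + N2 K.
Proof.
move=> F2 K2; apply: complexI; rewrite -pip_self; last exact: L2B.
have -> : pip (fun xi => F xi - K xi) (fun xi => F xi - K xi) =
    pip F F + -1 * pip F K + -1 * pip K F + pip K K.
  have iFF := pip_cintegrable F2 F2; have iFK := pip_cintegrable F2 K2.
  have iKF := pip_cintegrable K2 F2; have iKK := pip_cintegrable K2 K2.
  have iZ1 := cintegrableZ (-1) iFK; have iZ2 := cintegrableZ (-1) iKF.
  have i12 := cintegrableD iFF iZ1; have i123 := cintegrableD i12 iZ2.
  rewrite /pip -(cintZ _ iFK) -(cintZ _ iKF) -(cintD iFF iZ1) -(cintD i12 iZ2) -(cintD i123 iKK).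
  by apply: eq_cint => xi; rewrite rmorphB /=; ring.
rewrite !pip_self // (pip_conj F2 K2); case: (pip F K) => a b.
by apply/eqP; rewrite eq_complex /=; apply/andP; split; apply/eqP; ring.
Qed.

Lemma pip_trig F x J : L2 F -> pip F (trig x J) = \sum_(g <- J) (x g)^* * fourier_coef F g.
Proof.
move=> F2; have i1 g : cintegrable mu (fun xi => F xi * pairing g xi).
  by apply: cintegrableM => //; exact: pairing_L2.
have i2 g : cintegrable mu (fun xi => (x g)^* * (F xi * pairing g xi)).
  rewrite (_ : (fun xi => _) = (fun xi => ((x g)^* * F xi) * pairing g xi)).
    by apply: cintegrableM; [exact: L2Z|exact: pairing_L2].
  by apply/funext => xi; rewrite mulrA.
have [_ e] := @cint_sum _ J _ i2.
rewrite /pip /fourier_coef; under [RHS]eq_bigr do rewrite -cintZ //.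
rewrite -e; apply: eq_cint => xi; rewrite /trig rmorph_sum mulr_sumr; apply: eq_bigr => g _.
by rewrite rmorphM /= conjCK; ring.
Qed.

Lemma fourier_coef_trig x J g : fourier_coef (trig x J) g = cutoff J x g.
Proof.
have i1 h : cintegrable mu (fun xi => x h * ((pairing h xi)^* * pairing g xi)).
  rewrite (_ : (fun xi => _) = (fun xi => (x h * (pairing h xi)^*) * pairing g xi)).
    by apply: cintegrableM; [apply: L2Z; exact: L2_pairing_conj|exact: pairing_L2].
  by apply/funext => xi; rewrite mulrA.
have [_ e] := @cint_sum _ J _ i1.
have -> : fourier_coef (trig x J) g = \sum_(h <- J) x h * (g == h)%:R.
  rewrite [LHS](_ : _ = cint (fun xi => \sum_(h <- J) x h * ((pairing h xi)^* * pairing g xi))).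
    rewrite e; apply: eq_bigr => h _.
    rewrite cintZ; last first.
      by apply: cintegrableM; [exact: L2_pairing_conj|exact: pairing_L2].
    congr (_ * _); rewrite -subr_eq0 -(cint_pairing mu_haar); apply: eq_cint => xi.
    by rewrite pairing_conj -pairingD addrC.
  by apply: eq_cint => xi; rewrite /trig mulr_suml; apply: eq_bigr => h _; rewrite mulrA.
rewrite /cutoff; case: ifPn => gJ.
  rewrite (big_fsetD1 g) //= eqxx mulr1 big1_fset ?addr0 // => j.
  by rewrite !inE => /andP[jg _ _]; rewrite eq_sym (negbTE jg) mulr0.
rewrite big1_fset // => j jJ _; rewrite (_ : g == j = false) ?mulr0 //.
by apply: contraNF gJ => /eqP ->.
Qed.

Lemma N2_trig x J : N2 (trig x J) = sqsum x J.
Proof.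
apply: complexI; rewrite -pip_self; last exact: trig_L2.
rewrite pip_trig; last exact: trig_L2.
rewrite /sqsum rmorph_sum /= big_seq [RHS]big_seq; apply: eq_bigr => g gJ.
by rewrite fourier_coef_trig /cutoff gJ -mul_conj_rnorm mulrC.
Qed.

(** Completing the square coefficient by coefficient. Both Bessel's inequality and the optimality of
    the Fourier coefficients among all polynomials with frequencies in [J] are read off. *)
Lemma N2_sub_trig F x J : L2 F ->
  N2 (fun xi => F xi - trig x J xi) =
  N2 F - sqsum (fourier_coef F) J + sqsum (fun g => fourier_coef F g - x g) J.
Proof.
move=> F2; rewrite N2B //; last exact: trig_L2.
rewrite N2_trig pip_trig // -!addrA; congr (_ + _); rewrite cRe_sum /sqsum.
rewrite mulr_sumr -!sumrN -!big_split /=; apply: eq_bigr => g _.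
by rewrite !rnorm_sqr; case: (x g) (fourier_coef F g) => a b [c d] /=; ring.
Qed.

Lemma bessel F J : L2 F -> sqsum (fourier_coef F) J <= N2 F.
Proof.
move=> F2; have := N2_sub_trig (fourier_coef F) J F2.
rewrite [X in _ + X]big1 ?addr0 => [e|g _]; first by rewrite -subr_ge0 -e N2_ge0.
by rewrite subrr rnorm0 expr0n.
Qed.

Lemma fourier_coef_l2 F : L2 F -> l2 (fourier_coef F).
Proof. by move=> F2; apply/l2P; exists (N2 F) => J; exact: bessel. Qed.

Lemma N2_sub_coef F J : L2 F ->
  N2 (fun xi => F xi - trig (fourier_coef F) J xi) = N2 F - sqsum (fourier_coef F) J.
Proof.
move=> F2; rewrite N2_sub_trig // [X in _ + X]big1 ?addr0 // => g _.
by rewrite subrr rnorm0 expr0n.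
Qed.

(** The space W, with approximation measured by the squared norm. *)
Definition fourier_space F : Prop :=
  L2 F /\ forall e : R, 0 < e -> exists x J, N2 (fun xi => F xi - trig x J xi) < e.

Lemma is_fourierP x F : is_fourier mu x F <-> cmeasurable F /\
  forall e : R, 0 < e -> exists J0, forall J, (J0 `<=` J)%fset ->
    (sqint (fun xi => (F xi - trig x J xi)%R) < e%:E)%E.
Proof.
have eF J : (\int[mu]_xi (rnorm (F xi - summability.partial_sum
    (fun g => x g * (pairing g xi)^*) J) ^+ 2)%:E)%E =
    sqint (fun xi => (F xi - trig x J xi)%R).
  by apply: eq_integral => xi _; rewrite partial_sumE.
split=> [[mF Fx]|[mF Fx]]; split => //.
  move=> e e0; have F0 J := sqint_ge0 mu (fun xi => F xi - trig x J xi).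
  move: Fx; under eq_cvg do rewrite eF.
  by move/(integral_cvg0P F0); apply.
under eq_cvg do rewrite eF.
by apply/integral_cvg0P => // J; exact: sqint_ge0.
Qed.

(** Once some polynomial with frequencies in [J0] is close to [F], the Fourier sums over all larger
    sets are at least as close, by optimality. *)
Lemma is_fourier_coef F : fourier_space F -> is_fourier mu (fourier_coef F) F.
Proof.
move=> [F2 Fa]; apply/is_fourierP; split; first by case: F2.
move=> e /Fa [x [J0 xJ0]]; exists J0 => J JJ.
rewrite N2E; last by apply: L2B => //; exact: trig_L2.
rewrite lte_fin N2_sub_coef // (le_lt_trans _ xJ0) // N2_sub_trig //.
by rewrite -[leLHS]addr0 lerD ?sqsum_ge0 // lerD2l lerN2 sqsum_mono.
Qed.

Lemma is_fourier_space x F : is_fourier mu x F -> fourier_space F /\ x = fourier_coef F.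
Proof.
move=> /is_fourierP [mF Fx].
have F2 : L2 F.
  have [J /(_ J (fsubset_refl _)) FJ] := Fx 1 ltr01.
  have tm : cmeasurable (trig x J) by case: (trig_L2 x J).
  have D2 : L2 (fun xi => F xi - trig x J xi).
    by split; [exact: cmeasurableB|exact: lt_trans FJ (ltry _)].
  have := L2D D2 (trig_L2 x J); rewrite (_ : (fun xi => _) = F) //.
  by apply/funext => xi; rewrite subrK.
have Fx' (e : R) : 0 < e -> exists J0, forall J, (J0 `<=` J)%fset ->
    N2 (fun xi => F xi - trig x J xi) < e.
  move=> /Fx [J0 J0P]; exists J0 => J /J0P; rewrite N2E ?lte_fin //.
  by apply: L2B => //; exact: trig_L2.
split.
  split => // e /Fx' [J0 /(_ J0 (fsubset_refl _)) J0P]; exists x, J0; exact: J0P.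
apply/funext => g; apply/eqP; rewrite eq_sym -subr_eq0 -rnorm_eq0 -sqrf_eq0 eq_le sqr_ge0 andbT.
apply/ler_addgt0Pr => e /Fx' [J0 J0P]; rewrite add0r.
(* With [g] adjoined, the coefficient error at [g] is one term of the squared distance, whose other
   contributions are nonnegative by Bessel's inequality. *)
have := J0P (J0 `|` [fset g])%fset (fsubsetUl _ _); rewrite N2_sub_trig // => h.
have hb := bessel (J0 `|` [fset g])%fset F2.
have hg : rnorm (fourier_coef F g - x g) ^+ 2 <= sqsum (fun g => fourier_coef F g - x g) (J0 `|` [fset g])%fset.
  have := sqsum_mono (fun g => fourier_coef F g - x g) (fsubsetUr J0 [fset g]%fset).
  by rewrite {1}/sqsum big_seq_fset1.
apply: ltW; apply: (le_lt_trans hg); apply: le_lt_trans h.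
by rewrite lerDr subr_ge0.
Qed.

Lemma parseval F : fourier_space F -> l2n (fourier_coef F) = N2 F.
Proof.
move=> WF; have [F2 _] := WF; have c2 := fourier_coef_l2 F2; apply/eqP; rewrite eq_le; apply/andP; split.
  rewrite -lee_fin -l2nE //; apply/l2norm2_leP => J; exact: bessel.
apply/ler_addgt0Pr => e e0; have [x [J xJ]] := WF.2 e e0.
rewrite -lerBlDr (le_trans _ (sqsum_le J c2)) // lerBlDr -lerBlDl (le_trans _ (ltW xJ)) //.
by rewrite N2_sub_trig // lerDl sqsum_ge0.
Qed.

End FourierL2.

(** * The algebra of bounded transforms and the convolution theorem *)

Section FourierAlgebra.
Variables (R : realType) (G : zmodType) (mu : probability (borel_dual R G) R).
Hypothesis mu_haar : haar_measure mu.
Local Notation C := R[i].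
Local Notation X := (borel_dual R G).
Local Notation L2 := (@L2 R G mu).
Local Notation N2 := (@N2 R G mu).
Local Notation fourier_coef := (@fourier_coef R G mu).
Local Notation fourier_space := (@fourier_space R G mu).
Implicit Types (F K : X -> C) (x y : G -> C) (J : {fset G}).

Lemma fourier_space_lim F : L2 F ->
  (forall e : R, 0 < e -> exists K, fourier_space K /\ N2 (fun xi => F xi - K xi) < e) ->
  fourier_space F.
Proof.
move=> F2 FK; split => // e e0.
(* [N2] is a squared norm: adding two errors doubles each of them. *)
have e4 : 0 < e / 4 by rewrite divr_gt0.
have [K [[K2 Ka] FKe]] := FK _ e4; have [x [J KJ]] := Ka _ e4; exists x, J.
have -> : (fun xi => F xi - trig x J xi) = (fun xi => (F xi - K xi) + (K xi - trig x J xi)).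
  by apply/funext => xi; rewrite addrA subrK.
have t2 := trig_L2 mu x J.
apply: (le_lt_trans (N2D (L2B F2 K2) (L2B K2 t2))); lra.
Qed.

Lemma fourier_space_trig x J : fourier_space (trig x J).
Proof.
split; first exact: trig_L2.
move=> e e0; exists x, J; rewrite (_ : N2 _ = 0) //.
by rewrite /N2 (_ : sqint _ _ = 0%E) // /sqint integral0_eq // => xi _; rewrite subrr rnorm0 expr0n.
Qed.

Lemma fourier_spaceD F K : fourier_space F -> fourier_space K ->
  fourier_space (fun xi => F xi + K xi).
Proof.
move=> [F2 Fa] [K2 Ka]; split; first exact: L2D.
move=> e e0; have e4 : 0 < e / 4 by rewrite divr_gt0.
have [x [I FI]] := Fa _ e4; have [y [J KJ]] := Ka _ e4.
pose z := fun g => cutoff I x g + cutoff J y g.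
exists z, (I `|` J)%fset.
have -> : (fun xi => F xi + K xi - trig z (I `|` J)%fset xi) =
          (fun xi => (F xi - trig x I xi) + (K xi - trig y J xi)).
  apply/funext => xi; rewrite addrACA -opprD; congr (_ - _); rewrite /trig.
  rewrite -(sum_fset_mkcond _ (fsubsetUl I J)) -(sum_fset_mkcond _ (fsubsetUr I J)) -big_split /=.
  apply: eq_bigr => g _; rewrite /z /cutoff mulrDl.
  by case: (g \in I); case: (g \in J); rewrite ?mul0r.
have tI := trig_L2 mu x I; have tJ := trig_L2 mu y J.
apply: (le_lt_trans (N2D (L2B F2 tI) (L2B K2 tJ))); lra.
Qed.

Lemma fourier_spaceZ (z : C) F : fourier_space F -> fourier_space (fun xi => z * F xi).
Proof.
move=> [F2 Fa]; split; first exact: L2Z.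
move=> e e0; have b0 : 0 < rnorm z ^+ 2 + 1 by rewrite ltr_wpDl ?sqr_ge0.
have [x [J FJ]] := Fa _ (divr_gt0 e0 b0); exists (fun g => z * x g), J.
have -> : (fun xi => z * F xi - trig (fun g => z * x g) J xi) = (fun xi => z * (F xi - trig x J xi)).
  apply/funext => xi; rewrite mulrBr /trig mulr_sumr; congr (_ - _).
  by apply: eq_bigr => g _; rewrite mulrA.
have D2 := L2B F2 (trig_L2 mu x J).
rewrite -lte_fin -N2E; last exact: L2Z.
rewrite sqintZ; last by case: D2.
rewrite N2E // -EFinM lte_fin.
rewrite ltr_pdivlMr // in FJ; apply: le_lt_trans FJ.
by rewrite mulrC ler_wpM2l ?N2_ge0 // lerDl.
Qed.

Lemma fourier_spaceB F K : fourier_space F -> fourier_space K ->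
  fourier_space (fun xi => F xi - K xi).
Proof.
move=> WF WK; have -> : (fun xi => F xi - K xi) = (fun xi => F xi + -1 * K xi).
  by apply/funext => xi; rewrite mulN1r.
exact: fourier_spaceD WF (fourier_spaceZ _ WK).
Qed.

Lemma fourier_space_pairing_conj (g : G) : fourier_space (fun xi => (pairing g xi)^*).
Proof.
have -> : (fun xi : X => (pairing g xi)^*) = trig (fun=> 1) [fset g]%fset.
  by apply/funext => xi; rewrite /trig big_seq_fset1 mul1r.
exact: fourier_space_trig.
Qed.

Lemma fourier_space_pairing (g : G) : fourier_space (pairing g).
Proof.
have -> : (pairing g : X -> C) = (fun xi => (pairing (- g) xi)^*).
  by apply/funext => xi; rewrite pairing_conj opprK.
exact: fourier_space_pairing_conj.
Qed.

Lemma fourier_space_cst (z : C) : fourier_space (cst z).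
Proof.
have -> : (cst z : X -> C) = (fun xi => z * pairing 0 xi) by apply/funext => xi; rewrite pairing0 mulr1.
by apply: fourier_spaceZ; exact: fourier_space_pairing.
Qed.

Lemma fourier_space_sum (I : Type) (r : seq I) (F : I -> X -> C) :
  (forall i, fourier_space (F i)) -> fourier_space (fun xi => \sum_(i <- r) F i xi).
Proof.
move=> WF; elim: r => [|i r IH].
  have -> : (fun xi => \sum_(i <- [::]) F i xi) = (cst 0 : X -> C) by apply/funext => xi; rewrite big_nil.
  exact: fourier_space_cst.
have -> : (fun xi => \sum_(j <- i :: r) F j xi) = (fun xi => F i xi + \sum_(j <- r) F j xi).
  by apply/funext => xi; rewrite big_cons.
exact: fourier_spaceD.
Qed.

(** A Lipschitz map that sends trigonometric polynomials into the closed space W preserves W.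
    Linearity is not asked for, so that conjugation is covered too. *)
Lemma fourier_space_map (Phi : (X -> C) -> (X -> C)) (c : R) :
  (forall F, L2 F -> L2 (Phi F)) ->
  (forall F K, L2 F -> L2 K ->
     N2 (fun xi => Phi F xi - Phi K xi) <= c * N2 (fun xi => F xi - K xi)) ->
  (forall x J, fourier_space (Phi (trig x J))) ->
  forall F, fourier_space F -> fourier_space (Phi F).
Proof.
move=> PL Pc Pt F [F2 Fa]; apply: fourier_space_lim; first exact: PL.
move=> e e0; have c1 : 0 < `|c| + 1 by rewrite ltr_wpDl.
have [x [J FJ]] := Fa _ (divr_gt0 e0 c1); exists (Phi (trig x J)); split; first exact: Pt.
apply: (le_lt_trans (Pc _ _ F2 (trig_L2 mu x J))).
rewrite ltr_pdivlMr // in FJ; apply: le_lt_trans FJ; rewrite mulrC ler_wpM2l ?N2_ge0 //.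
by rewrite (le_trans (ler_norm c)) // lerDl.
Qed.

Lemma fourier_space_conj F : fourier_space F -> fourier_space (fun xi => (F xi)^*).
Proof.
apply: (@fourier_space_map (fun F xi => (F xi)^*) 1).
- exact: L2_conj.
- move=> {}F K F2 K2; rewrite mul1r le_eqVlt; apply/orP; left; apply/eqP.
  by congr fine; apply: eq_integral => xi _; rewrite -rmorphB /= rnorm_conj.
move=> x J; have -> : (fun xi => (trig x J xi)^*) = (fun xi : X => \sum_(g <- J) (x g)^* * pairing g xi).
  apply/funext => xi; rewrite /trig rmorph_sum; apply: eq_bigr => g _.
  by rewrite rmorphM /= conjCK.
by apply: fourier_space_sum => g; apply: fourier_spaceZ; exact: fourier_space_pairing.
Qed.

Lemma bounded_mul_N2 F K (c : R) : 0 <= c -> cmeasurable F -> L2 K ->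
  (\forall xi \ae mu, rnorm (F xi) <= c) ->
  N2 (fun xi => F xi * K xi) <= c ^+ 2 * N2 K.
Proof.
move=> c0 mF K2 Fc; rewrite -lee_fin -N2E; last exact: L2_bounded_mul mF Fc K2.
by rewrite EFinM -N2E // bounded_mul_sqint //; case: K2.
Qed.

Lemma ae_bound_pos F (c : R) : (\forall xi \ae mu, rnorm (F xi) <= c) ->
  exists2 c' : R, 0 < c' & \forall xi \ae mu, rnorm (F xi) <= c'.
Proof.
move=> Fc; exists (`|c| + 1); first by rewrite ltr_wpDl.
move: Fc; apply: filterS => xi Fc; rewrite (le_trans Fc) // (le_trans (ler_norm c)) //.
by rewrite lerDl.
Qed.

Lemma fourier_space_bounded_map F (c : R) : cmeasurable F ->
  (\forall xi \ae mu, rnorm (F xi) <= c) ->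
  (forall g, fourier_space (fun xi => F xi * (pairing g xi)^*)) ->
  forall K, fourier_space K -> fourier_space (fun xi => F xi * K xi).
Proof.
move=> mF /ae_bound_pos [b b0 Fb] Fg; apply: (@fourier_space_map (fun K xi => F xi * K xi) (b ^+ 2)).
- by move=> K K2; exact: L2_bounded_mul mF Fb K2.
- move=> K K' K2 K'2; under [X in N2 X]funext do rewrite -mulrBr.
  by apply: bounded_mul_N2 => //; [exact: ltW|exact: L2B].
move=> x J; have -> : (fun xi => F xi * trig x J xi) =
    (fun xi => \sum_(g <- J) x g * (F xi * (pairing g xi)^*)).
  by apply/funext => xi; rewrite /trig mulr_sumr; apply: eq_bigr => g _; rewrite mulrCA.
by apply: fourier_space_sum => g; apply: fourier_spaceZ.
Qed.

(** Density is used twice: multiplication by a character, which is bounded, maps W into W; hence [F]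
    times a character is in W, and then multiplication by the bounded [F] maps W into W. *)
Lemma fourier_spaceM F K (c : R) : fourier_space F ->
  (\forall xi \ae mu, rnorm (F xi) <= c) ->
  fourier_space K -> fourier_space (fun xi => F xi * K xi).
Proof.
move=> WF Fc; have mF := WF.1.1.
apply: (fourier_space_bounded_map mF Fc) => g.
have -> : (fun xi => F xi * (pairing g xi)^*) = (fun xi => (pairing g xi)^* * F xi).
  by apply/funext => xi; rewrite mulrC.
have mg : cmeasurable (fun xi : X => (pairing g xi)^*) := (L2_pairing_conj mu g).1.
have gb : \forall xi \ae mu, rnorm ((pairing g xi)^* : C) <= 1.
  by apply: aeW => xi; rewrite rnorm_conj pairing_rnorm.
apply: (fourier_space_bounded_map mg gb) => // h.
have -> : (fun xi : X => (pairing g xi)^* * (pairing h xi)^*) = (fun xi => (pairing (g + h) xi)^*).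
  by apply/funext => xi; rewrite pairingD rmorphM.
exact: fourier_space_pairing_conj.
Qed.

(** The *-algebra of essentially bounded elements of W. *)
Definition fourier_bounded F : Prop :=
  fourier_space F /\ exists c : R, \forall xi \ae mu, rnorm (F xi) <= c.

Lemma LinftyP F : Linfty mu F <-> cmeasurable F /\ exists c : R, \forall xi \ae mu, rnorm (F xi) <= c.
Proof.
split=> [[mF Fs]|[mF [c Fc]]]; split => //.
  have [c Fc] : exists c : R, (ess_sup mu (fun xi => (rnorm (F xi))%:E) <= c%:E)%E.
    case: (ess_sup mu _) Fs => [r _| //|_]; first by exists r.
    by exists 0; rewrite leNye.
  by exists c; move/ess_supP: Fc; apply: filterS => xi; rewrite lee_fin.
apply: (@le_lt_trans _ _ c%:E); last exact: ltry.
by apply/ess_supP; move: Fc; apply: filterS => xi; rewrite lee_fin.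
Qed.

Lemma fourier_bounded_cst (z : C) : fourier_bounded (cst z).
Proof. by split; [exact: fourier_space_cst|exists (rnorm z); exact: aeW]. Qed.

Lemma fourier_boundedD F K : fourier_bounded F -> fourier_bounded K ->
  fourier_bounded (fun xi => F xi + K xi).
Proof.
move=> [WF [c Fc]] [WK [d Kd]]; split; first exact: fourier_spaceD.
exists (c + d); move: Fc Kd; apply: filterS2 => xi Fc Kd.
by rewrite (le_trans (rnormD _ _)) // lerD.
Qed.

Lemma fourier_boundedM F K : fourier_bounded F -> fourier_bounded K ->
  fourier_bounded (fun xi => F xi * K xi).
Proof.
move=> [WF [c Fc]] [WK [d Kd]]; split; first exact: fourier_spaceM Fc WK.
exists (c * d); move: Fc Kd; apply: filterS2 => xi Fc Kd.
by rewrite rnormM ler_pM ?rnorm_ge0.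
Qed.

Lemma fourier_bounded_conj F : fourier_bounded F -> fourier_bounded (fun xi => (F xi)^*).
Proof.
move=> [WF [c Fc]]; split; first exact: fourier_space_conj.
by exists c; move: Fc; apply: filterS => xi Fc; rewrite rnorm_conj.
Qed.

Lemma fourier_bounded_sum (I : Type) (r : seq I) (F : I -> X -> C) :
  (forall i, fourier_bounded (F i)) -> fourier_bounded (fun xi => \sum_(i <- r) F i xi).
Proof.
move=> WF; elim: r => [|i r IH].
  have -> : (fun xi => \sum_(i <- [::]) F i xi) = (cst 0 : X -> C) by apply/funext => xi; rewrite big_nil.
  exact: fourier_bounded_cst.
have -> : (fun xi => \sum_(j <- i :: r) F j xi) = (fun xi => F i xi + \sum_(j <- r) F j xi).
  by apply/funext => xi; rewrite big_cons.
exact: fourier_boundedD.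
Qed.

Lemma fourier_bounded_prod (I : Type) (r : seq I) (F : I -> X -> C) :
  (forall i, fourier_bounded (F i)) -> fourier_bounded (fun xi => \prod_(i <- r) F i xi).
Proof.
move=> WF; elim: r => [|i r IH].
  have -> : (fun xi => \prod_(i <- [::]) F i xi) = (cst 1 : X -> C) by apply/funext => xi; rewrite big_nil.
  exact: fourier_bounded_cst.
have -> : (fun xi => \prod_(j <- i :: r) F j xi) = (fun xi => F i xi * \prod_(j <- r) F j xi).
  by apply/funext => xi; rewrite big_cons.
exact: fourier_boundedM.
Qed.

Lemma fourier_boundedX F n : fourier_bounded F -> fourier_bounded (fun xi => F xi ^+ n).
Proof.
move=> WF; elim: n => [|n IH].
  have -> : (fun xi => F xi ^+ 0) = (cst 1 : X -> C) by apply/funext.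
  exact: fourier_bounded_cst.
have -> : (fun xi => F xi ^+ n.+1) = (fun xi => F xi * F xi ^+ n).
  by apply/funext => xi; rewrite exprS.
exact: fourier_boundedM.
Qed.

Lemma fourier_bounded_det n (F : X -> 'M[C]_n) :
  (forall i j, fourier_bounded (fun xi => F xi i j)) -> fourier_bounded (fun xi => \det (F xi)).
Proof.
move=> WF; apply: fourier_bounded_sum => s; apply: fourier_boundedM.
  exact: fourier_bounded_cst.
exact: fourier_bounded_prod.
Qed.

Lemma fourier_coef_bound F g : L2 F -> rnorm (fourier_coef F g) ^+ 2 <= N2 F.
Proof.
by move=> F2; have := bessel mu_haar [fset g]%fset F2; rewrite /sqsum big_seq_fset1.
Qed.

Lemma fourier_coefB F K g : L2 F -> L2 K -> fourier_coef (fun xi => F xi - K xi) g = fourier_coef F g - fourier_coef K g.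
Proof.
move=> F2 K2; have p2 := pairing_L2 mu g.
have iF := cintegrableM F2 p2; have iK := cintegrableM K2 p2.
rewrite /fourier_coef -mulN1r -(cintZ _ iK) -(cintD iF (cintegrableZ _ iK)).
by apply: eq_cint => xi; rewrite mulN1r mulrBl.
Qed.

Lemma fourier_coef_sum (I : Type) (r : seq I) (F : I -> X -> C) g :
  (forall i, L2 (F i)) -> fourier_coef (fun xi => \sum_(i <- r) F i xi) g = \sum_(i <- r) fourier_coef (F i) g.
Proof.
move=> F2; have i1 i := cintegrableM (F2 i) (pairing_L2 mu g).
rewrite /fourier_coef -(cint_sum r i1).2.
by apply: eq_cint => xi; rewrite mulr_suml.
Qed.

Lemma ae_eq_coef F K g : cmeasurable F -> cmeasurable K ->
  (\forall xi \ae mu, F xi = K xi) -> fourier_coef F g = fourier_coef K g.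
Proof.
move=> [F1 F2] [K1 K2] FK; have [p1 p2] := @pairing_cmeasurable R G g.
have [m1 m2] := cmeasurableM (conj F1 F2) (conj p1 p2).
have [n1 n2] := cmeasurableM (conj K1 K2) (conj p1 p2).
rewrite /fourier_coef /cint; congr Complex; rewrite /Rintegral; congr fine.
  apply: ae_eq_integral => //; try exact/measurable_EFinP.
  by move: FK; apply: filterS => xi -> _.
apply: ae_eq_integral => //; try exact/measurable_EFinP.
by move: FK; apply: filterS => xi -> _.
Qed.

Lemma N2_eq0 F : L2 F -> N2 F = 0 -> \forall xi \ae mu, F xi = 0.
Proof.
move=> F2 N0; have mF := cmeasurable_sqr F2.1.
have /(ae_eq_integral_abs mu measurableT mF) :
    (\int[mu]_xi `|(rnorm (F xi) ^+ 2)%:E|)%E = 0%E.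
  transitivity (sqint mu F); last by rewrite N2E // N0.
  by apply: eq_integral => xi _; rewrite /= ger0_norm // sqr_ge0.
apply: filterS => xi /(_ I) [] /eqP; rewrite sqrf_eq0 rnorm_eq0.
by move/eqP.
Qed.

Lemma fourier_space_inj F K : fourier_space F -> fourier_space K -> fourier_coef F =1 fourier_coef K ->
  \forall xi \ae mu, F xi = K xi.
Proof.
move=> WF WK FK; have WD := fourier_spaceB WF WK.
have : \forall xi \ae mu, F xi - K xi = 0.
  apply: N2_eq0; first by case: WD.
  rewrite -(parseval mu_haar WD); have -> : fourier_coef (fun xi => F xi - K xi) = fun=> 0.
    by apply/funext => g; rewrite fourier_coefB ?FK ?subrr //; [case: WF|case: WK].
  have c0 : @l2 R G (fun=> 0) := @l2_cst0 R G.
  apply/eqP; rewrite eq_le l2n_ge0 andbT -lee_fin -l2nE //; apply/l2norm2_leP => J.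
  by rewrite /sqsum big1 // => g _; rewrite rnorm0 expr0n.
by apply: filterS => xi /eqP; rewrite subr_eq0 => /eqP.
Qed.

Lemma fourier_coef_mul_trig F x J g : L2 F ->
  fourier_coef (fun xi => F xi * trig x J xi) g = \sum_(h <- J) fourier_coef F (g - h) * x h.
Proof.
move=> F2; have i0 h := cintegrableM F2 (pairing_L2 mu (g - h)).
have i1 h : cintegrable mu (fun xi => x h * (F xi * pairing (g - h) xi)) := cintegrableZ _ (i0 h).
transitivity (cint mu (fun xi => \sum_(h <- J) x h * (F xi * pairing (g - h) xi))).
  apply: eq_cint => xi; rewrite /trig mulr_sumr mulr_suml; apply: eq_bigr => h _.
  by rewrite pairingD -pairing_conj; ring.
by rewrite (cint_sum J i1).2; apply: eq_bigr => h _; rewrite (cintZ _ (i0 h)) mulrC.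
Qed.

Lemma fourier_space_mul_trig F x J : fourier_space F ->
  fourier_space (fun xi => F xi * trig x J xi).
Proof.
move=> WF.
have -> : (fun xi => F xi * trig x J xi) = (fun xi => \sum_(g <- J) x g * ((pairing g xi)^* * F xi)).
  apply/funext => xi; rewrite /trig mulr_sumr; apply: eq_bigr => g _.
  by rewrite mulrC mulrA.
apply: fourier_space_sum => g; apply: fourier_spaceZ.
apply: (@fourier_spaceM _ _ 1) => //; first exact: fourier_space_pairing_conj.
by apply: aeW => xi; rewrite rnorm_conj pairing_rnorm.
Qed.

(** The partial sums of the convolution at [g] are the coefficients at [g] of [F] times Fourier sums
    of [K]. These products tend to [F * K] in L^2 because [F] is bounded, and a coefficient is
    L^2-continuous by Bessel's inequality. *)
Lemma convolution_fourier (a x : G -> C) F K (c : R) :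
  is_fourier mu a F -> (\forall xi \ae mu, rnorm (F xi) <= c) -> is_fourier mu x K ->
  (forall g, has_sum (fun h => a (g - h) * x h : C^o) (fourier_coef (fun xi => F xi * K xi) g)) /\
  is_fourier mu (convolution a x) (fun xi => F xi * K xi).
Proof.
move=> /(is_fourier_space mu_haar) [WF ->] Fc0 /(is_fourier_space mu_haar) [WK ->].
have [b b0 Fb] := ae_bound_pos Fc0; have WFK := fourier_spaceM WF Fb WK.
have mF := WF.1.1.
have hs g : has_sum (fun h => fourier_coef F (g - h) * fourier_coef K h : C^o) (fourier_coef (fun xi => F xi * K xi) g).
  apply/has_sumP => e e0.
  have /is_fourierP [_ Kx] := is_fourier_coef mu_haar WK.
  have [J0 J0P] := Kx (e ^+ 2 / b ^+ 2) (divr_gt0 (exprn_gt0 2 e0) (exprn_gt0 2 b0)).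
  exists J0 => J /J0P; set D := fun xi => K xi - _ => Dlt.
  have D2 : L2 D by apply: L2B; [case: WK|exact: trig_L2].
  have FD2 : L2 (fun xi => F xi * D xi) := L2_bounded_mul mF Fb D2.
  have Ft2 : L2 (fun xi => F xi * trig (fourier_coef K) J xi) := L2_bounded_mul mF Fb (trig_L2 mu _ _).
  rewrite -fourier_coef_mul_trig; last by case: WF.
  rewrite -fourier_coefB //; last by case: WFK.
  have -> : (fun xi => F xi * K xi - F xi * trig (fourier_coef K) J xi) = (fun xi => F xi * D xi).
    by apply/funext => xi; rewrite -mulrBr.
  rewrite -(@ltr_pXn2r _ 2) ?nnegrE ?rnorm_ge0 ?(ltW e0) //.
  apply: (le_lt_trans (fourier_coef_bound g FD2)).
  apply: (le_lt_trans (bounded_mul_N2 (ltW b0) mF D2 Fb)).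
  by move: Dlt; rewrite N2E // lte_fin ltr_pdivlMr ?exprn_gt0 // mulrC.
split => //; have -> : convolution (fourier_coef F) (fourier_coef K) = fourier_coef (fun xi => F xi * K xi).
  by apply/funext => g; apply: (@has_sum_sum _ _ C^o); exact: hs.
exact: is_fourier_coef.
Qed.

End FourierAlgebra.

(** * The Riesz-Fischer theorem *)

Section RieszFischer.
Variable R : realType.
Local Notation C := R[i].

Lemma cvg_summable_increments (q v : nat -> R) :
  (forall n, 0 <= v n) -> (forall n, `|q n.+1 - q n| <= v n) ->
  (\sum_(0 <= n <oo) (v n)%:E < +oo)%E -> cvgn q.
Proof.
move=> v0 qv vfin.
have vs : cvgn (series v).
  apply: nondecreasing_is_cvgn; first by apply: nondecreasing_series => n _ _; exact: v0.
  exists (fine (\sum_(0 <= n <oo) (v n)%:E)%E) => _ [n _ <-].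
  rewrite -lee_fin fineK; last first.
    by rewrite ge0_fin_numE // nneseries_ge0 // => k _ _; rewrite lee_fin.
  by rewrite /series /= -sumEFin; apply: nneseries_lim_ge => k _; rewrite lee_fin.
have ts : cvgn (series (telescope q)).
  apply: normed_cvg; apply: (@series_le_cvg _ (fun n => `|telescope q n|) v) => //.
have -> : q = series (telescope q) \+ cst (q 0%N).
  by apply/funext => n; rewrite telescopeK /= subrK.
by apply: is_cvgD => //; exact: is_cvg_cst.
Qed.

Variables (G : zmodType) (mu : probability (borel_dual R G) R).
Local Notation X := (borel_dual R G).
Local Notation L2 := (@L2 R G mu).
Local Notation N2 := (@N2 R G mu).
Local Notation sqint := (@sqint R G mu).

(** Upper limits are measurable without any convergence assumption, and agree with the limit
    wherever the sequence converges. *)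
Definition climit (p : nat -> X -> C) : X -> C := fun xi =>
  Complex (fine (limn_esup (fun n => (complex.Re (p n xi))%:E)))
          (fine (limn_esup (fun n => (complex.Im (p n xi))%:E))).

Lemma climit_cmeasurable (p : nat -> X -> C) :
  (forall n, cmeasurable (p n)) -> cmeasurable (climit p).
Proof.
move=> mp; split; apply: measurableT_comp; rewrite //=;
  by apply: measurable_fun_limn_esup => n; apply/measurable_EFinP; case: (mp n).
Qed.

Lemma limn_esup_EFin (q : nat -> R) : cvgn q ->
  q n @[n --> \oo] --> fine (limn_esup (fun n => (q n)%:E)).
Proof.
move=> /cvg_ex [l ql]; have ql' : (q n)%:E @[n --> \oo] --> l%:E.
  by apply: cvg_comp ql _; exact: cvg_id || apply: cvg_EFin.
by rewrite (cvg_limn_einf_sup ql').2.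
Qed.

(** By monotone convergence the sum of the [v n] is integrable, hence finite almost everywhere; at
    such points the increments of [p] are absolutely summable. *)
Lemma ae_cvg_climit (p : nat -> X -> C) (v : nat -> X -> R) :
  (forall n, measurable_fun [set: X] (v n)) -> (forall n xi, 0 <= v n xi) ->
  (forall n xi, rnorm (p n.+1 xi - p n xi) <= v n xi) ->
  (\sum_(0 <= n <oo) \int[mu]_xi (v n xi)%:E < +oo)%E ->
  \forall xi \ae mu,
    (complex.Re (p n xi) @[n --> \oo] --> complex.Re (climit p xi)) /\
    (complex.Im (p n xi) @[n --> \oo] --> complex.Im (climit p xi)).
Proof.
move=> mv v0 pv; rewrite -integral_nneseries //; last 2 first.
- by move=> n; exact/measurable_EFinP.
- by move=> n xi _; rewrite lee_fin.
move=> vfin.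
have : \forall xi \ae mu, setT xi -> (\sum_(0 <= n <oo) (v n xi)%:E)%E \is a fin_num.
  apply: integrable_ae => //; apply/integrableP; split.
    by apply: ge0_emeasurable_sum => [n xi _ _|n _]; rewrite ?lee_fin //; exact/measurable_EFinP.
  under eq_integral.
    move=> xi _; rewrite gee0_abs; last by apply: nneseries_ge0 => n _ _; rewrite lee_fin.
    over.
  exact: vfin.
apply: filterS => xi /(_ I) xfin.
have {}xfin : (\sum_(0 <= n <oo) (v n xi)%:E < +oo)%E.
  by move: xfin; rewrite ge0_fin_numE // nneseries_ge0 // => n _ _; rewrite lee_fin.
split; apply: limn_esup_EFin.
  apply: (cvg_summable_increments (v := fun n => v n xi)) => // n.
  by rewrite -cReN -cReD (le_trans (Re_le_rnorm _)).
apply: (cvg_summable_increments (v := fun n => v n xi)) => // n.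
by rewrite -cImN -cImD (le_trans (Im_le_rnorm _)).
Qed.

Lemma limn_einf_le (u : nat -> \bar R) (c : \bar R) m :
  (forall n, (m <= n)%N -> (u n <= c)%E) -> (limn_einf u <= c)%E.
Proof.
move=> uc; rewrite limn_einf_lim; apply: lime_le; first exact: is_cvg_einfs.
near=> n; apply: (@le_trans _ _ (u n)).
  by apply: ereal_inf_lbound; exists n => /=.
by apply: uc; near: n; exists m.
Unshelve. all: by end_near.
Qed.

(** By Fatou's lemma, a uniform bound on the distances to [K] survives the almost everywhere limit;
    this replaces L^2 convergence of [p]. *)
Lemma fatou_sqint (p : nat -> X -> C) (K : X -> C) (e : \bar R) m :
  (forall n, cmeasurable (p n)) -> cmeasurable K ->
  (\forall xi \ae mu,
    (complex.Re (p n xi) @[n --> \oo] --> complex.Re (climit p xi)) /\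
    (complex.Im (p n xi) @[n --> \oo] --> complex.Im (climit p xi))) ->
  (forall n, (m <= n)%N -> (sqint (fun xi => (p n xi - K xi)%R) <= e)%E) ->
  (sqint (fun xi => (climit p xi - K xi)%R) <= e)%E.
Proof.
move=> mp mK pF pe; have mF := climit_cmeasurable mp.
apply: le_trans (limn_einf_le pe).
have mpK n : measurable_fun setT (fun xi => (rnorm (p n xi - K xi) ^+ 2)%:E).
  by apply: cmeasurable_sqr; exact: cmeasurableB.
apply: le_trans (fatou _ _ mpK _) => //; last by move=> n xi _; rewrite lee_fin sqr_ge0.
apply: ae_ge0_le_integral => //.
- by move=> xi _; rewrite lee_fin sqr_ge0.
- by apply: cmeasurable_sqr; exact: cmeasurableB.
- move=> xi _; rewrite limn_einf_lim; apply: lime_ge; first exact: is_cvg_einfs.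
  by apply: nearW => n; apply: le_ereal_inf_tmp => _ [k _ <-]; rewrite lee_fin sqr_ge0.
- rewrite (_ : (fun x => limn_einf _) = (fun x => - limn_esup (-%E \o (fun n => (rnorm (p n x - K x) ^+ 2)%:E)))%E).
    apply: measurableT_comp => //; apply: measurable_fun_limn_esup => n.
    exact: measurableT_comp.
  by apply/funext => xi; rewrite limn_esupN oppeK.
move: pF; apply: filterS => xi [pR pI] _.
have : (rnorm (p n xi - K xi) ^+ 2)%:E @[n --> \oo] --> (rnorm (climit p xi - K xi) ^+ 2)%:E.
  apply: cvg_EFin; first exact: nearW.
  rewrite rnorm_sqr; under eq_cvg do rewrite /= rnorm_sqr.
  apply: cvgD; rewrite !expr2; apply: cvgM; rewrite !(cReD, cReN, cImD, cImN);
    (under eq_cvg do rewrite !(cReD, cReN, cImD, cImN)); by apply: cvgB => //; exact: cvg_cst.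
by move/cvg_limn_einf_sup => [-> _].
Qed.

Hypothesis mu_haar : haar_measure mu.

Lemma N2_trig_sub (x : G -> C) (A B : {fset G}) : (B `<=` A)%fset ->
  N2 (fun xi => trig x A xi - trig x B xi) = sqsum x A - sqsum x B.
Proof.
move=> BA; rewrite N2_sub_trig //; last exact: trig_L2.
rewrite N2_trig // (_ : fourier_coef mu (trig x A) = cutoff A x); last first.
  by apply/funext => g; exact: fourier_coef_trig.
have xB g : g \in B -> cutoff A x g = x g by move=> gB; rewrite /cutoff (fsubsetP BA).
rewrite /sqsum [X in _ + X]big1_fset ?addr0 => [|g gB _].
  congr (_ - _); rewrite big_seq [RHS]big_seq; apply: eq_bigr => g gB.
  by rewrite xB.
by rewrite xB // subrr rnorm0 expr0n.
Qed.

(* The partial sums p_n are chosen with |p_(n+1) - p_n|_2 < w_n = 2^-(n+1); since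
   |t| <= w_n + |t|^2 / w_n, their increments are summable almost everywhere. *)
Lemma riesz_fischer (x : G -> C) : l2 x -> exists F, is_fourier mu x F.
Proof.
move=> x2; pose w k : R := 1 / (2 ^ k.+1)%:R.
have w0 k : 0 < w k by rewrite divr_gt0 // ltr0n expn_gt0.
have /choice [J JP] k : exists J0, forall J, (J0 `<=` J)%fset -> l2n x - sqsum x J < w k ^+ 2.
  by apply: l2n_approx => //; rewrite exprn_gt0.
pose K := fix K n := if n is n'.+1 then (K n' `|` J n)%fset else J 0%N.
have JK n : (J n `<=` K n)%fset by case: n => [|n] //=; exact: fsubsetUr.
have KS m n : (m <= n)%N -> (K m `<=` K n)%fset.
  elim: n => [|n IH]; first by rewrite leqn0 => /eqP ->.
  rewrite leq_eqVlt => /orP[/eqP -> //|]; rewrite ltnS => /IH h.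
  exact: fsubset_trans h (fsubsetUl _ _).
have tail m A : (K m `<=` A)%fset -> N2 (fun xi => trig x A xi - trig x (K m) xi) <= w m ^+ 2.
  move=> KA; rewrite N2_trig_sub // ltW // (le_lt_trans _ (JP m (K m) (JK m))) //.
  by rewrite lerD2r sqsum_le.
pose p n : X -> C := trig x (K n).
have p2 n : L2 (p n) := trig_L2 mu x (K n).
have mp n : cmeasurable (p n) := (p2 n).1.
have f2 n : L2 (fun xi => p n.+1 xi - p n xi) by exact: L2B.
pose v n xi := w n + (w n)^-1 * rnorm (p n.+1 xi - p n xi) ^+ 2.
have mf n : measurable_fun setT (fun xi => rnorm (p n.+1 xi - p n xi) ^+ 2).
  by apply/measurable_EFinP; apply: cmeasurable_sqr; case: (f2 n).
have v0 n xi : 0 <= v n xi.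
  by rewrite /v addr_ge0 ?(ltW (w0 n)) // mulr_ge0 ?sqr_ge0 // invr_ge0 ltW.
have pF := @ae_cvg_climit p v.
exists (climit p); apply/is_fourierP; split; first exact: climit_cmeasurable.
(* Each [p n] with [n >= m], and each Fourier sum over a set containing [K m], is within squared
   distance [w m ^+ 2] of [p m]; comparing the two doubles both errors, hence the 4. *)
move=> e e0; have [m we] : exists m, 4 * w m ^+ 2 < e.
  exists (Num.bound (4 / e)); set m := Num.bound _.
  have me : 4 / e < m%:R by apply: archi_boundP; rewrite divr_ge0 // ltW.
  have w1 : w m <= 1 by rewrite /w ler_pdivrMr ?ltr0n ?expn_gt0 // mul1r ler1n expn_gt0.
  apply: (@le_lt_trans _ _ (4 * w m)).
    by rewrite ler_pM2l // expr2 ger_pMl.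
  rewrite /w mulrA mulr1 ltr_pdivrMr ?ltr0n ?expn_gt0 // mulrC -ltr_pdivrMr //.
  by rewrite (lt_le_trans me) // ler_nat (leq_trans (leqnSn m)) // ltnW // ltn_expl.
exists (K m) => A KA; apply: (@le_lt_trans _ _ (4 * w m ^+ 2)%:E); last by rewrite lte_fin.
apply: (@fatou_sqint p (trig x A) _ m) => //; first by case: (trig_L2 mu x A).
  apply: pF.
  - by move=> n; apply: measurable_funD => //; apply: measurable_funM.
  - exact: v0.
  - move=> n xi; rewrite /v; set r := rnorm _; rewrite -subr_ge0.
    have -> : w n + (w n)^-1 * r ^+ 2 - r = (w n)^-1 * ((w n - r / 2) ^+ 2 + 3 / 4 * r ^+ 2).
      by field; rewrite gt_eqF.
    apply: mulr_ge0; first by rewrite invr_ge0 ltW.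
    by rewrite addr_ge0 ?sqr_ge0 // mulr_ge0 ?sqr_ge0 // divr_ge0.
  (* The integral of [v n] is at most [w n + w n ^+ 2 / w n = 2 * w n], and the [w n] sum to 1. *)
  apply: (@le_lt_trans _ _ 2%:E); last exact: ltry.
  apply: le_trans (epsilon_trick0 xpredT (ler0n R 2)).
  apply: lee_nneseries => [n _ _|n _].
    by apply: integral_ge0 => xi _; rewrite lee_fin v0.
  rewrite (eq_integral (fun xi => ((w n)%:E + ((w n)^-1)%:E * (rnorm (p n.+1 xi - p n xi) ^+ 2)%:E)%E)) //.
  rewrite ge0_integralD //; first last.
  - by apply: measurable_funeM; exact/measurable_EFinP.
  - by move=> xi _; rewrite -EFinM lee_fin mulr_ge0 ?invr_ge0 ?sqr_ge0 // ltW.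
  - by move=> xi _; rewrite lee_fin ltW.
  rewrite ge0_integralZl_EFin //; first last.
  - by rewrite invr_ge0 ltW.
  - exact/measurable_EFinP.
  - by move=> xi _; rewrite lee_fin sqr_ge0.
  rewrite [X in (X + _)%E](_ : _ = (w n)%:E); last first.
    by rewrite (eq_integral (cst (w n)%:E)) // integral_cst //= probability_setT mule1.
  rewrite -/(sqint (fun xi => (p n.+1 xi - p n xi)%R)) N2E // -EFinM -EFinD lee_fin.
  have h := tail n (K n.+1) (KS n n.+1 (leqnSn n)).
  rewrite [leRHS](_ : _ = w n + w n); last by rewrite /w; ring.
  rewrite lerD2l mulrC ler_pdivrMr // -expr2; exact: h.
move=> n mn; have tA2 := trig_L2 mu x A.
rewrite N2E; last exact: L2B.
rewrite lee_fin.
have -> : (fun xi => p n xi - trig x A xi) = (fun xi => (p n xi - p m xi) - (trig x A xi - p m xi)).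
  by apply/funext => xi; rewrite opprB addrA subrK.
have h1 := tail m (K n) (KS m n mn); have h2 := tail m A KA.
apply: (le_trans (N2B_le (L2B (p2 n) (p2 m)) (L2B tA2 (p2 m)))).
by rewrite /p; lra.
Qed.

End RieszFischer.

(** * Inverses and multipliers *)


Section SpectralArguments.
Variables (R : realType) (G : zmodType) (mu : probability (borel_dual R G) R).
Hypothesis mu_haar : haar_measure mu.
Local Notation C := R[i].
Local Notation X := (borel_dual R G).
Local Notation L2 := (@L2 R G mu).
Local Notation N2 := (@N2 R G mu).
Local Notation sqint := (@sqint R G mu).
Local Notation fourier_coef := (@fourier_coef R G mu).
Local Notation fourier_space := (@fourier_space R G mu).
Local Notation fourier_bounded := (@fourier_bounded R G mu).
Implicit Types (F K : X -> C).

Lemma ae_const_N2 F (c : R) : cmeasurable F -> 0 <= c -> (\forall xi \ae mu, rnorm (F xi) <= c) ->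
  L2 F /\ N2 F <= c ^+ 2.
Proof.
move=> mF c0 Fc; have e1 : F = (fun xi => F xi * cst 1 xi).
  by apply/funext => xi; rewrite mulr1.
have F2 := L2_bounded_mul mF Fc (L2_cst mu 1); rewrite -e1 in F2; split => //.
have := bounded_mul_N2 c0 mF (L2_cst mu 1) Fc; rewrite -e1.
by rewrite [X in _ * X](_ : _ = 1) ?mulr1 // /N2 sqint_cst rnorm1 expr1n.
Qed.

Lemma expr_small (q e : R) : 0 <= q -> q < 1 -> 0 < e -> exists n, q ^+ n < e.
Proof.
move=> q0 q1 e0; have : `|q| < 1 by rewrite ger0_norm.
move/cvg_expr/cvgrPdist_lt => /(_ e e0) [n _ /(_ n (leqnn n))] /=.
by rewrite sub0r normrN ger0_norm ?exprn_ge0 // => h; exists n.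
Qed.

(* Neumann series: 1/d = (1/b) sum_k (1 - d/b)^k, uniformly since delta <= d <= b. *)
Lemma fourier_bounded_inv F (delta : R) : 0 < delta -> fourier_bounded F ->
  (\forall xi \ae mu, complex.Im (F xi) = 0 /\ delta <= complex.Re (F xi)) ->
  exists2 D, fourier_bounded D & \forall xi \ae mu, D xi * F xi = 1.
Proof.
move=> d0 EF Fd; have [WF [b' /ae_bound_pos [b'' b''0 Fb'']]] := EF.
(* Adding [delta] ensures [delta <= b], so that the ratio [q] below satisfies [0 <= q < 1]. *)
pose b := b'' + delta; have b0 : 0 < b by rewrite addr_gt0.
have Fb : \forall xi \ae mu, complex.Im (F xi) = 0 /\ delta <= complex.Re (F xi) <= b.
  move: Fd Fb''; apply: filterS2 => xi [F0 -> /=] Fb; split => //.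
  by rewrite (le_trans (ler_norm _)) // (le_trans (Re_le_rnorm _)) // (le_trans Fb) // lerDl ltW.
(* The real power is a measurable function that coincides with the inverse on nonnegative
   numbers. *)
pose D : X -> C := fun xi => (complex.Re (F xi) `^ (-1))%:C%C.
have mD : cmeasurable D.
  split; last exact: measurable_cst.
  by apply: (measurableT_comp (measurable_powR (-1))); case: WF.1.1.
have DF : \forall xi \ae mu, D xi * F xi = 1 /\ rnorm (D xi) <= delta^-1.
  move: Fb; apply: filterS => xi [F0 /andP[Fd1 _]].
  have r0 : 0 < complex.Re (F xi) := lt_le_trans d0 Fd1.
  rewrite /D powR_inv1 ?(ltW r0) // rnorm_real ger0_norm ?invr_ge0 ?(ltW r0) //.
  rewrite lef_pV2 ?posrE //; split => //.
  have -> : F xi = (complex.Re (F xi))%:C%C by move: F0; case: (F xi) => x y /= ->.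
  by rewrite -rmorphM /= mulVf ?gt_eqF.
have Db : \forall xi \ae mu, rnorm (D xi) <= delta^-1 by move: DF; apply: filterS => xi [].
have di0 : 0 <= delta^-1 by rewrite invr_ge0 ltW.
have [D2 _] := ae_const_N2 mD di0 Db.
exists D; last by move: DF; apply: filterS => xi [].
split; last by exists delta^-1.
pose p xi := 1 - (b^-1)%:C%C * F xi.
have Ep : fourier_bounded p.
  have -> : p = (fun xi => cst 1 xi + cst (- (b^-1)%:C%C) xi * F xi).
    by apply/funext => xi; rewrite /p /= mulNr.
  apply: fourier_boundedD; first exact: fourier_bounded_cst.
  by apply: fourier_boundedM => //; exact: fourier_bounded_cst.
pose s n xi := (b^-1)%:C%C * \sum_(k < n) p xi ^+ k.
have Es n : fourier_space (s n).
  apply: fourier_spaceZ; apply: fourier_space_sum => k.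
  by have [] := fourier_boundedX k Ep.
apply: fourier_space_lim => // e e0; pose q := 1 - delta / b.
have q01 : 0 <= q < 1.
  rewrite /q subr_ge0 gtrBl divr_gt0 // andbT ler_pdivrMr // mul1r.
  by rewrite /b lerDr ltW.
have /andP[q0 q1] := q01.
have e1 : 0 < e * delta ^+ 2 by rewrite mulr_gt0 // exprn_gt0.
have q21 : q ^+ 2 < 1 by rewrite expr_lt1.
have [n qn] := expr_small (exprn_ge0 2 q0) q21 e1.
exists (s n); split => //.
have Dsn : \forall xi \ae mu, rnorm (D xi - s n xi) <= delta^-1 * q ^+ n.
  move: DF Fb; apply: filterS2 => xi [DF1 Dd] [F0 /andP[Fd1 Fb1]].
  (* The geometric sum gives [s n * F = 1 - p ^+ n]; multiply by [D], using [D * F = 1]. *)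
  have -> : D xi - s n xi = D xi * p xi ^+ n.
    have : s n xi * F xi = 1 - p xi ^+ n.
      rewrite -opprB subrX1 -mulNr opprB /s mulrAC; congr (_ * _).
      by rewrite /p opprB addrCA subrr addr0.
    move=> sF; have : D xi * (s n xi * F xi) = D xi - D xi * p xi ^+ n by rewrite sF mulrBr mulr1.
    by rewrite mulrCA DF1 mulr1 => ->; rewrite opprB addrCA subrr addr0.
  rewrite rnormM rnormX ler_pM ?rnorm_ge0 ?exprn_ge0 ?rnorm_ge0 // lerXn2r ?nnegrE ?rnorm_ge0 //.
  have -> : p xi = (1 - b^-1 * complex.Re (F xi))%:C%C.
    rewrite /p rmorphB rmorphM /=; congr (_ - _ * _).
    by move: F0; case: (F xi) => x y /= ->.
  rewrite rnorm_real ger0_norm; last by rewrite subr_ge0 mulrC ler_pdivrMr // mul1r.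
  by rewrite lerD2l lerN2 mulrC ler_pM2l ?invr_gt0.
have mDs : cmeasurable (fun xi => D xi - s n xi) by apply: cmeasurableB => //; case: (Es n).1.
have [_ h] := ae_const_N2 mDs (mulr_ge0 di0 (exprn_ge0 n q0)) Dsn.
apply: (le_lt_trans h); rewrite exprMn exprVn mulrC ltr_pdivrMr ?exprn_gt0 //.
by rewrite -exprM mulnC exprM.
Qed.

Lemma bernoulli_growth (m r c : R) : 0 <= m -> 1 < r -> (forall n, m * r ^+ n <= c) -> m = 0.
Proof.
move=> m0 r1 mr; apply/eqP; rewrite eq_le m0 andbT leNgt; apply/negP => m1.
have bern n : 1 + n%:R * (r - 1) <= r ^+ n.
  elim: n => [|n IH]; first by rewrite mul0r addr0 expr0.
  rewrite exprS; apply: (@le_trans _ _ (r * (1 + n%:R * (r - 1)))).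
    rewrite -natr1 -subr_ge0.
    have -> : r * (1 + n%:R * (r - 1)) - (1 + (n%:R + 1) * (r - 1)) = n%:R * (r - 1) ^+ 2 by ring.
    by rewrite mulr_ge0 // sqr_ge0.
  by rewrite ler_pM2l // (lt_trans ltr01).
have c0 : 0 <= c by rewrite (le_trans _ (mr 0%N)) // expr0 mulr1.
have d0 : 0 < m * (r - 1) by rewrite mulr_gt0 // subr_gt0.
have := mr (Num.bound (c / (m * (r - 1)))); set n := Num.bound _ => h.
have : c < n%:R * (m * (r - 1)).
  by rewrite -ltr_pdivrMr //; apply: archi_boundP; rewrite divr_ge0 // ltW.
rewrite ltNge => /negP; apply; apply: le_trans h.
rewrite mulrCA ler_pM2l // (le_trans _ (bern n)) // lerDr; exact: ler01.
Qed.

Lemma ae_of_growth (A : set X) (r c : R) : measurable A -> 1 < r ->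
  (forall n, (mu A * (r ^+ n)%:E <= c%:E)%E) -> \forall xi \ae mu, ~ A xi.
Proof.
move=> mA r1 Ar; exists A; split => //; last by move=> xi /= /contrapT.
have Af : mu A \is a fin_num by rewrite fin_num_measure.
rewrite -(fineK Af); congr EFin; apply: (@bernoulli_growth _ r c) => // [|n].
  by rewrite fine_ge0.
by rewrite -lee_fin EFinM fineK.
Qed.

(* Tested on p = ((2c - f) / (2c - beta))^n with c >= f: p stays bounded by 1 where
   f >= beta and blows up where f <= beta - eps, so the latter set is null. *)
Lemma ae_lower_bound (f : X -> R) (beta : R) : 0 <= beta -> (forall xi, 0 <= f xi) ->
  fourier_bounded (fun xi => (f xi)%:C%C) ->
  (forall p, fourier_bounded p ->
    (beta%:E * sqint p <= \int[mu]_xi (f xi * rnorm (p xi) ^+ 2)%:E)%E) ->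
  \forall xi \ae mu, beta <= f xi.
Proof.
move=> beta0 f0 Ef fp; have [Wf [c' /ae_bound_pos [c'' c''0 fc'']]] := Ef.
pose c := c'' + `|beta| + 1.
have fc : \forall xi \ae mu, f xi <= c.
  move: fc''; apply: filterS => xi; rewrite rnorm_real ger0_norm // => h.
  by rewrite (le_trans h) // /c -addrA lerDl addr_ge0.
have cb : beta < c.
  by rewrite (le_lt_trans (ler_norm beta)) // /c addrAC ltrDr addr_gt0.
have c0 : 0 < c by rewrite /c addr_gt0 // ltr_pwDl.
have d0 : 0 < 2 * c - beta by lra.
have mf : measurable_fun setT f by case: Wf.1.1.
(* A strict failure of the bound is a failure by some [1 / (k + 1)], and countably many null sets
   have a null union. *)
suff h k : \forall xi \ae mu, ~ (f xi <= beta - (k.+1%:R)^-1).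
  have /ae_foralln : forall k, \forall xi \ae mu, ~ (f xi <= beta - (k.+1%:R)^-1) := h.
  apply: filterS => xi hxi; rewrite leNgt; apply/negP => fb.
  have b0 : 0 < beta - f xi by rewrite subr_gt0.
  apply: (hxi (Num.bound (beta - f xi)^-1)); rewrite lerBrDl -lerBrDr.
  rewrite -[leRHS]invrK lef_pV2 ?posrE ?invr_gt0 ?ltr0Sn //.
  rewrite ltW // (lt_le_trans (archi_boundP _)) ?invr_ge0 ?(ltW b0) // ler_nat //.
set eps : R := (k.+1%:R)^-1; have eps0 : 0 < eps by rewrite invr_gt0 ltr0Sn.
pose A := [set xi : X | f xi <= beta - eps].
have mA : measurable A.
  have := measurable_fun_ler mf (measurable_cst (beta - eps)).
  move=> /(_ measurableT [set true] I); rewrite setTI.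
  by congr measurable; apply/seteqP; split => xi /=.
pose rho := ((2 * c - beta + eps) / (2 * c - beta)) ^+ 2.
have rho1 : 1 < rho.
  by rewrite /rho exprn_egt1 // ltr_pdivlMr // mul1r ltrDl.
apply: (@ae_of_growth A rho (c / eps)) => // n.
pose P xi : C := ((2 * c - f xi) / (2 * c - beta))%:C%C.
have EP : fourier_bounded P.
  have -> : P = (fun xi => cst ((2 * c) / (2 * c - beta))%:C%C xi +
      cst (- (2 * c - beta)^-1)%:C%C xi * (f xi)%:C%C).
    apply/funext => xi; rewrite /= /P -rmorphM -rmorphD /=; congr (_%:C)%C.
    by rewrite mulrBl mulNr [_^-1 * _]mulrC.
  apply: fourier_boundedD; first exact: fourier_bounded_cst.
  by apply: fourier_boundedM => //; exact: fourier_bounded_cst.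
have EPn := fourier_boundedX n EP.
set p := fun xi => P xi ^+ n in EPn.
have p2 : L2 p := EPn.1.1.
have mp2 := cmeasurable_sqr p2.1.
have mfp : measurable_fun setT (fun xi => (f xi * rnorm (p xi) ^+ 2)%:E).
  by apply/measurable_EFinP; apply: measurable_funM => //; apply/measurable_EFinP.
have fpf : (\int[mu]_xi (f xi * rnorm (p xi) ^+ 2)%:E)%E \is a fin_num.
  rewrite ge0_fin_numE; last by apply: integral_ge0 => xi _; rewrite lee_fin mulr_ge0 ?sqr_ge0.
  apply: (@le_lt_trans _ _ (c%:E * sqint p)%E); last first.
    by rewrite N2E // -EFinM ltry.
  rewrite /sqint -ge0_integralZl_EFin ?(ltW c0) //; last by move=> xi _; rewrite lee_fin sqr_ge0.
  apply: ae_ge0_le_integral => //.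
  - by move=> xi _; rewrite lee_fin mulr_ge0 ?sqr_ge0.
  - by move=> xi _; rewrite -EFinM lee_fin mulr_ge0 ?sqr_ge0 ?(ltW c0).
  - exact: measurable_funeM.
  - by move: fc; apply: filterS => xi fc _; rewrite -EFinM lee_fin ler_wpM2r ?sqr_ge0.
(* A pointwise inequality integrated, with [t ^+ n] standing for [rnorm (p xi) ^+ 2]. On [A],
   [rho ^+ n <= t ^+ n] and [f + eps <= beta]. Outside [A], either [f <= beta], or [t <= 1] and the
   excess [(f - beta) * t ^+ n] is at most [c]. The hypothesis on [p] then cancels the two integrals
   and leaves [eps * rho ^+ n * mu A <= c]. *)
have main : ((eps * rho ^+ n)%:E * mu A + \int[mu]_xi (f xi * rnorm (p xi) ^+ 2)%:E <=
    beta%:E * sqint p + c%:E)%E.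
  have er0 : 0 <= eps * rho ^+ n by rewrite mulr_ge0 ?(ltW eps0) // exprn_ge0 // ltW // (lt_trans ltr01).
  have m1 : measurable_fun setT (fun xi : X => (eps * rho ^+ n * \1_A xi)%:E).
    by apply/measurable_EFinP; apply: measurable_funM => //; exact: measurable_indic.
  have -> : ((eps * rho ^+ n)%:E * mu A = \int[mu]_xi (eps * rho ^+ n * \1_A xi)%:E)%E.
    under eq_integral do rewrite EFinM.
    rewrite ge0_integralZl_EFin //; first by rewrite integral_indic // setIT.
    by apply/measurable_EFinP; exact: measurable_indic.
  have -> : (beta%:E * sqint p + c%:E = \int[mu]_xi (beta * rnorm (p xi) ^+ 2 + c)%:E)%E.
    rewrite /sqint -ge0_integralZl_EFin //; last by move=> xi _; rewrite lee_fin sqr_ge0.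
    have -> : c%:E = (\int[mu]_xi (cst c%:E xi))%E.
      by rewrite integral_cst //= probability_setT mule1.
    rewrite -ge0_integralD //.
    - by move=> xi _; rewrite -EFinM lee_fin mulr_ge0 ?sqr_ge0.
    - exact: measurable_funeM.
    - by move=> xi _; rewrite lee_fin ltW.
  rewrite -ge0_integralD //; first last.
  - by move=> xi _; rewrite lee_fin mulr_ge0 ?sqr_ge0.
  - by move=> xi _; rewrite lee_fin mulr_ge0.
  apply: ae_ge0_le_integral => //.
  - move=> xi _; rewrite -EFinD lee_fin; apply: addr_ge0; first exact: mulr_ge0.
    by apply: mulr_ge0 => //; exact: sqr_ge0.
  - exact: emeasurable_funD.
  - move=> xi _; rewrite lee_fin; apply: addr_ge0; last exact: ltW.
    by apply: mulr_ge0 => //; exact: sqr_ge0.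
  - apply/measurable_EFinP; apply: measurable_funD => //; apply: measurable_funM => //.
    exact/measurable_EFinP.
  move: fc; apply: filterS => xi fcx _; rewrite -EFinD lee_fin.
  have -> : rnorm (p xi) ^+ 2 = (((2 * c - f xi) / (2 * c - beta)) ^+ 2) ^+ n.
    by rewrite /p /P rnormX rnorm_real -exprM mulnC exprM real_normK ?num_real.
  set t := (_ / _) ^+ 2; have t0 : 0 <= t by exact: sqr_ge0.
  have dd0 : 0 <= (2 * c - f xi) / (2 * c - beta) by rewrite divr_ge0 ?(ltW d0) //; lra.
  have [xA|xA] := pselect (A xi).
    rewrite indicE mem_set // mulr1.
    have rt : rho ^+ n <= t ^+ n.
      rewrite lerXn2r ?nnegrE //; first by rewrite ltW // (lt_trans ltr01).
      rewrite /rho /t lerXn2r ?nnegrE //; first by rewrite divr_ge0 ?(ltW d0) //; lra.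
      by rewrite ler_pM2r ?invr_gt0 //; move: xA; rewrite /A /=; lra.
    have h1 : eps * rho ^+ n <= eps * t ^+ n by rewrite ler_pM2l.
    have h2 : (f xi + eps) * t ^+ n <= beta * t ^+ n.
      by rewrite ler_wpM2r ?exprn_ge0 //; move: xA; rewrite /A /=; lra.
    lra.
  rewrite indicE memNset // mulr0 add0r.
  have [fb|fb] := leP (f xi) beta.
    have : f xi * t ^+ n <= beta * t ^+ n by rewrite ler_wpM2r ?exprn_ge0.
    lra.
  have t1 : t ^+ n <= 1.
    rewrite exprn_ile1 // /t exprn_ile1 // ler_pdivrMr // mul1r; lra.
  have : (f xi - beta) * t ^+ n <= (f xi - beta) * 1 by rewrite ler_wpM2l // subr_ge0 ltW.
  lra.
have {}main : ((eps * rho ^+ n)%:E * mu A <= c%:E)%E.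
  rewrite -(leeD2rE _ _ fpf); apply: (le_trans main); rewrite addeC leeD2l //.
  exact: fp.
have Af : mu A \is a fin_num by rewrite fin_num_measure.
move: main; rewrite -(fineK Af) -!EFinM !lee_fin => h.
by rewrite ler_pdivlMr // (_ : _ * eps = eps * rho ^+ n * fine (mu A)) //; ring.
Qed.

End SpectralArguments.

(** * Multipliers of the transforms are bounded *)

Section Multipliers.
Variables (R : realType) (G : zmodType) (mu : probability (borel_dual R G) R).
Hypothesis mu_haar : haar_measure mu.
Local Notation C := R[i].
Local Notation X := (borel_dual R G).
Local Notation L2 := (@L2 R G mu).
Local Notation N2 := (@N2 R G mu).
Local Notation sqint := (@sqint R G mu).
Local Notation fourier_coef := (@fourier_coef R G mu).
Local Notation fourier_space := (@fourier_space R G mu).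
Variables (F : X -> C) (c : R).
Hypothesis WF : fourier_space F.
Hypothesis c0 : 0 < c.
Hypothesis Fc : forall x J, (sqint (fun xi => (F xi * trig x J xi)%R) <= c%:E * sqint (trig x J))%E.

(* The factor 2 comes from truncating F, which is not known to be bounded, before
   approximating Y by trigonometric polynomials. *)
Lemma multiplier_sqint Y : fourier_space Y ->
  (sqint (fun xi => (F xi * Y xi)%R) <= (2 * c * N2 Y)%:E)%E.
Proof.
move=> WY; have [Y2 _] := WY; have mF := WF.1.1; have mY := Y2.1.
pose F' (n : nat) xi : C := F xi * (\1_[set xi : X | rnorm (F xi) <= n%:R] xi)%:C%C.
have mF' n : cmeasurable (F' n).
  apply: cmeasurableM => //; split; last exact: measurable_cst.
  apply: measurable_indic.
  have := measurable_fun_ler (cmeasurable_rnorm mF) (@measurable_cst _ _ X R setT n%:R).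
  move=> /(_ measurableT [set true] I); rewrite setTI.
  by congr measurable; apply/seteqP; split => xi /=.
have F'F n xi : rnorm (F' n xi) <= rnorm (F xi).
  rewrite rnormM rnorm_real indicE; case: (_ \in _); rewrite /= ?normr1 ?mulr1 // normr0 mulr0.
  exact: rnorm_ge0.
have F'n n xi : rnorm (F' n xi) <= n%:R.
  rewrite rnormM rnorm_real indicE; have [h|h] := pselect (rnorm (F xi) <= n%:R).
    by rewrite mem_set // normr1 mulr1.
  by rewrite memNset // normr0 mulr0.
have F'b n : (sqint (fun xi => (F' n xi * Y xi)%R) <= (2 * c * N2 Y)%:E)%E.
  have FY2 : L2 (fun xi => F' n xi * Y xi).
    by apply: (L2_bounded_mul (mF' n) _ Y2); exact: aeW.
  rewrite N2E // lee_fin; apply/ler_addgt0Pr => e e0.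
  have d0 : 0 < e / (2 * (n%:R ^+ 2 + 1)) by rewrite divr_gt0 // mulr_gt0 // ltr_wpDl ?sqr_ge0.
  have /is_fourierP [_ /(_ _ d0) [J /(_ J (fsubset_refl _))]] := is_fourier_coef mu_haar WY.
  set p := trig (fourier_coef Y) J; have p2 : L2 p := trig_L2 mu _ _.
  have D2 := L2B Y2 p2; rewrite N2E // lte_fin => De.
  have h1 : N2 (fun xi => F' n xi * (Y xi - p xi)) <= n%:R ^+ 2 * N2 (fun xi => Y xi - p xi).
    by apply: bounded_mul_N2 => //; exact: aeW.
  have F'p2 : L2 (fun xi => F' n xi * p xi) by apply: (L2_bounded_mul (mF' n) _ p2); exact: aeW.
  have F'D2 : L2 (fun xi => F' n xi * (Y xi - p xi)).
    by apply: (L2_bounded_mul (mF' n) _ D2); exact: aeW.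
  have h2 : N2 (fun xi => F' n xi * p xi) <= c * N2 Y.
    rewrite -lee_fin -N2E //; apply: (@le_trans _ _ (sqint (fun xi => (F xi * p xi)%R))).
      apply: le_sqint; [by case: F'p2|by apply: cmeasurableM => //; case: p2|].
      by move=> xi; rewrite (rnormM (F' n xi)) (rnormM (F xi)) ler_wpM2r ?rnorm_ge0.
    apply: (le_trans (Fc _ _)); rewrite N2E // -EFinM lee_fin ler_pM2l // N2_trig //.
    exact: bessel.
  have -> : (fun xi => F' n xi * Y xi) = (fun xi => F' n xi * (Y xi - p xi) + F' n xi * p xi).
    by apply/funext => xi; rewrite -mulrDr subrK.
  apply: (le_trans (N2D F'D2 F'p2)); rewrite addrC lerD //.
    by rewrite -mulrA ler_pM2l.
  rewrite (@le_trans _ _ (2 * (n%:R ^+ 2 * (e / (2 * (n%:R ^+ 2 + 1)))))) //.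
    rewrite ler_pM2l // (le_trans h1) // ler_wpM2l ?sqr_ge0 // ltW //.
  have n1 : 0 < n%:R ^+ 2 + 1 :> R by rewrite ltr_wpDl ?sqr_ge0.
  have -> : 2 * (n%:R ^+ 2 * (e / (2 * (n%:R ^+ 2 + 1)))) = n%:R ^+ 2 / (n%:R ^+ 2 + 1) * e.
    by field; rewrite gt_eqF.
  by rewrite ger_pMl // ler_pdivrMr // mul1r lerDl.
(* The bound does not depend on the truncation level, so Fatou's lemma removes it: at each point
   [F' n] equals [F] for large [n]. *)
apply: le_trans (limn_einf_le (m := 0) (fun n _ => F'b n)).
have mF'Y n : measurable_fun setT (fun xi => (rnorm (F' n xi * Y xi) ^+ 2)%:E).
  by apply: cmeasurable_sqr; exact: cmeasurableM.
apply: le_trans (fatou _ _ mF'Y _) => //; last by move=> n xi _; rewrite lee_fin sqr_ge0.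
rewrite /sqint le_eqVlt; apply/orP; left; apply/eqP; apply: eq_integral => xi _.
suff /cvg_limn_einf_sup [-> _] : (rnorm (F' n xi * Y xi) ^+ 2)%:E @[n --> \oo] --> (rnorm (F xi * Y xi) ^+ 2)%:E by [].
apply: cvg_near_cst.
near=> n; rewrite /F' indicE mem_set ?mulr1 //=.
rewrite (@le_trans _ _ (Num.bound (rnorm (F xi)))%:R) //.
  by rewrite ltW // archi_boundP // rnorm_ge0.
by rewrite ler_nat; near: n; exists (Num.bound (rnorm (F xi))).
Unshelve. all: by end_near.
Qed.

(** Staying in W is what allows the estimate to be iterated along the powers of [F]. *)
Lemma multiplier_space Y : fourier_space Y ->
  fourier_space (fun xi => F xi * Y xi) /\ N2 (fun xi => F xi * Y xi) <= 2 * c * N2 Y.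
Proof.
move=> WY; have h := multiplier_sqint WY; have [Y2 Ya] := WY.
have FYm : cmeasurable (fun xi => F xi * Y xi) by apply: cmeasurableM; [case: WF.1|case: Y2].
have FY2 : L2 (fun xi => F xi * Y xi) by split => //; rewrite (le_lt_trans h) ?ltry.
split; last by rewrite -lee_fin -N2E.
apply: fourier_space_lim => // e e0.
have d0 : 0 < e / (4 * c) by rewrite divr_gt0 // mulr_gt0.
have [x [J xJ]] := Ya _ d0; exists (fun xi => F xi * trig x J xi).
have Wt := fourier_space_trig mu x J.
split; first exact: fourier_space_mul_trig.
have WD := fourier_spaceB WY Wt; have := multiplier_sqint WD.
have -> : (fun xi => F xi * (Y xi - trig x J xi)) = (fun xi => F xi * Y xi - F xi * trig x J xi).
  by apply/funext => xi; rewrite mulrBr.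
move=> hD; rewrite (@le_lt_trans _ _ (2 * c * N2 (fun xi => Y xi - trig x J xi))) //.
  rewrite -lee_fin (le_trans _ hD) // /N2 fineK // ge0_fin_numE ?sqint_ge0 //.
  by rewrite (le_lt_trans hD) ?ltry.
rewrite (@lt_trans _ _ (2 * c * (e / (4 * c)))) ?ltr_pM2l ?mulr_gt0 //.
rewrite [ltLHS](_ : _ = e / 2); last by field; rewrite gt_eqF.
by rewrite ltr_pdivrMr // ltr_pMr // ltrDl.
Qed.

(* The powers F^n stay in L^2 with norms growing at most geometrically. *)
Lemma multiplier_bounded : exists b : R, \forall xi \ae mu, rnorm (F xi) <= b.
Proof.
have Fn n : fourier_space (fun xi => F xi ^+ n) /\ N2 (fun xi => F xi ^+ n) <= (2 * c) ^+ n.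
  elim: n => [|n [WFn Nn]].
    have -> : (fun xi => F xi ^+ 0) = (cst 1 : X -> C) by apply/funext.
    split; first exact: fourier_space_cst.
    by rewrite /N2 sqint_cst rnorm1 expr1n expr0.
  have -> : (fun xi => F xi ^+ n.+1) = (fun xi => F xi * F xi ^+ n).
    by apply/funext => xi; rewrite exprS.
  have [WFS NS] := multiplier_space WFn; split => //.
  by rewrite (le_trans NS) // exprS ler_pM2l // mulr_gt0.
have mF := cmeasurable_rnorm WF.1.1.
(* On [A] the square of [F ^+ n] is at least [(4 * c) ^+ n], while its integral is at most
   [(2 * c) ^+ n]; so [mu A * 2 ^+ n <= 1] for all [n]. *)
pose A := [set xi : X | 4 * c <= rnorm (F xi) ^+ 2].
have mA : measurable A.
  have mF2 : measurable_fun setT (fun xi => rnorm (F xi) ^+ 2) by exact: measurable_funX.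
  have := measurable_fun_ler (@measurable_cst _ _ X R setT (4 * c)) mF2.
  move=> /(_ measurableT [set true] I); rewrite setTI.
  by congr measurable; apply/seteqP; split => xi /=.
exists (Num.sqrt (4 * c)).
have : \forall xi \ae mu, ~ A xi.
  have r12 : (1 : R) < 2 by rewrite ltr1n.
  apply: (@ae_of_growth _ _ _ A 2 1 mA r12) => n.
  have [[F2n _] Nn] := Fn n.
  have cn0 : 0 < (2 * c) ^+ n by rewrite exprn_gt0 // mulr_gt0.
  have Af : mu A \is a fin_num by rewrite fin_num_measure.
  have : (((4 * c) ^+ n)%:E * mu A <= sqint (fun xi => (F xi ^+ n)%R))%E.
    have -> : (((4 * c) ^+ n)%:E * mu A = \int[mu]_xi ((4 * c) ^+ n * \1_A xi)%:E)%E.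
      under eq_integral do rewrite EFinM.
      rewrite ge0_integralZl_EFin //; first by rewrite integral_indic // setIT.
      - by apply/measurable_EFinP; exact: measurable_indic.
      - by rewrite exprn_ge0 // mulr_ge0 // ltW.
    apply: ge0_le_integral => //.
    - by move=> xi _; rewrite lee_fin mulr_ge0 // exprn_ge0 // mulr_ge0 // ltW.
    - by apply/measurable_EFinP; apply: measurable_funM => //; exact: measurable_indic.
    - by apply: cmeasurable_sqr; case: F2n.
    move=> xi _; rewrite lee_fin indicE; have [Ax|Ax] := pselect (A xi).
      rewrite mem_set // mulr1 rnormX -exprM mulnC exprM lerXn2r ?nnegrE ?sqr_ge0 //.
      by rewrite mulr_ge0 // ltW.
    by rewrite memNset // mulr0 sqr_ge0.
  rewrite N2E // -(fineK Af) -!EFinM !lee_fin => h.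
  have {}h := le_trans h Nn.
  rewrite -(ler_pM2l cn0) mulr1 (le_trans _ h) // le_eqVlt; apply/orP; left; apply/eqP.
  rewrite mulrCA -exprMn mulrC; congr (_ ^+ _ * _); ring.
apply: filterS => xi /negP; rewrite -ltNge => h.
have c4 : 0 <= 4 * c by rewrite mulr_ge0 // ltW.
by rewrite -(@ler_pXn2r _ 2) ?nnegrE ?rnorm_ge0 ?sqrtr_ge0 // sqr_sqrtr // ltW.
Qed.

End Multipliers.

(** * Transfer matrices *)


Section PointwiseMatrices.
Variable R : realType.
Local Notation C := R[i].

Definition vsq n (v : 'cV[C]_n) : R := \sum_i rnorm (v i ord0) ^+ 2.

Lemma vsq_ge0 n (v : 'cV[C]_n) : 0 <= vsq v.
Proof. by apply: sumr_ge0 => i _; rewrite sqr_ge0. Qed.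

Lemma vsqZ n (a : C) (v : 'cV[C]_n) : vsq (a *: v) = rnorm a ^+ 2 * vsq v.
Proof. by rewrite /vsq mulr_sumr; apply: eq_bigr => i _; rewrite mxE rnormM exprMn. Qed.

Lemma conjtrmxE m n (A : 'M[C]_(m, n)) i j : conjtrmx A i j = (A j i)^*.
Proof. by rewrite !mxE. Qed.

Lemma conjtrmx_mul m n p (A : 'M[C]_(m, n)) (B : 'M[C]_(n, p)) :
  conjtrmx (A *m B) = conjtrmx B *m conjtrmx A.
Proof. by rewrite /conjtrmx trmx_mul map_mxM. Qed.

Lemma vsq_mul m n (A : 'M[C]_(m, n)) v :
  (conjtrmx v *m (conjtrmx A *m A) *m v) ord0 ord0 = (vsq (A *m v))%:C%C.
Proof.
rewrite !mulmxA -conjtrmx_mul -mulmxA mxE rmorph_sum; apply: eq_bigr => i _.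
by rewrite conjtrmxE /= -mul_conj_rnorm mulrC.
Qed.

Lemma vsq_mul_le m n (A : 'M[C]_(m, n)) (c : R) v : 0 <= c ->
  (forall i j, rnorm (A i j) <= c) -> vsq (A *m v) <= m%:R * (n%:R * c) ^+ 2 * vsq v.
Proof.
move=> c0 Ac; pose s := Num.sqrt (vsq v).
have sv : s ^+ 2 = vsq v by rewrite sqr_sqrtr // vsq_ge0.
have vs j : rnorm (v j ord0) <= s.
  rewrite -(@ler_pXn2r _ 2) ?nnegrE ?rnorm_ge0 ?sqrtr_ge0 // sv /vsq (bigD1 j) //=.
  by rewrite lerDl sumr_ge0 // => i _; rewrite sqr_ge0.
rewrite {1}/vsq -sv -mulrA -exprMn (@le_trans _ _ (\sum_(i < m) (n%:R * c * s) ^+ 2)) //.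
  apply: ler_sum => i _; rewrite lerXn2r ?nnegrE ?rnorm_ge0 ?mulr_ge0 ?sqrtr_ge0 //.
  rewrite mxE (le_trans (rnorm_sum _ _ _)) // (@le_trans _ _ (\sum_(j < n) (c * s))) //.
    by apply: ler_sum => j _; rewrite rnormM ler_pM ?rnorm_ge0.
  by rewrite sumr_const card_ord -[leLHS]mulr_natl mulrA.
by rewrite sumr_const card_ord -[leLHS]mulr_natl.
Qed.

Lemma det_gram_real m n (A : 'M[C]_(m, n)) : complex.Im (\det (conjtrmx A *m A)) = 0.
Proof.
have h : (\det (conjtrmx A *m A))^* = \det (conjtrmx A *m A).
  rewrite -det_map_mx -det_tr map_trmx; congr (\det _).
  by rewrite -[LHS]/(conjtrmx _) conjtrmx_mul; congr (_ *m _); apply/matrixP => i j; rewrite !mxE conjCK.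
move: h; case: (\det _) => a b /= [] /eqP.
by rewrite eq_sym -subr_eq0 opprK -mulr2n mulrn_eq0 /= => /eqP.
Qed.

(* In an orthonormal eigenbasis w_i of A^* A the determinant is the product of the
   eigenvalues |A w_i|^2. *)
Lemma det_gram_lower_bound m n (A : 'M[C]_(m, n)) (c : R) : 0 <= c ->
  (forall v, c * vsq v <= vsq (A *m v)) ->
  c ^+ n <= complex.Re (\det (conjtrmx A *m A)).
Proof.
move=> c0 Ac; set K := conjtrmx A *m A.
have KK : conjtrmx K = K.
  by rewrite /K conjtrmx_mul; congr (_ *m _); apply/matrixP => i j; rewrite !mxE conjCK.
have Kn : K \is normalmx.
  by apply/normalmxP; rewrite -/(conjtrmx K) KK.
have /orthomx_spectralP eK := Kn; have Pu := spectral_unitarymx K.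
set P := spectralmx K in eK Pu; set D := spectral_diag K in eK.
have PP : P *m conjtrmx P = 1%:M by apply/unitarymxP.
have dK : \det K = \prod_i D ord0 i.
  rewrite eK !det_mulmx mulrAC -det_mulmx mulVmx ?det1 ?mul1r ?det_diag //.
  exact: spectral_unit.
pose w i := conjtrmx (row i P).
have wn i : vsq (w i) = 1.
  have := congr1 (fun Z : 'M[C]_n => complex.Re (Z i i)) PP; rewrite !mxE eqxx /= => <-.
  rewrite cRe_sum; apply: eq_bigr => j _.
  by rewrite !mxE mul_conj_rnorm /= rnorm_conj.
have Dw i : D ord0 i = (vsq (A *m w i))%:C%C.
  rewrite -vsq_mul -/K.
  have -> : conjtrmx (w i) = row i P by apply/matrixP => a b; rewrite !mxE conjCK.
  (* Its diagonal entries are the quadratic form of [K] at the vectors [w i]. *)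
  have e1 : P *m K *m conjtrmx P = diag_mx D.
    rewrite eK !mulmxA mulmxV ?spectral_unit // mul1mx -mulmxA PP mulmx1 //.
  have := congr1 (fun Z : 'M[C]_n => Z i i) e1; rewrite [in RHS]mxE eqxx mulr1n => <-.
  rewrite -!row_mul /w [RHS]mxE [LHS]mxE [RHS]mxE; apply: eq_bigr => j _.
  by rewrite !mxE.
rewrite dK (eq_bigr (fun i => (vsq (A *m w i))%:C%C)) // -rmorph_prod /=.
rewrite -[X in c ^+ X]card_ord -prodr_const; apply: ler_prod => i _; rewrite c0 /=.
by rewrite (le_trans _ (Ac _)) // wn mulr1.
Qed.

End PointwiseMatrices.

(** * Transforms of vector sequences and left inverses *)

Section VectorFourier.
Variables (R : realType) (G : zmodType) (mu : probability (borel_dual R G) R).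
Hypothesis mu_haar : haar_measure mu.
Local Notation C := R[i].
Local Notation X := (borel_dual R G).
Local Notation L2 := (@L2 R G mu).
Local Notation sqint := (@sqint R G mu).
Local Notation fourier_coef := (@fourier_coef R G mu).
Local Notation fourier_space := (@fourier_space R G mu).
Local Notation fourier_bounded := (@fourier_bounded R G mu).

Definition vfourier n (x : G -> 'cV[C]_n) (xh : X -> 'cV[C]_n) : Prop :=
  forall i, is_fourier mu (fun g => x g i ord0) (fun xi => xh xi i ord0).

Lemma vfourier_exists n (x : G -> 'cV[C]_n) : vl2 x -> exists xh, vfourier x xh.
Proof.
move=> x2; have /choice [F Fx] : forall i, exists F, is_fourier mu (fun g => x g i ord0) F.
  by move=> i; apply: riesz_fischer => //; exact: x2.
exists (fun xi => \col_i F i xi) => i.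
by have := Fx i; congr is_fourier; apply/funext => xi; rewrite mxE.
Qed.

Lemma is_fourier_l2 (x : G -> C) F : is_fourier mu x F -> l2 x.
Proof. by move=> /(is_fourier_space mu_haar) [[F2 _] ->]; exact: fourier_coef_l2. Qed.

Lemma vfourier_vl2 n (x : G -> 'cV[C]_n) xh : vfourier x xh -> vl2 x.
Proof. by move=> xf i; exact: is_fourier_l2 (xf i). Qed.

Lemma is_fourier_parseval (x : G -> C) F : is_fourier mu x F -> l2norm2 x = sqint F.
Proof.
move=> xF; have [WF ex] := is_fourier_space mu_haar xF.
by rewrite (l2nE (is_fourier_l2 xF)) ex (parseval mu_haar WF) N2E //; case: WF.
Qed.

Lemma vfourier_measurable n (x : G -> 'cV[C]_n) xh : vfourier x xh ->
  measurable_fun setT (fun xi => (vsq (xh xi))%:E).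
Proof.
move=> xf; apply/measurable_EFinP; rewrite /vsq.
apply: measurable_sum => i; apply/measurable_EFinP; apply: cmeasurable_sqr.
by case: (xf i).
Qed.

Lemma vfourier_parseval n (x : G -> 'cV[C]_n) xh : vfourier x xh ->
  vl2norm2 x = (\int[mu]_xi (vsq (xh xi))%:E)%E.
Proof.
move=> xf; rewrite /vl2norm2 (eq_bigr (fun i => sqint (fun xi => xh xi i ord0))); last first.
  by move=> i _; exact: is_fourier_parseval.
rewrite -ge0_integral_sum //; last 2 first.
- by move=> i; apply: cmeasurable_sqr; case: (xf i).
- by move=> i xi _; rewrite lee_fin sqr_ge0.
by apply: eq_integral => xi _; rewrite sumEFin.
Qed.

Lemma vfourier_ae_inj n (x y : G -> 'cV[C]_n) xh yh : vfourier x xh -> vfourier y yh ->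
  (\forall xi \ae mu, xh xi = yh xi) -> x = y.
Proof.
move=> xf yf xy; apply/funext => g; apply/colP => i.
have [Wx ex] := is_fourier_space mu_haar (xf i); have [Wy ey] := is_fourier_space mu_haar (yf i).
rewrite [LHS](congr1 (@^~ g) ex) [RHS](congr1 (@^~ g) ey).
apply: ae_eq_coef; [exact: Wx.1.1|exact: Wy.1.1|].
by move: xy; apply: filterS => xi ->.
Qed.

Lemma vfourier_inj n (x : G -> 'cV[C]_n) xh yh : vfourier x xh -> vfourier x yh ->
  \forall xi \ae mu, xh xi = yh xi.
Proof.
move=> xf yf.
have : \forall xi \ae mu, forall i, xh xi i ord0 = yh xi i ord0.
  apply: filter_forall => i.
  have [Wx ex] := is_fourier_space mu_haar (xf i); have [Wy ey] := is_fourier_space mu_haar (yf i).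
  by apply: fourier_space_inj => // g; rewrite -[LHS](congr1 (@^~ g) ex) -[RHS](congr1 (@^~ g) ey).
by apply: filterS => xi h; apply/colP.
Qed.

Section Transfer.
Variables (m n : nat) (A : G -> 'M[C]_(m, n)) (Ah : X -> 'M[C]_(m, n)).
Hypothesis A_Ah : transfer_matrix mu A Ah.
Hypothesis Ah_bounded : mxLinfty mu Ah.

Lemma transfer_fourier_bounded i j : fourier_bounded (fun xi => Ah xi i j).
Proof.
by split; [case: (is_fourier_space mu_haar (A_Ah i j))|case/LinftyP: (Ah_bounded i j)].
Qed.

Lemma mxLinfty_ae_bound : exists2 c : R, 0 <= c &
  \forall xi \ae mu, forall i j, rnorm (Ah xi i j) <= c.
Proof.
have /choice [c cP] : forall i, exists c : 'I_n -> R,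
    forall j, \forall xi \ae mu, rnorm (Ah xi i j) <= c j.
  move=> i; have /choice [c cP] : forall j, exists c : R, \forall xi \ae mu, rnorm (Ah xi i j) <= c.
    by move=> j; have /LinftyP [_] := Ah_bounded i j.
  by exists c.
exists (\sum_i \sum_j `|c i j|); first by apply: sumr_ge0 => i _; exact: sumr_ge0.
apply: filter_forall => i; apply: filter_forall => j.
have := cP i j; apply: filterS => xi h; rewrite (le_trans h) // (le_trans (ler_norm _)) //.
rewrite (bigD1 i) //= (bigD1 j) //= -addrA lerDl addr_ge0 ?sumr_ge0 //.
by move=> k _; exact: sumr_ge0.
Qed.

Lemma vfourier_mxconvolution x xh : vfourier x xh ->
  vfourier (mxconvolution A x) (fun xi => Ah xi *m xh xi).
Proof.
move=> xf i.
have cF j : is_fourier mu (convolution (fun h => A h i j) (fun h => x h j ord0))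
    (fun xi => Ah xi i j * xh xi j ord0).
  have [_ [c Ac]] := transfer_fourier_bounded i j.
  by have [] := convolution_fourier mu_haar (A_Ah i j) Ac (xf j).
have Wj j := is_fourier_space mu_haar (cF j).
have W : fourier_space (fun xi => \sum_j Ah xi i j * xh xi j ord0).
  by apply: fourier_space_sum => j; case: (Wj j).
have := is_fourier_coef mu_haar W; congr is_fourier; last first.
  by apply/funext => xi; rewrite mxE.
apply/funext => g; rewrite mxE fourier_coef_sum; last by move=> j; have [[]] := Wj j.
by apply: eq_bigr => j _; have [_ ->] := Wj j.
Qed.

(** The convolution series must be known to converge before sums can be subtracted: Riesz-Fischer
    gives each entry of the argument a transform, and the convolution theorem then applies. *)
Lemma mxconvolutionB x y : vl2 x -> vl2 y ->
  mxconvolution A (fun g => x g - y g) = (fun g => mxconvolution A x g - mxconvolution A y g).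
Proof.
move=> x2 y2; apply/funext => g; apply/colP => i; rewrite !mxE -sumrB; apply: eq_bigr => j _.
have hs (z : G -> C) : l2 z -> exists s,
    has_sum (fun h => A (g - h) i j * z h : C^o) s /\ convolution (fun h => A h i j) z g = s.
  move=> z2; have [Z zZ] := riesz_fischer mu_haar z2.
  have [_ [c Ac]] := transfer_fourier_bounded i j.
  have [/(_ g) h _] := convolution_fourier mu_haar (A_Ah i j) Ac zZ.
  by eexists; split; [exact: h|exact: (@has_sum_sum _ _ C^o)].
have [s [hs1 ->]] := hs _ (x2 j); have [t [ht1 ->]] := hs _ (y2 j).
apply: (@has_sum_sum _ _ C^o); have := has_sumB hs1 ht1.
by congr has_sum; apply/funext => h; rewrite !mxE mulrBr.
Qed.

Lemma transfer_bounded_convolution : exists a, bounded_convolution A a.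
Proof.
have [c c0 Ac] := mxLinfty_ae_bound.
exists (m%:R * (n%:R * c) ^+ 2 + 1); split.
- by rewrite ltr_wpDl // mulr_ge0 // sqr_ge0.
- move=> y y2; have [yh yf] := vfourier_exists y2.
  have Ayf := vfourier_mxconvolution yf; split; first exact: vfourier_vl2 Ayf.
  have a0 : 0 <= m%:R * (n%:R * c) ^+ 2 by rewrite mulr_ge0 // sqr_ge0.
  rewrite (vfourier_parseval Ayf) (vfourier_parseval yf) -ge0_integralZl_EFin //; first last.
  - by rewrite addr_ge0.
  - exact: vfourier_measurable yf.
  - by move=> xi _; rewrite lee_fin vsq_ge0.
  apply: ae_ge0_le_integral => //.
  - by move=> xi _; rewrite lee_fin vsq_ge0.
  - exact: vfourier_measurable Ayf.
  - by move=> xi _; rewrite -EFinM lee_fin mulr_ge0 ?vsq_ge0 // addr_ge0.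
  - by apply: measurable_funeM; exact: vfourier_measurable yf.
  move: Ac; apply: filterS => xi Ac _; rewrite -EFinM lee_fin (le_trans (vsq_mul_le _ c0 Ac)) //.
  by rewrite ler_wpM2r ?vsq_ge0 // lerDl.
- exact: mxconvolutionB.
Qed.

End Transfer.

Lemma transfer_coef m n (Bh : X -> 'M[C]_(m, n)) :
  (forall i j, fourier_space (fun xi => Bh xi i j)) ->
  exists2 B, mxl2 B & transfer_matrix mu B Bh.
Proof.
move=> WB; exists (fun g => \matrix_(i, j) fourier_coef (fun xi => Bh xi i j) g) => i j.
  have := fourier_coef_l2 mu_haar (WB i j).1; congr l2.
  by apply/funext => g; rewrite mxE.
have := is_fourier_coef mu_haar (WB i j); congr is_fourier.
by apply/funext => g; rewrite mxE.
Qed.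

Section LeftInverses.
Variables (M N : nat) (A : G -> 'M[C]_(M, N)) (Ah : X -> 'M[C]_(M, N)).
Hypothesis A_Ah : transfer_matrix mu A Ah.
Hypothesis Ah_bounded : mxLinfty mu Ah.

Definition gram_det xi : R := complex.Re (\det (conjtrmx (Ah xi) *m Ah xi)).

Lemma gram_fourier_bounded i j : fourier_bounded (fun xi => (conjtrmx (Ah xi) *m Ah xi) i j).
Proof.
have -> : (fun xi => (conjtrmx (Ah xi) *m Ah xi) i j) =
    (fun xi => \sum_k (Ah xi k i)^* * Ah xi k j).
  by apply/funext => xi; rewrite mxE; apply: eq_bigr => k _; rewrite conjtrmxE.
apply: fourier_bounded_sum => k; apply: fourier_boundedM.
  by apply: fourier_bounded_conj; exact: transfer_fourier_bounded.
exact: transfer_fourier_bounded.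
Qed.

Lemma gram_left_inverse : (0 < ess_inf mu (fun xi => (gram_det xi)%:E))%E ->
  exists2 Bh : X -> 'M[C]_(N, M), (forall i j, fourier_bounded (fun xi => Bh xi i j)) &
    \forall xi \ae mu, Bh xi *m Ah xi = 1%:M.
Proof.
move=> inf0; have [delta d0 /ess_infP Ad] : exists2 delta : R, 0 < delta &
    (delta%:E <= ess_inf mu (fun xi => (gram_det xi)%:E))%E.
  case: (ess_inf _ _) inf0 => [r|_|//]; first by rewrite lte_fin => r0; exists r.
  by exists 1 => //; rewrite leey.
pose K xi := conjtrmx (Ah xi) *m Ah xi.
have EK := gram_fourier_bounded.
have Edet : fourier_bounded (fun xi => \det (K xi)) by exact: fourier_bounded_det.
have [|D ED Ddet] := fourier_bounded_inv d0 Edet.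
  by move: Ad; apply: filterS => xi; rewrite lee_fin det_gram_real.
exists (fun xi => D xi *: (\adj (K xi) *m conjtrmx (Ah xi))); last first.
  move: Ddet; apply: filterS => xi DK.
  by rewrite -scalemxAl -mulmxA mul_adj_mx scale_scalar_mx DK.
move=> i j; have -> : (fun xi => (D xi *: (\adj (K xi) *m conjtrmx (Ah xi))) i j) =
    (fun xi => D xi * \sum_(k < N) ((-1) ^+ (k + i) * \det (row' k (col' i (K xi)))) * (Ah xi j k)^*).
  apply/funext => xi; rewrite mxE mxE; congr (_ * _); apply: eq_bigr => k _.
  by rewrite conjtrmxE mxE.
apply: fourier_boundedM => //; apply: fourier_bounded_sum => k; apply: fourier_boundedM.
  apply: fourier_boundedM; first exact: fourier_bounded_cst.
  apply: fourier_bounded_det => a b.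
  have := EK (lift k a) (lift i b); congr fourier_bounded.
  by apply/funext => xi; rewrite !mxE.
by apply: fourier_bounded_conj; exact: transfer_fourier_bounded.
Qed.

Lemma gram_det_lower_bound (c : R) : 0 < c ->
  (\forall xi \ae mu, forall v, c * vsq v <= vsq (Ah xi *m v)) ->
  (0 < ess_inf mu (fun xi => (gram_det xi)%:E))%E.
Proof.
move=> c0 Ac; apply: (@lt_le_trans _ _ (c ^+ N)%:E); first by rewrite lte_fin exprn_gt0.
apply/ess_infP; move: Ac; apply: filterS => xi Ac; rewrite lee_fin.
by apply: det_gram_lower_bound Ac; exact: ltW.
Qed.

(** Pointwise [v] is [Bh] applied to [Ah v], so [|v|^2 <= k |Ah v|^2]. [Bh] is any essentially
    bounded matrix here, not the transform of a sequence. *)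
Lemma left_inverse_lower_bound (Bh : X -> 'M[C]_(N, M)) : mxLinfty mu Bh ->
  (\forall xi \ae mu, Bh xi *m Ah xi = 1%:M) ->
  exists2 c : R, 0 < c & \forall xi \ae mu, forall v, c * vsq v <= vsq (Ah xi *m v).
Proof.
move=> /mxLinfty_ae_bound [b b0 Bb] BA; pose k := N%:R * (M%:R * b) ^+ 2 + 1.
have k0 : 0 < k by rewrite ltr_wpDl // mulr_ge0 // sqr_ge0.
exists k^-1; first by rewrite invr_gt0.
move: Bb BA; apply: filterS2 => xi Bb BA v; rewrite mulrC ler_pdivrMr // mulrC.
rewrite -{1}[v]mul1mx -BA -mulmxA (le_trans (vsq_mul_le _ b0 Bb)) //.
by rewrite ler_wpM2r ?vsq_ge0 // lerDl.
Qed.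

Lemma left_inverse_convolution (B : G -> 'M[C]_(N, M)) Bh : transfer_matrix mu B Bh ->
  mxLinfty mu Bh -> (\forall xi \ae mu, Bh xi *m Ah xi = 1%:M) ->
  forall x, vl2 x -> mxconvolution B (mxconvolution A x) = x.
Proof.
move=> B_Bh Bb BA x x2; have [xh xf] := vfourier_exists x2.
have BAf := vfourier_mxconvolution B_Bh Bb (vfourier_mxconvolution A_Ah Ah_bounded xf).
apply: (vfourier_ae_inj BAf xf).
by move: BA; apply: filterS => xi BA; rewrite mulmxA BA mul1mx.
Qed.

(** Tested on the [N] sequences whose transforms are the constant basis vectors, that is, on the
    delta sequences at 0; each gives one column of the identity outside a null set. *)
Lemma convolution_left_inverse (B : G -> 'M[C]_(N, M)) Bh : transfer_matrix mu B Bh ->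
  mxLinfty mu Bh -> (forall x, vl2 x -> mxconvolution B (mxconvolution A x) = x) ->
  \forall xi \ae mu, Bh xi *m Ah xi = 1%:M.
Proof.
move=> B_Bh Bb BA.
have h (j : 'I_N) : \forall xi \ae mu, Bh xi *m Ah xi *m delta_mx j ord0 = (delta_mx j ord0 : 'cV[C]_N).
  pose dh : X -> 'cV[C]_N := fun=> delta_mx j ord0.
  pose d : G -> 'cV[C]_N := fun g => \col_i fourier_coef (fun xi => dh xi i ord0) g.
  have df : vfourier d dh.
    move=> i; have := is_fourier_coef mu_haar (fourier_space_cst mu (delta_mx j (ord0 : 'I_1) i ord0)).
    by congr is_fourier; apply/funext => g; rewrite [RHS]mxE.
  have := vfourier_mxconvolution B_Bh Bb (vfourier_mxconvolution A_Ah Ah_bounded df).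
  rewrite BA; last exact: vfourier_vl2 df.
  move/vfourier_inj => /(_ _ df); apply: filterS => xi; by rewrite mulmxA.
have : \forall xi \ae mu, forall j, Bh xi *m Ah xi *m delta_mx j ord0 = (delta_mx j ord0 : 'cV[C]_N).
  exact: filter_forall.
apply: filterS => xi {}h; apply/matrixP => i j.
have := congr1 (fun Z : 'cV[C]_N => Z i ord0) (h j).
by rewrite -colE !mxE andbT.
Qed.

End LeftInverses.

End VectorFourier.

(** * Reduction to countably many vectors *)

Section Rational.
Variable R : realType.
Local Notation C := R[i].

Definition rational_vector n (q : 'cV[(rat * rat)%type]_n) : 'cV[C]_n :=
  \col_i Complex (ratr (q i ord0).1) (ratr (q i ord0).2).

Lemma rational_approx n (w : 'cV[C]_n) (e : R) : 0 < e ->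
  exists q, vsq (w - rational_vector q) <= e.
Proof.
move=> e0; pose eta := e / (2 * (n%:R + 1)); pose s := Num.sqrt eta.
have n1 : 0 < n%:R + 1 :> R by rewrite ltr_wpDl.
have eta0 : 0 < eta by rewrite divr_gt0 // mulr_gt0.
have s0 : 0 < s by rewrite sqrtr_gt0.
have approx (a : R) : exists q : rat, (a - ratr q) ^+ 2 <= eta.
  have [|q] := @rat_in_itvoo R (a - s) (a + s); first by rewrite ltrD2l gtrN.
  rewrite in_itv /= => /andP[q1 q2]; exists q.
  rewrite -(sqr_sqrtr (ltW eta0)) -/s -[leLHS]real_normK ?num_real //.
  by rewrite ler_pXn2r ?nnegrE ?(ltW s0) // ler_norml; apply/andP; split; lra.
have /choice [q qP] : forall i, exists q : rat * rat,
    rnorm (w i ord0 - Complex (ratr q.1) (ratr q.2)) ^+ 2 <= 2 * eta.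
  move=> i; have [q1 h1] := approx (complex.Re (w i ord0)).
  have [q2 h2] := approx (complex.Im (w i ord0)); exists (q1, q2).
  by rewrite rnorm_sqr !(cReD, cReN, cImD, cImN) /=; lra.
exists (\col_i q i); apply: (@le_trans _ _ (\sum_(i < n) (2 * eta))).
  by apply: ler_sum => i _; rewrite !mxE.
rewrite sumr_const card_ord -[leLHS]mulr_natl /eta.
have -> : n%:R * (2 * (e / (2 * (n%:R + 1)))) = n%:R / (n%:R + 1) * e by field; rewrite gt_eqF.
by rewrite ger_pMl // ler_pdivrMr // mul1r lerDl.
Qed.

Lemma vsqD_le n (v w : 'cV[C]_n) : vsq (v + w) <= 2 * vsq v + 2 * vsq w.
Proof.
rewrite /vsq !mulr_sumr -big_split /=; apply: ler_sum => i _; rewrite mxE.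
exact: rnorm_sqrD.
Qed.

Lemma vsqN n (v : 'cV[C]_n) : vsq (- v) = vsq v.
Proof. by rewrite -scaleN1r vsqZ rnormN rnorm1 expr1n mul1r. Qed.

(** The 4 comes from two uses of [|x + y|^2 <= 2 |x|^2 + 2 |y|^2]: once to pass from [v] to a
    rational [u], once to return from [A u] to [A v]. *)
Lemma lower_bound_rational m n (A : 'M[C]_(m, n)) (a : R) : 0 < a ->
  (forall q, a * vsq (rational_vector q) <= vsq (A *m rational_vector q)) ->
  forall v, a / 4 * vsq v <= vsq (A *m v).
Proof.
move=> a0 Aq v; pose c := \sum_i \sum_j rnorm (A i j).
have c0 : 0 <= c by apply: sumr_ge0 => i _; apply: sumr_ge0 => j _; exact: rnorm_ge0.
have Ac i j : rnorm (A i j) <= c.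
  rewrite /c (bigD1 i) //= (bigD1 j) //= -addrA lerDl addr_ge0 ?sumr_ge0 // => k _.
    exact: rnorm_ge0.
  by apply: sumr_ge0 => l _; exact: rnorm_ge0.
pose b := m%:R * (n%:R * c) ^+ 2; have b0 : 0 <= b by rewrite mulr_ge0 // sqr_ge0.
apply/ler_addgt0Pr => e e0.
have r0 : 0 < e / (a + b + 1) by rewrite divr_gt0 // ltr_wpDl // addr_ge0 // ltW.
have [q vq] := rational_approx v r0; set u := rational_vector q in vq.
have h1 : vsq v <= 2 * vsq u + 2 * vsq (v - u).
  by rewrite -{1}[v](subrK u) [v - u + u]addrC vsqD_le.
have h2 : vsq (A *m u) <= 2 * vsq (A *m v) + 2 * (b * vsq (v - u)).
  have -> : A *m u = A *m v + - (A *m (v - u)).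
    by rewrite mulmxBr opprB addrCA subrr addr0.
  rewrite (le_trans (vsqD_le _ _)) // vsqN lerD2l ler_pM2l //.
  exact: vsq_mul_le.
have h3 := Aq q; rewrite -/u in h3.
have h4 : (a + b + 1) * vsq (v - u) <= e.
  by rewrite mulrC -ler_pdivlMr // ltr_wpDl // addr_ge0 // ltW.
have h5 : a * vsq v <= 2 * (a * vsq u) + 2 * (a * vsq (v - u)).
  by rewrite !(mulrCA 2) -mulrDr ler_pM2l.
have h6 := vsq_ge0 (v - u).
have : a / 4 * vsq v = a * vsq v / 4 by rewrite mulrAC.
have : (a + b + 1) * vsq (v - u) = a * vsq (v - u) + b * vsq (v - u) + vsq (v - u) by ring.
have : 0 <= b * vsq (v - u) by exact: mulr_ge0.
have : 0 <= a * vsq (v - u) by rewrite mulr_ge0 // ltW.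
lra.
Qed.

End Rational.

(** * From bounds on sequences to bounds on transfer matrices *)

Section Equivalences.
Variables (R : realType) (G : zmodType) (mu : probability (borel_dual R G) R).
Hypothesis mu_haar : haar_measure mu.
Local Notation C := R[i].
Local Notation X := (borel_dual R G).
Local Notation sqint := (@sqint R G mu).
Local Notation fourier_bounded := (@fourier_bounded R G mu).

Section LowerBound.
Variables (M N : nat) (A : G -> 'M[C]_(M, N)) (Ah : X -> 'M[C]_(M, N)).
Hypothesis A_Ah : transfer_matrix mu A Ah.
Hypothesis Ah_bounded : mxLinfty mu Ah.

Lemma convolution_lower_bound_at (a : R) (v : 'cV[C]_N) : 0 < a ->
  (forall x, vl2 x -> (a%:E * vl2norm2 x <= vl2norm2 (mxconvolution A x))%E) ->
  \forall xi \ae mu, a * vsq v <= vsq (Ah xi *m v).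
Proof.
move=> a0 Aa; apply: ae_lower_bound; first by rewrite mulr_ge0 ?vsq_ge0 // ltW.
- by move=> xi; exact: vsq_ge0.
- pose u i xi : C := \sum_j Ah xi i j * cst (v j ord0) xi.
  have Eu i : fourier_bounded (u i).
    apply: fourier_bounded_sum => j; apply: fourier_boundedM; last exact: fourier_bounded_cst.
    exact: transfer_fourier_bounded.
  have -> : (fun xi => (vsq (Ah xi *m v))%:C%C) = (fun xi => \sum_i u i xi * (u i xi)^*).
    apply/funext => xi; rewrite rmorph_sum; apply: eq_bigr => i _.
    by rewrite mul_conj_rnorm /= mxE.
  apply: fourier_bounded_sum => i; apply: fourier_boundedM => //.
  exact: fourier_bounded_conj.
move=> p Ep; pose ph xi : 'cV[C]_N := p xi *: v.
have Wph i : fourier_space mu (fun xi => ph xi i ord0).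
  have -> : (fun xi => ph xi i ord0) = (fun xi => v i ord0 * p xi).
    by apply/funext => xi; rewrite mxE mulrC.
  by apply: fourier_spaceZ; case: Ep.
pose x g : 'cV[C]_N := \col_i fourier_coef mu (fun xi => ph xi i ord0) g.
have xf : vfourier mu x ph.
  move=> i; have := is_fourier_coef mu_haar (Wph i); congr is_fourier.
  by apply/funext => g; rewrite mxE.
have mp2 := cmeasurable_sqr Ep.1.1.1.
have := Aa x (vfourier_vl2 mu_haar xf).
rewrite (vfourier_parseval mu_haar xf).
rewrite (vfourier_parseval mu_haar (vfourier_mxconvolution mu_haar A_Ah Ah_bounded xf)).
have -> : (\int[mu]_xi (vsq (ph xi))%:E = (vsq v)%:E * sqint p)%E.
  rewrite /sqint -ge0_integralZl_EFin ?vsq_ge0 //.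
    by apply: eq_integral => xi _; rewrite vsqZ mulrC.
  by move=> xi _; rewrite lee_fin sqr_ge0.
rewrite muleA -EFinM => /le_trans; apply; rewrite le_eqVlt; apply/orP; left; apply/eqP.
by apply: eq_integral => xi _; rewrite -scalemxAr vsqZ mulrC.
Qed.

Lemma convolution_lower_bound (a : R) : 0 < a ->
  (forall x, vl2 x -> (a%:E * vl2norm2 x <= vl2norm2 (mxconvolution A x))%E) ->
  (0 < ess_inf mu (fun xi => (gram_det Ah xi)%:E))%E.
Proof.
move=> a0 Aa; apply: (@gram_det_lower_bound _ _ _ _ _ _ (a / 4)); first by rewrite divr_gt0.
(* Rational vectors are enumerated by their codes, so that countably many almost everywhere
   statements can be intersected; a number that encodes no vector imposes nothing. *)
have : \forall xi \ae mu, forall k : nat, if choice.unpickle k is Some q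
    then a * vsq (rational_vector R (q : 'cV[(rat * rat)%type]_N)) <= vsq (Ah xi *m rational_vector R q) else true.
  apply: ae_foralln => k; case: (choice.unpickle k) => [q|]; last exact: aeW.
  exact: convolution_lower_bound_at.
apply: filterS => xi h; apply: lower_bound_rational => // q.
by have := h (choice.pickle q); rewrite choice.pickleK.
Qed.

End LowerBound.

(** Each entry has a transform [F] by Riesz-Fischer; its boundedness is the issue. Feeding a scalar
    sequence into slot [m] and reading component [n] shows that [F] multiplies trigonometric
    polynomials boundedly, which is the multiplier hypothesis. *)
Lemma synthesis_transfer (M N : nat) (B : G -> 'M[C]_(N, M)) (k : R) : 0 < k -> mxl2 B ->
  (forall y J, (l2norm2 (flatten_vec (mxconvolution B (unflatten_vec (cutoff J y)))) <=
     (k * sqsum y J)%:E)%E) ->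
  exists2 Bh, transfer_matrix mu B Bh & mxLinfty mu Bh.
Proof.
move=> k0 B2 Bk.
have Bnm n m : exists F, is_fourier mu (fun g => B g n m) F /\ Linfty mu F.
  have [F BF] := riesz_fischer mu_haar (B2 n m); exists F; split => //.
  have [WF eF] := is_fourier_space mu_haar BF.
  apply/LinftyP; split; first exact: WF.1.1.
  apply: (@multiplier_bounded _ _ _ mu_haar F k) => // x J.
  have WFt := fourier_space_mul_trig x J WF.
  rewrite -(is_fourier_parseval mu_haar (is_fourier_coef mu_haar WFt)).
  rewrite N2E ?N2_trig //; last exact: trig_L2.
  (* [y] ignores the slot; truncation to [J'] is what selects [m]. *)
  pose J' := [fset (h, m) | h in J]%fset; pose y (q : G * 'I_M) := x q.1.
  have <- : sqsum y J' = sqsum x J by rewrite /sqsum big_imfset //= => g h _ _ [].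
  apply: le_trans (Bk y J'); rewrite -vl2norm2E /vl2norm2 (bigD1 n) //=.
  rewrite -[leLHS]adde0 leeD ?sume_ge0 // => [|i _]; last exact: l2norm2_ge0.
  rewrite le_eqVlt; apply/orP; left; apply/eqP; congr l2norm2; apply/funext => g.
  have := mxconvolution_cutoff B J' y (g, n); rewrite /flatten_vec /= => ->.
  rewrite fourier_coef_mul_trig ?big_imfset //=; [|by move=> g1 g2 _ _ []|by case: WF].
  apply: eq_bigr => h _; rewrite /translate /column /y /= mulrC; congr (_ * _).
  exact: (esym (congr1 (@^~ (g - h)) eF)).
have /choice [F FP] n : exists F : 'I_M -> X -> C, forall m,
    is_fourier mu (fun g => B g n m) (F m) /\ Linfty mu (F m).
  by have /choice [F FP] := Bnm n; exists F.
exists (fun xi => \matrix_(n, m) F n m xi) => n m; have [h1 h2] := FP n m.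
  by move: h1; congr is_fourier; apply/funext => xi; rewrite mxE.
by move: h2; congr (Linfty mu _); apply/funext => xi; rewrite mxE.
Qed.

End Equivalences.

(** * The equivalences and the form of the reconstruction elements *)

Lemma gram_transfer_inverse (R : realType) (G : zmodType)
    (mu : probability (borel_dual R G) R) (M N : nat) (A : G -> 'M[R[i]]_(M, N))
    (Ah : borel_dual R G -> 'M[R[i]]_(M, N)) :
  haar_measure mu -> transfer_matrix mu A Ah -> mxLinfty mu Ah ->
  (0 < ess_inf mu (fun xi => (gram_det Ah xi)%:E))%E ->
  exists B Bh, [/\ mxl2 B, transfer_matrix mu B Bh, mxLinfty mu Bh &
    \forall xi \ae mu, Bh xi *m Ah xi = 1%:M].
Proof.
move=> mu_haar A_Ah Ab inf0; have [Bh EB BA] := gram_left_inverse mu_haar A_Ah Ab inf0.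
have [B B2 B_Bh] := transfer_coef mu_haar (fun i j => (EB i j).1).
exists B, Bh; split => // i j; apply/LinftyP; have [WB Bc] := EB i j; split => //.
exact: WB.1.1.
Qed.

Lemma synthesis_lower_bound_gram (R : realType) (G : zmodType)
    (mu : probability (borel_dual R G) R) (H : completeNormedModType R[i])
    (U : G -> H -> H) (N M : nat) (phi : 'I_N -> H)
    (T : (G * 'I_N -> R[i]) -> H) (c d : R)
    (A : G -> 'M[R[i]]_(M, N)) (Ah : borel_dual R G -> 'M[R[i]]_(M, N)) (alpha : R) :
  haar_measure mu -> transfer_matrix mu A Ah -> mxLinfty mu Ah ->
  synthesis_operator (orbit_family U phi) T c d -> 0 < alpha ->
  (forall x f, vl2 x -> synthesis U phi x f ->
     ((alpha * rnorm f ^+ 2)%:E <= vl2norm2 (mxconvolution A x))%E) ->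
  (0 < ess_inf mu (fun xi => (gram_det Ah xi)%:E))%E.
Proof.
move=> mu_haar A_Ah Ab synT alpha0 Aalpha; have [c0 _ _ Tb _] := synT.
apply: (convolution_lower_bound mu_haar A_Ah Ab (mulr_gt0 alpha0 c0)) => x x2.
have fx2 := (vl2P x).1 x2; have /andP[cT _] := Tb _ fx2.
apply: le_trans (Aalpha x _ x2 ((synthesisP synT _ x2).2 erefl)).
by rewrite vl2norm2E l2nE // -EFinM lee_fin -mulrA ler_pM2l.
Qed.

Theorem theorem1 (R : realType)
  (G : zmodType) (G_countable : countable [set: G])
  (mu : probability (borel_dual R G) R) (mu_haar : haar_measure mu)
  (H : completeNormedModType R[i]) (ip : {dot H for Num.conj})
  (ip_norm : forall v, ip v v = `|v| ^+ 2)
  (H_separable : exists2 D : set H, countable D & dense D)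
  (U : G -> H -> H) (U_rep : unitary_representation ip U)
  (N M : nat) (N_gt0 : (0 < N)%N) (M_gt0 : (0 < M)%N)
  (phi : 'I_N -> H) (phi_riesz : riesz_sequence (orbit_family U phi))
  (A : G -> 'M[R[i]]_(M, N)) (A_l2 : mxl2 A)
  (Ahat : borel_dual R G -> 'M[R[i]]_(M, N))
  (Ahat_A : transfer_matrix mu A Ahat) (Ahat_bounded : mxLinfty mu Ahat) :
  [<->
    (* (a) *)
    (0 < ess_inf mu
           (fun xi => (complex.Re (\det (conjtrmx (Ahat xi) *m Ahat xi)))%:E))%E;
    (* (b) *)
    exists alpha beta : R, [/\ 0 < alpha, alpha <= beta &
      forall x f, vl2 x -> synthesis U phi x f ->
        ((alpha * rnorm f ^+ 2)%:E <=
           \sum_(m < M) \esum_(g in [set: G])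
             (rnorm (mxconvolution A x g m ord0) ^+ 2)%:E /\
         \sum_(m < M) \esum_(g in [set: G])
             (rnorm (mxconvolution A x g m ord0) ^+ 2)%:E <=
           (beta * rnorm f ^+ 2)%:E)%E];
    (* (c) *)
    exists2 Bhat : borel_dual R G -> 'M[R[i]]_(N, M), mxLinfty mu Bhat &
      \forall xi \ae mu, Bhat xi *m Ahat xi = 1%:M;
    (* (d), first form *)
    exists B Bhat, [/\ mxl2 B, transfer_matrix mu B Bhat, mxLinfty mu Bhat &
      forall x f, vl2 x -> synthesis U phi x f ->
        x = mxconvolution B (mxconvolution A x)];
    (* (d), second form *)
    exists2 T : (G -> 'cV[R[i]]_M) -> (G -> 'cV[R[i]]_N),
      bounded_convolution_operator mu T &
      forall x, vl2 x -> T (mxconvolution A x) = x;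
    (* (e) *)
    exists S : 'I_M -> H, [/\ forall m, VPhi U phi (S m),
      frame ip (VPhi U phi) (orbit_family U S) &
      reconstructs U phi A (orbit_family U S)];
    (* (f) *)
    exists2 S : G * 'I_M -> H,
      frame ip (VPhi U phi) S & reconstructs U phi A S
  ] /\
  (forall S : 'I_M -> H, (forall m, VPhi U phi (S m)) ->
     frame ip (VPhi U phi) (orbit_family U S) ->
     reconstructs U phi A (orbit_family U S) ->
     exists B Bhat, [/\ mxl2 B, transfer_matrix mu B Bhat, mxLinfty mu Bhat,
       (\forall xi \ae mu, Bhat xi *m Ahat xi = 1%:M) &
       forall m, synthesis U phi (fun g => col m (B g)) (S m)]).
Proof.
have [T [c [d synT]]] := riesz_synthesis_operator phi_riesz.
have [a Aa] := transfer_bounded_convolution mu_haar Ahat_A Ahat_bounded.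
have [c0 d0 _ Tb _] := synT; have [a0 Abound _] := Aa.
have A_vl2 x : vl2 x -> vl2 (mxconvolution A x) by move=> /Abound [].
have gram_inv := gram_transfer_inverse mu_haar Ahat_A Ahat_bounded.
split; last first.
  move=> S SV Sframe Srec.
  (* The Riesz coefficients of [S m] are the only candidate for column [m] of [B]. *)
  have /choice [z zP] m : exists z, l2 z /\ S m = T z.
    by have /(VPhiP synT) [z z2 Sz] := SV m; exists z.
  pose B g : 'M[R[i]]_(N, M) := \matrix_(n, m) z m (g, n).
  have colB m : column B m = z m by apply/funext => -[g n]; rewrite /column mxE.
  have eS : S = fun m => T (column B m) by apply/funext => m; rewrite colB (zP m).2.
  have B2 : mxl2 B.
    move=> n m; have z2 : vl2 (unflatten_vec (z m)).
      by apply/vl2P; rewrite unflatten_vecK; exact: (zP m).1.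
    by have := z2 n; congr l2; apply/funext => g; rewrite !mxE.
  (* The Bessel bound of the orbit frame controls [B] on finitely supported sequences, whence [Bhat]
     is essentially bounded; after that, [B] may be composed with the convolution by [A]. *)
  have [b b0 Sb] := frame_synthesis_bound ip_norm Sframe
    (fun y J => VPhi_sum synT y J (fun q => orbit_VPhi ip_norm U_rep synT q SV)).
  rewrite eS in Sb Srec.
  have Bk := synthesis_bound_convolution ip_norm U_rep synT B2 Sb.
  have [Bhat B_Bhat Bhat_bounded] := synthesis_transfer mu_haar (divr_gt0 b0 c0) B2 Bk.
  have [b' Bb] := transfer_bounded_convolution mu_haar B_Bhat Bhat_bounded.
  exists B, Bhat; split => //.
    apply: (convolution_left_inverse mu_haar Ahat_A Ahat_bounded B_Bhat Bhat_bounded).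
    move=> x x2; exact: (reconstructs_left_inverse ip_norm U_rep synT B2 Aa Bb Srec x2).
  have flatB m : flatten_vec (fun g => col m (B g)) = column B m.
    by apply/funext => -[g n]; rewrite /flatten_vec /column mxE.
  move=> m; have m2 : vl2 (fun g => col m (B g)) by apply/vl2P; rewrite flatB; exact: column_l2.
  by apply/(synthesisP synT _ m2); rewrite flatB eS.
tfae.
- move=> /gram_inv [B [Bhat [B2 B_Bhat Bhat_bounded BA]]].
  have [b Bb] := transfer_bounded_convolution mu_haar B_Bhat Bhat_bounded.
  have BAx := left_inverse_convolution mu_haar Ahat_A Ahat_bounded B_Bhat Bhat_bounded BA.
  have [b0 Bbound _] := Bb; have db0 : 0 < d * b by rewrite mulr_gt0.
  (* Below: [|f|^2 <= d |x|^2], and [x] is recovered from the samples by a convolution of squared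
     norm at most [b]. Above: [a] bounds the convolution by [A], and [c |x|^2 <= |f|^2]. *)
  exists (d * b)^-1, (Num.max (d * b)^-1 (a / c)); split; first by rewrite invr_gt0.
    by rewrite le_max lexx.
  move=> x f x2 xf; have Ax2 := A_vl2 x x2; split; last first.
    apply: (le_trans (samples_bound synT Aa x2 xf)).
    by rewrite lee_fin ler_wpM2r ?sqr_ge0 // le_max lexx orbT.
  rewrite -/(vl2norm2 (mxconvolution A x)); have [_] := Bbound _ Ax2; rewrite BAx //.
  have fx2 := (vl2P x).1 x2; have fAx2 := (vl2P _).1 Ax2.
  rewrite !vl2norm2E !l2nE // -EFinM !lee_fin => h.
  have /andP[_ Td] := Tb _ fx2; rewrite ((synthesisP synT f x2).1 xf).
  by rewrite mulrC ler_pdivrMr // (le_trans Td) // [leRHS]mulrC -mulrA ler_pM2l.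
- move=> [alpha [beta [alpha0 _ Ab]]].
  have /gram_inv [B [Bhat [B2 B_Bhat Bhat_bounded BA]]] :=
    synthesis_lower_bound_gram mu_haar Ahat_A Ahat_bounded synT alpha0
      (fun x f x2 xf => (Ab x f x2 xf).1).
  by exists Bhat.
- move=> [Bhat0 Bhat0_bounded BA0].
  (* [Bhat0] is merely essentially bounded and no sequence is attached to it. It serves to bound
     [Ahat] below, after which the Gram inverse, whose entries are transforms, takes its place. *)
  have [k k0 Ak] := left_inverse_lower_bound Bhat0_bounded BA0.
  have /gram_inv [B [Bhat [B2 B_Bhat Bhat_bounded BA]]] := gram_det_lower_bound k0 Ak.
  exists B, Bhat; split => // x f x2 _; apply/esym.
  exact: (left_inverse_convolution mu_haar Ahat_A Ahat_bounded B_Bhat Bhat_bounded BA x2).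
- move=> [B [Bhat [B2 B_Bhat Bhat_bounded BA]]].
  have [b [_ Bb _]] := transfer_bounded_convolution mu_haar B_Bhat Bhat_bounded.
  exists (mxconvolution B); first split.
  + by move=> y /Bb [].
  + by exists b => y /Bb [].
  + by exists B, Bhat.
  by move=> x x2; rewrite -(BA x _ x2 ((synthesisP synT _ x2).2 erefl)).
- move=> [L [_ _ [B [Bhat [B2 B_Bhat Bhat_bounded LB]]]] LA].
  have BA x : vl2 x -> mxconvolution B (mxconvolution A x) = x.
    by move=> x2; rewrite -LB ?LA //; exact: A_vl2.
  have [b Bb] := transfer_bounded_convolution mu_haar B_Bhat Bhat_bounded.
  exists (fun m => T (column B m)); split.
  + by move=> m; apply: (columns_VPhi synT B2).
  + exact: (left_inverse_frame ip_norm U_rep synT B2 Aa Bb BA).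
  + exact: (left_inverse_reconstructs ip_norm U_rep synT B2 Aa Bb BA).
- by move=> [S [_ Sframe Srec]]; exists (orbit_family U S).
- move=> [S Sframe Srec].
  (* This frame need not be an orbit, so no matrix [B] is available; its Bessel bound and the
     expansion of [f] bound the samples below, and this gives (a). *)
  have [b b0 Sb] := frame_synthesis_bound ip_norm Sframe
    (fun y J => VPhi_sum synT y J Sframe.1).
  have bi0 : 0 < b^-1 by rewrite invr_gt0.
  apply: (synthesis_lower_bound_gram mu_haar Ahat_A Ahat_bounded synT bi0) => x f x2 xf.
  exact: (synthesis_lower_bound Srec b0 Sb x2 xf (A_vl2 x x2)).
Qed.
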